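(* (1) For every prime $m\geq 2$, there exist infinitely many Ramanujan-type congruences of $b_4(n)$ modulo $m$. (2) For every prime $m\geq 5$, there exist infinitely many Ramanujan-type congruences of $b_6(n)$ modulo $m$.
   Context: For a positive integer $k$, $b_k(n)$ denotes the number of partitions of $n$ in which no part is a multiple of $k$ ($k$-regular partitions), with $b_k(0)=1$ and $b_k(n)=0$ if $n\notin\mathbb{Z}_{\geq 0}$; equivalently $\sum_{n\geq 0} b_k(n)q^n=\prod_{n\geq 1}\frac{1-q^{kn}}{1-q^n}$. A Ramanujan-type congruence of $b_k(n)$ modulo $m$ is a congruence of the form $b_k(An+B)\equiv 0 \pmod m$ holding for all integers $n\geq 0$, where $A\geq 1$ and $B\geq 0$ are fixed integers; ''infinitely many'' means infinitely many distinct pairs $(A,B)$. *)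

(* Defs.v *)
From mathcomp Require Import all_boot.
From mathcomp Require Import boolp classical_sets cardinality.

Set Implicit Arguments.
Unset Strict Implicit.
Unset Printing Implicit Defensive.

Local Open Scope nat_scope.

(* A partition of n is encoded by its multiplicities: f i is the number of
   parts equal to i.+1.  Every part and every multiplicity is at most n, so
   the types 'I_n and 'I_n.+1 lose nothing. *)
Definition is_partition (n : nat) (f : {ffun 'I_n -> 'I_n.+1}) : bool :=
  \sum_(i < n) f i * i.+1 == n.

Definition k_regular (k n : nat) (f : {ffun 'I_n -> 'I_n.+1}) : bool :=
  [forall i : 'I_n, (0 < f i) ==> ~~ (k %| i.+1)].

Definition b (k n : nat) : nat :=
  #|[set f : {ffun 'I_n -> 'I_n.+1} | is_partition f && k_regular k f]|.

Definition ramanujan_congruence (k m A B : nat) : Prop :=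
  forall n : nat, b k (A * n + B) = 0 %[mod m].

Definition infinitely_many_ramanujan_congruences (k m : nat) : Prop :=
  infinite_set
    [set AB : nat * nat | 1 <= AB.1 /\ ramanujan_congruence k m AB.1 AB.2]%classic.

(* Main.v *)
Require Import Defs.
From HB Require Import structures.
From mathcomp Require Import all_boot all_order all_fingroup all_algebra all_field.
From mathcomp Require Import zify ring lra.
From mathcomp Require Import boolp classical_sets cardinality.

(** Fix a prime m and work with power series over F_m.  Up to sign, the generating
    function of b_4 is psi(q)/phi(q), and that of b_6 is an eta quotient; both are
    algebraic over the field generated by the parameter alpha (for 4) or p (for 6) of
    the theta functions.  The logarithmic differential of this parameter is a weight
    two form which, by the Hasse invariant identity, is an m^2-th power times a
    polynomial, so the Cartier operator turns the coefficients at the indices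
    m^2 n + s into a form of half-integral or integral weight, which is a
    combination of products of theta series of positive definite integral forms.

    Theta series with periodic weights on the lattices of fixed determinant are
    permuted by Kneser p-neighbours, and there are finitely many of them up to
    isometry.  The resulting p^2-Hecke recursion over a finite field is periodic,
    which forces the coefficients at p^(2s-1) n, p not dividing n, to vanish for a
    suitable s.  Restricting to a residue class modulo p^(2s) gives a congruence;
    its sub-progressions are infinitely many. *)

Set Implicit Arguments.
Unset Strict Implicit.
Unset Printing Implicit Defensive.
Import Order.TTheory GRing.Theory Num.Theory.
Local Open Scope ring_scope.

(** The square of m appears because of the eta multipliers: G(q) = 2 sum b_4(n) (-q)^n satisfies q
    G^8 = 16 alpha, and for b_6 the series q^5 G^24 is a rational function of p. As m^2 is 8s + 1,
    respectively 24s + 1, for the odd m concerned, Frobenius writes G(q^(m^2)) = G^(m^2) as G times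
    a function of the parameter, up to a power of q, so the extraction of coefficients only meets
    polynomials in the parameter. Holomorphy at the cusps, needed to reach theta series, becomes a
    degree bound on the resulting polynomial. The differential equation of alpha and the Hasse
    identity come from Landen's transformation: the two sides of each change alike under q -> q^2,
    and a series fixed by q -> q^2 is constant. On the lattice side, p = 1 modulo the period N keeps
    weights unchanged under w -> p w, and the relation is used only at n divisible by p, where every
    vector of norm n is isotropic modulo p; thus all ranks are treated alike. The recursion can be
    run backwards because its last coefficient is a power of p, and it starts from the pair (c(p n),
    0); periodicity brings that zero back. *)

Definition bform (R : comNzRingType) n (G : 'M[R]_n) (u v : 'rV[R]_n) : R :=
  (u *m G *m v^T) 0 0.
Definition qform (R : comNzRingType) n (G : 'M[R]_n) (v : 'rV[R]_n) : R :=
  bform G v v.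

(** * Bilinear and quadratic forms given by Gram matrices *)

Section BilinearForms.
Variables (R : comNzRingType) (n : nat).
Implicit Types (G U : 'M[R]_n) (u v w : 'rV[R]_n).

Lemma bformDl G u v w : bform G (u + v) w = bform G u w + bform G v w.
Proof. by rewrite /bform !mulmxDl mxE. Qed.

Lemma bformDr G u v w : bform G u (v + w) = bform G u v + bform G u w.
Proof. by rewrite /bform linearD mulmxDr mxE. Qed.

Lemma bformZl G a u v : bform G (a *: u) v = a * bform G u v.
Proof. by rewrite /bform -!scalemxAl mxE. Qed.

Lemma bformZr G a u v : bform G u (a *: v) = a * bform G u v.
Proof. by rewrite /bform linearZ -!scalemxAr mxE. Qed.

Lemma bformC G u v : G^T = G -> bform G u v = bform G v u.
Proof.
move=> sG; rewrite /bform -[in RHS]sG.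
have -> : v *m G^T *m u^T = (u *m G *m v^T)^T by rewrite !trmx_mul trmxK mulmxA.
by rewrite [RHS]mxE.
Qed.

Lemma qformD G u v : G^T = G ->
  qform G (u + v) = qform G u + 2 * bform G u v + qform G v.
Proof.
by move=> sG; rewrite /qform bformDl !bformDr (bformC v u sG); ring.
Qed.

Lemma qformZ G a v : qform G (a *: v) = a ^+ 2 * qform G v.
Proof. by rewrite /qform bformZl bformZr; ring. Qed.

Lemma bform_mul k (G : 'M[R]_n) (Y : 'M[R]_(k, n)) (u v : 'rV[R]_k) :
  bform G (u *m Y) (v *m Y) = bform (Y *m G *m Y^T) u v.
Proof. by rewrite /bform trmx_mul !mulmxA. Qed.

Lemma bform_row G U i j :
  bform G (row i U) (row j U) = (U *m G *m U^T) i j.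
Proof.
rewrite /bform -row_mul.
rewrite [LHS]mxE [RHS]mxE; apply: eq_bigr => k _; by rewrite !mxE.
Qed.

Lemma bformE G u v : bform G u v = \sum_j (u *m G) 0 j * v 0 j.
Proof. by rewrite /bform mxE; apply: eq_bigr => j _; rewrite [v^T _ _]mxE. Qed.

End BilinearForms.

Lemma bform_map (R S : comNzRingType) (f : {rmorphism R -> S}) n
  (G : 'M[R]_n) u v : bform (map_mx f G) (map_mx f u) (map_mx f v) = f (bform G u v).
Proof. by rewrite /bform map_trmx -!map_mxM mxE. Qed.

(** * Positive definite integral forms and Hermite reduction *)

Definition posdef n (G : 'M[int]_n) : Prop :=
  G^T = G /\ (forall v : 'rV[int]_n, v != 0 -> 0 < qform G v).

(** This is the Smith normal form of a single row: the left unit times the only elementary divisor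
    is [g], and the right unimodular factor is the completed basis. *)
Lemma primitive_completion n (v : 'rV[int]_n.+1) :
  exists g : int, exists2 U : 'M[int]_n.+1, U \in unitmx & v = g *: row 0 U.
Proof.
have [L uL [R uR [d _ ->]]] := int_Smith_normal_form v.
exists (L 0 0 * d`_0); exists R => //.
apply/rowP => j; rewrite [LHS]mxE [RHS]mxE [row 0 R 0 j]mxE.
rewrite (bigD1 ord0) //= big1 ?addr0.
  by rewrite !mxE big_ord1 mxE /= mulr1n.
move=> k k0; rewrite mxE big_ord1 mxE /=.
suff -> : (0%N == k :> nat) = false by rewrite mulr0n mulr0 mul0r.
by apply/negbTE; apply: contra k0 => /eqP k0; apply/eqP/val_inj.
Qed.

Lemma unitmx_row_neq0 n (U : 'M[int]_n.+1) i : U \in unitmx -> row i U != 0.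
Proof.
move=> uU; apply/eqP => r0.
have: row i (U *m invmx U) = 0 by rewrite row_mul r0 mul0mx.
rewrite mulmxV // => /rowP/(_ i); rewrite !mxE eqxx => /eqP.
by rewrite oner_eq0.
Qed.

Lemma posdef_congr n (G U : 'M[int]_n) : U \in unitmx -> posdef G ->
  posdef (U *m G *m U^T).
Proof.
move=> uU [sG pG]; split; first by rewrite !trmx_mul trmxK sG mulmxA.
move=> v v0; rewrite /qform -bform_mul; apply: pG.
apply: contra v0 => /eqP v0; rewrite -[v]mulmx1 -(mulmxV uU) mulmxA v0.
by rewrite mul0mx.
Qed.

Lemma det_congr n (G U : 'M[int]_n) : U \in unitmx ->
  \det (U *m G *m U^T) = \det G.
Proof.
rewrite unitmxE !det_mulmx det_tr qualifE /= => /orP[] /eqP ->; ring.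
Qed.

Lemma posdef_minimal n (G : 'M[int]_n.+1) : posdef G ->
  exists v : 'rV[int]_n.+1, v != 0 /\
    (forall w : 'rV[int]_n.+1, w != 0 -> qform G v <= qform G w).
Proof.
move=> [sG pG].
pose P k := `[< exists v : 'rV[int]_n.+1, v != 0 /\ qform G v = k%:Z >].
have exP : exists k, P k.
  pose e : 'rV[int]_n.+1 := const_mx 1.
  have e0 : e != 0.
    by apply/eqP => /rowP/(_ 0); rewrite !mxE => /eqP; rewrite oner_eq0.
  exists `|qform G e|%N; apply/asboolP; exists e; split=> //.
  by have := pG _ e0; lia.
case: (ex_minnP exP) => k /asboolP[v [v0 qv]] kmin.
exists v; split=> // w w0; rewrite qv.
have qw := pG _ w0.
have: (k <= `|qform G w|)%N by apply: kmin; apply/asboolP; exists w; split=> //; lia.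
by lia.
Qed.

(** A minimal vector is [g] times a primitive one, and g^2 >= 1, so the primitive vector is minimal
    as well and can serve as the first vector of a basis. *)
Lemma posdef_minimal_row n (G : 'M[int]_n.+1) : posdef G ->
  exists2 U : 'M[int]_n.+1, U \in unitmx &
    forall w : 'rV[int]_n.+1, w != 0 -> qform G (row 0 U) <= qform G w.
Proof.
move=> pG; have [v [v0 vmin]] := posdef_minimal pG.
have [g [U uU vE]] := primitive_completion v; exists U => // w w0.
apply: le_trans (vmin _ w0); rewrite vE qformZ.
have := pG.2 _ (unitmx_row_neq0 0 uU).
have g0 : g != 0 by apply: contra v0 => /eqP g0; rewrite vE g0 scale0r.
have g1 : 0 < g ^+ 2 by rewrite exprn_even_gt0.
by move=> q0; rewrite -[leLHS]mul1r ler_wpM2r //; lia.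
Qed.

Section Schur.
Variables (n : nat) (mu : int) (b : 'rV[int]_n) (H : 'M[int]_n).

Definition bordered : 'M[int]_(1 + n) := block_mx mu%:M b b^T H.
(** The usual Schur complement multiplied by [mu], which keeps the entries integral. *)
Definition schur : 'M[int]_n := mu *: H - b^T *m b.

Lemma bordered00 : bordered 0 0 = mu.
Proof.
have -> : (0 : 'I_(1 + n)) = lshift n 0 by apply/val_inj.
by rewrite block_mxEul mxE.
Qed.

Lemma bordered_norm_le (C : int) : `|mu| <= C ->
  (forall j, `|b 0 j| <= C) -> (forall i j, `|H i j| <= C) ->
  forall i j, `|bordered i j| <= C.
Proof.
move=> hmu hb hH i j.
case: (split_ordP i) => i' ->; case: (split_ordP j) => j' ->.
- by rewrite block_mxEul mxE !ord1 eqxx.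
- by rewrite block_mxEur ord1.
- by rewrite block_mxEdl mxE ord1.
by rewrite block_mxEdr.
Qed.

Lemma schur_qform (x : int) (y : 'rV[int]_n) :
  mu * qform bordered (row_mx x%:M y) =
    (mu * x + (b *m y^T) 0 0) ^+ 2 + qform schur y.
Proof.
have e : y *m b^T = ((b *m y^T) 0 0)%:M.
  by rewrite -[y *m b^T]trmxK trmx_mul trmxK {1}[b *m y^T]mx11_scalar tr_scalar_mx.
have -> : qform bordered (row_mx x%:M y) =
    mu * x ^+ 2 + 2 * x * (b *m y^T) 0 0 + qform H y.
  rewrite /qform /bform /bordered mul_row_block tr_row_mx mul_row_col.
  rewrite e tr_scalar_mx !mul_scalar_mx mulmxDl -!scalemxAl !mul_mx_scalar.
  rewrite mulmxDl -scalemxAl; move: (b *m y^T) (y *m H *m y^T) => C D.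
  by rewrite !mxE /= !mulr1n; ring.
have -> : qform schur y = mu * qform H y - ((b *m y^T) 0 0) ^+ 2.
  rewrite /qform /bform /schur mulmxBr mulmxBl -scalemxAr -scalemxAl mulmxA e.
  rewrite mul_scalar_mx -scalemxAl; move: (b *m y^T) (y *m H *m y^T) => C D.
  by rewrite !mxE expr2.
ring.
Qed.

Lemma schur_posdef : 0 < mu -> posdef bordered -> posdef schur.
Proof.
move=> mu0 [sG pG]; split.
  rewrite /schur linearB linearZ /= trmx_mul trmxK; congr (_ *: _ - _).
  by move: sG; rewrite /bordered tr_block_mx => /eq_block_mx[].
(* This choice of the first coordinate, after scaling y by [mu], makes the square in [schur_qform]
   vanish. *)
move=> y y0; have := schur_qform (- (b *m y^T) 0 0) (mu *: y).
rewrite qformZ linearZ -scalemxAr [X in mu * - _ + X]mxE mulrN addNr expr0n add0r.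
have : row_mx (- (b *m y^T) 0 0)%:M (mu *: y) != 0.
  apply: contra y0; rewrite -row_mx0 => /eqP/eq_row_mx[_ /eqP].
  by rewrite scalemx_eq0 gt_eqF.
move=> /pG; move: (qform _ _) (qform _ _) => s t; nia.
Qed.

Lemma schur_det : 0 < mu -> \det schur * mu = mu ^+ n * \det bordered.
Proof.
move=> mu0.
have: \det (block_mx 1%:M 0 (- b^T) mu%:M *m bordered) = \det (block_mx mu%:M b 0 schur).
  congr (\det _); rewrite /bordered mulmx_block !mul1mx !mul0mx !addr0.
  congr block_mx; first by rewrite mul_mx_scalar mul_scalar_mx scalerN addNr.
  by rewrite mul_scalar_mx mulNmx /schur addrC.
rewrite det_mulmx det_lblock det_ublock !det_scalar1 det_scalar mul1r => ->.
by rewrite mulrC.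
Qed.

(** Translating by multiples of the first basis vector makes the square in [schur_qform] at most
    mu^2/4, while minimality makes the left side of that identity at least mu^2. *)
Lemma bordered_minimal_bound y : 0 < mu ->
  (forall w : 'rV[int]_(1 + n), w != 0 -> mu <= qform bordered w) -> y != 0 ->
  3 * mu ^+ 2 <= 4 * qform schur y.
Proof.
move=> mu0 mumin y0.
pose B := (b *m y^T) 0 0.
(* the nearest multiple of mu to -B *)
pose x : int := - ((2 * B + mu) %/ (2 * mu))%Z.
have hx : 2 * `|mu * x + B| <= mu.
  have := divz_eq (2 * B + mu) (2 * mu).
  have := modz_ge0 (2 * B + mu) (d := 2 * mu).
  have := ltz_pmod (2 * B + mu) (d := 2 * mu).
  rewrite /x; move: (_ %% _)%Z (_ %/ _)%Z => r k; nia.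
have := schur_qform x y; rewrite -/B.
have /mumin : row_mx x%:M y != 0.
  by apply: contra y0; rewrite -row_mx0 => /eqP/eq_row_mx[_ /eqP].
move: (qform _ _) (qform _ _) => s t; nia.
Qed.

End Schur.

Lemma congr_bordered n (G : 'M[int]_(1 + n)) : G^T = G ->
  G = bordered (G 0 0) (ursubmx G) (drsubmx G).
Proof.
move=> sG; rewrite /bordered -[LHS]submxK; congr block_mx.
  by rewrite [LHS]mx11_scalar !mxE lshift0.
by rewrite -[in LHS]sG trmx_ursub.
Qed.

Lemma minimal_bordered n (G : 'M[int]_(1 + n)) : posdef G ->
  exists mu b H, exists2 U : 'M[int]_(1 + n), U \in unitmx &
    [/\ U *m G *m U^T = bordered mu b H, 0 < mu
      & forall w : 'rV[int]_(1 + n), w != 0 -> mu <= qform (bordered mu b H) w].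
Proof.
move=> pG; have [U uU Umin] := posdef_minimal_row pG.
have pG' := posdef_congr uU pG.
have e := congr_bordered pG'.1.
move: e; set G' : 'M[int]_(1 + n) := U *m G *m U^T => e.
exists (G' 0 0), (ursubmx G'), (drsubmx G').
exists U => //; rewrite -e {1 2}/G' -bform_row; split=> //.
  by apply: pG.2; exact: unitmx_row_neq0.
move=> w w0; rewrite /qform -bform_mul; apply: Umin.
apply: contra w0 => /eqP w0; rewrite -[w]mulmx1 -(mulmxV uU) mulmxA w0.
by rewrite mul0mx.
Qed.

(** Hermite's inequality by induction on the rank. A nonzero value S(y) of the Schur complement
    satisfies mu^2 <= 4 S(y), and the determinant of the complement is mu^n det G, so the powers of
    [mu] can be cancelled. The sharper factor 4/3 is not retained, since only the existence of a
    constant matters. *)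
Lemma hermite_minimum n : exists2 c : int, 0 < c &
  forall G : 'M[int]_n.+1, posdef G ->
    exists2 x : 'rV[int]_n.+1, x != 0 & qform G x ^+ n.+1 <= c * \det G.
Proof.
elim: n => [|n [c c0 IH]].
  exists 1 => // G pG; exists 1%:M.
    by apply/eqP => /matrixP/(_ 0 0); rewrite !mxE.
  rewrite /qform /bform [G]mx11_scalar tr_scalar_mx !mul1mx mulmx1 det_scalar1.
  by rewrite mxE mul1r.
exists (4 ^+ n.+1 * c) => [|G pG]; first by rewrite mulr_gt0 // exprn_gt0.
have [mu [b [H [U uU [eG mu0 mumin]]]]] := @minimal_bordered n.+1 G pG.
have pB : posdef (bordered mu b H) by rewrite -eG; apply: posdef_congr.
have pS := schur_posdef mu0 pB.
have [y y0 yle] := IH _ pS.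
have := bordered_minimal_bound mu0 mumin y0.
have := schur_det b H mu0; rewrite -eG det_congr // => dS hq.
have d0 : 0 <= \det G.
  rewrite -(pmulr_rge0 _ (exprn_gt0 n.+1 mu0)) -dS pmulr_lge0 //.
  rewrite -(pmulr_rge0 _ c0); apply: le_trans yle.
  by rewrite exprn_ge0 // ltW // pS.2.
exists (row 0 U); first exact: unitmx_row_neq0.
have -> : qform G (row 0 U) = mu.
  by rewrite /qform bform_row eG bordered00.
have q1 : (mu ^+ 2) ^+ n.+1 <= 4 ^+ n.+1 * qform (schur mu b H) y ^+ n.+1.
  have qS := pS.2 _ y0; have mm : 0 <= mu ^+ 2 by rewrite exprn_ge0 // ltW.
  by rewrite -exprMn lerXn2r ?nnegrE //; lia.
rewrite -(ler_pM2r (exprn_gt0 n.+1 mu0)).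
have -> : mu ^+ n.+2 * mu ^+ n.+1 = (mu ^+ 2) ^+ n.+1 * mu.
  by rewrite -exprM -exprD -exprSr; congr (_ ^+ _); lia.
have -> : 4 ^+ n.+1 * c * \det G * mu ^+ n.+1 = 4 ^+ n.+1 * (c * \det (schur mu b H)) * mu.
  by rewrite -!mulrA; do 2! congr (_ * _); rewrite dS mulrC.
rewrite ler_pM2r //; apply: le_trans q1 _.
by rewrite ler_pM2l // exprn_gt0.
Qed.

Lemma schur_congr n mu (b : 'rV[int]_n) H (V : 'M[int]_n) :
  block_mx 1%:M 0 0 V *m bordered mu b H *m (block_mx 1%:M 0 0 V)^T =
    bordered mu (b *m V^T) (V *m H *m V^T) /\
  schur mu (b *m V^T) (V *m H *m V^T) = V *m schur mu b H *m V^T.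
Proof.
split.
  rewrite /bordered tr_block_mx !mulmx_block !trmx0 trmx1.
  rewrite !mul1mx !mul0mx !mulmx0 !mulmx1 !addr0 !add0r.
  by rewrite trmx_mul trmxK.
rewrite /schur mulmxBr mulmxBl -scalemxAr -scalemxAl; congr (_ - _).
by rewrite trmx_mul trmxK !mulmxA.
Qed.

(** Adding multiples of the first basis vector to the others moves [b] modulo [mu] and leaves the
    Schur complement fixed. *)
Lemma schur_shear n mu (b t : 'rV[int]_n) H : H^T = H ->
  exists H', let T := block_mx 1%:M 0 t^T 1%:M in
    T *m bordered mu b H *m T^T = bordered mu (b + mu *: t) H' /\
    schur mu (b + mu *: t) H' = schur mu b H.
Proof.
move=> sH; exists (H + t^T *m b + b^T *m t + mu *: (t^T *m t)) => /=; split.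
  rewrite /bordered tr_block_mx !mulmx_block !trmx0 !trmx1 !trmxK.
  rewrite !mul1mx !mul0mx !mulmx0 !mulmx1 !addr0 !mul_scalar_mx.
  rewrite !linearD !linearZ /= !mul_mx_scalar mulmxDl -scalemxAl.
  congr block_mx; apply/matrixP => i j;
    move: (t^T *m b) (b^T *m t) (t^T *m t) => *; rewrite !mxE; ring.
rewrite /schur (_ : (b + mu *: t)^T = b^T + mu *: t^T) ?mulmxDl ?mulmxDr; last first.
  by apply/matrixP => i j; rewrite !mxE.
rewrite -!scalemxAl -!scalemxAr.
by apply/matrixP => i j; move: (t^T *m b) (b^T *m t) (t^T *m t) (b^T *m b) => *; rewrite !mxE; ring.
Qed.

(** The minimum [mu] is bounded by Hermite's inequality, the Schur complement is reduced by the
    induction hypothesis, [b] is reduced modulo [mu] by a shear, and the entries of [H] are then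
    bounded through mu H = schur + b^T b. *)
Lemma hermite_reduction n (D : int) : exists C : int,
  forall G : 'M[int]_n.+1, posdef G -> \det G <= D ->
    exists2 U : 'M[int]_n.+1, U \in unitmx &
      forall i j, `|(U *m G *m U^T) i j| <= C.
Proof.
elim: n D => [|n IH] D.
  exists `|D| => G pG dG; exists 1%:M; first exact: unitmx1.
  move=> i j; rewrite trmx1 mulmx1 mul1mx !ord1.
  have : 0 < qform G 1%:M.
    by apply: pG.2; apply/eqP => /matrixP/(_ 0 0); rewrite !mxE.
  rewrite /qform /bform trmx1 mul1mx mulmx1; move: dG.
  by rewrite [G]mx11_scalar det_scalar1 mxE eqxx; lia.
have [c c0 cmin] := hermite_minimum n.+1.
pose B : int := `|c * D|.
have [C IHC] := IH (B ^+ n.+1 * `|D|).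
exists (`|C| + B ^+ 2 + B) => G pG dG.
have [mu [b [H [U uU [eG mu0 mumin]]]]] := @minimal_bordered n.+1 G pG.
have pB : posdef (bordered mu b H) by rewrite -eG; apply: posdef_congr.
have muB : mu <= B.
  have [x x0 xle] := cmin _ pB; have := mumin _ x0.
  rewrite -eG det_congr // in xle.
  move=> mule; rewrite /B.
  have h1 : mu <= mu ^+ n.+2 by rewrite ler_eXnr //; lia.
  have h2 : mu ^+ n.+2 <= qform (bordered mu b H) x ^+ n.+2.
    by rewrite lerXn2r ?nnegrE //; lia.
  have h3 : c * \det G <= c * D by rewrite ler_pM2l.
  rewrite eG in xle; have := le_trans h1 (le_trans h2 (le_trans xle h3)).
  by move=> h; apply: le_trans h (ler_norm _).
have [V uV hV] : exists2 V : 'M[int]_n.+1, V \in unitmx &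
    forall i j, `|(V *m schur mu b H *m V^T) i j| <= C.
  apply: IHC; first exact: schur_posdef.
  have -> : \det (schur mu b H) = mu ^+ n * \det G.
    apply: (mulIf (lt0r_neq0 mu0)); rewrite (schur_det b H mu0) -eG det_congr //.
    by rewrite exprSr mulrAC.
  have m1 : mu ^+ n <= B ^+ n.+1.
    apply: (@le_trans _ _ (B ^+ n)); first by rewrite lerXn2r ?nnegrE //; lia.
    by apply: ler_weXn2l; lia.
  have m0 : 0 <= mu ^+ n by rewrite exprn_ge0 // ltW.
  apply: (@le_trans _ _ (mu ^+ n * `|D|)); first by rewrite ler_wpM2l //; lia.
  by rewrite ler_wpM2r //; lia.
have [e1 e2] := schur_congr mu b H V.
have sH' : (V *m H *m V^T)^T = V *m H *m V^T.
  have sH : H^T = H by case: pB; rewrite /bordered tr_block_mx => /eq_block_mx[].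
  by rewrite !trmx_mul trmxK sH mulmxA.
pose t : 'rV[int]_n.+1 := \row_j - divz ((b *m V^T) 0 j) mu.
have [H' /= [e3 e4]] := schur_shear mu (b *m V^T) t sH'.
move: e3; set T := block_mx _ _ _ _ => e3.
pose W : 'M[int]_(1 + n.+1) := T *m block_mx 1%:M 0 0 V.
exists (W *m U).
  have uW : W \in unitmx.
    rewrite /W unitmx_mul /T !unitmxE !det_lblock !det1 !mul1r unitr1 -unitmxE.
    exact: uV.
  by rewrite unitmx_mul uW uU.
have -> : W *m U *m G *m (W *m U)^T = bordered mu (b *m V^T + mu *: t) H'.
  by rewrite -e3 -e1 -eG /W !trmx_mul !mulmxA.
have hb j : 0 <= (b *m V^T + mu *: t) 0 j < mu.
  have -> : (b *m V^T + mu *: t) 0 j = modz ((b *m V^T) 0 j) mu.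
    by rewrite /modz [LHS]mxE [X in _ + X]mxE [t 0 j]mxE; ring.
  by rewrite modz_ge0 ?gt_eqF //= ltz_pmod.
have hH i j : `|H' i j| <= `|C| + B ^+ 2.
  have := hV i j; rewrite -e2 -e4.
  have -> : schur mu (b *m V^T + mu *: t) H' i j =
    mu * H' i j - (b *m V^T + mu *: t) 0 i * (b *m V^T + mu *: t) 0 j.
    by rewrite /schur !mxE big_ord1 !mxE.
  have := hb i; have := hb j; move: (_ 0 i) (_ 0 j) (H' i j) => x y h.
  nia.
have BB : 0 <= B ^+ 2 by rewrite exprn_ge0.
have B0 : 0 <= B by [].
apply: bordered_norm_le => [|j|i j]; first lia.
  have /andP[h1 h2] := hb j; rewrite ger0_norm //.
  apply: le_trans (ltW h2) (le_trans muB _).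
  by rewrite lerDr addr_ge0.
by apply: le_trans (hH i j) _; rewrite lerDl.
Qed.

(** * Reduction modulo p and Kneser neighbours *)

Section ReductionModP.
Variables (p : nat).
Hypothesis p_pr : prime p.

Lemma pchar_Fp_prime : p \in [pchar 'F_p].
Proof. exact: pchar_Fp. Qed.

Lemma Fp_int_eq0 (z : int) : (z%:~R == 0 :> 'F_p) = (p %| z)%Z.
Proof. by rewrite (dvdz_pcharf pchar_Fp_prime). Qed.

Lemma Fp_lift (a : 'F_p) : exists z : int, z%:~R = a.
Proof. by exists (Posz (a : nat)); rewrite -pmulrn natr_Zp. Qed.

Definition redmx m n (A : 'M[int]_(m, n)) : 'M['F_p]_(m, n) :=
  map_mx intr A.

Lemma redmx_lift m n (A : 'M['F_p]_(m, n)) : exists B, redmx B = A.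
Proof.
exists (\matrix_(i, j) Posz (A i j : nat)); apply/matrixP => i j.
by rewrite !mxE -pmulrn natr_Zp.
Qed.

Lemma redmx_eq0 n (z : 'rV[int]_n) :
  redmx z = 0 <-> exists w, z = p%:Z *: w.
Proof.
split=> [z0|[w ->]]; last first.
  apply/rowP => j; rewrite !mxE rmorphM /=.
  by apply/eqP; rewrite mulf_eq0 Fp_int_eq0 dvdzz.
exists (\row_j divz (z 0 j) p); apply/rowP => j; rewrite !mxE mulrC divzK //.
by rewrite -Fp_int_eq0; move/rowP/(_ j): z0; rewrite !mxE => ->.
Qed.

Lemma bform_red n (G : 'M[int]_n) u v :
  bform (redmx G) (redmx u) (redmx v) = (bform G u v)%:~R.
Proof. exact: (bform_map intr). Qed.

End ReductionModP.

Section Neighbours.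
Variables (p : nat) (r : nat) (G : 'M[int]_r.+1).
Hypotheses (p_pr : prime p) (p_odd : odd p) (symG : G^T = G).
Hypothesis detG : ~~ (p %| \det G)%Z.
Let red := @redmx p.

Let two_neq0 : (2%:R : 'F_p) != 0.
Proof.
by rewrite -(dvdn_pcharf (pchar_Fp_prime p_pr)) dvdn_prime2 //; apply: contraL p_odd => /eqP ->.
Qed.

Lemma red_nondegenerate (v : 'rV['F_p]_r.+1) : v != 0 ->
  exists k, (v *m red G) 0 k != 0.
Proof.
move=> v0; apply/existsP; apply: contraNT v0; rewrite negb_exists => /forallP h.
have uG : red G \in unitmx.
  by rewrite unitmxE /red /redmx det_map_mx unitfE Fp_int_eq0.
have -> : v = v *m red G *m invmx (red G) by rewrite mulmxK.
have -> : v *m red G = 0 by apply/rowP => j; have := h j; rewrite negbK => /eqP ->; rewrite mxE.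
by rewrite mul0mx.
Qed.

(** A Hensel step: moving a lift z by p t e changes q(z)/p by 2 t b(z, e) modulo p, and
    nondegeneracy provides a unit vector e with b(z, e) invertible modulo p. *)
Lemma isotropic_lift (v : 'rV['F_p]_r.+1) : v != 0 -> qform (red G) v = 0 ->
  exists2 z, red z = v & qform G z \in dvdz (p%:Z ^+ 2).
Proof.
move=> v0 qv; have [z zv] := redmx_lift v.
have [k hk] := red_nondegenerate v0.
have pq : (p %| qform G z)%Z by rewrite -Fp_int_eq0 // /qform -bform_red // zv; apply/eqP; exact: qv.
pose e : 'rV[int]_r.+1 := delta_mx 0 k.
have ek : (bform G z e)%:~R != 0 :> 'F_p.
  rewrite -bform_red // zv bformE (bigD1 k) //= big1 => [|j jk].
    have -> : redmx p e 0 k = 1 by rewrite !mxE !eqxx.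
    by rewrite addr0 mulr1.
  have -> : redmx p e 0 j = 0 by rewrite !mxE (negbTE jk) andbF.
  by rewrite mulr0.
pose a : 'F_p := - (divz (qform G z) p)%:~R / (2 * (bform G z e)%:~R).
have [t ht] := Fp_lift a.
exists (z + (p%:Z * t) *: e).
  rewrite /red /redmx; apply/rowP => j; rewrite -zv !mxE rmorphD rmorphM rmorphM /=.
  have -> : (p%:Z%:~R : 'F_p) = 0 by apply/eqP; rewrite Fp_int_eq0 // dvdzz.
  by rewrite !mul0r addr0.
rewrite qformD // bformZr qformZ.
have : (p %| divz (qform G z) p + 2 * t * bform G z e)%Z.
  rewrite -Fp_int_eq0 // rmorphD /= !rmorphM /= ht.
  apply/eqP; have h2 : (2%:~R : 'F_p) = 2 by [].
  rewrite h2 /a; field; by rewrite ek two_neq0.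
case/dvdzP => c hc; case/dvdzP: pq => d hd.
apply/dvdzP; exists (c + t ^+ 2 * qform G e).
have dp : divz (qform G z) p = d by rewrite hd mulzK //; have := prime_gt0 p_pr; lia.
rewrite dp in hc; rewrite hd.
have -> : d * p + 2 * (p%:Z * t * bform G z e) = (d + 2 * t * bform G z e) * p by ring.
by rewrite hc; ring.
Qed.

(** The lift of v, made primitive, becomes the first vector of a basis. By nondegeneracy some vector
    [j0] pairs with it to a unit modulo p; subtracting multiples of that vector from the others
    makes their pairings with the first one divisible by p. *)
Lemma isotropic_basis (v : 'rV['F_p]_r.+1) : v != 0 -> qform (red G) v = 0 ->
  exists U : 'M[int]_r.+1, exists j0 : 'I_r.+1, exists c : 'F_p,
  [/\ U \in unitmx, j0 != 0, c != 0 & v = c *: red (row 0 U)] /\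
  [/\ (U *m G *m U^T) 0 0 \in dvdz (p%:Z ^+ 2),
      (U *m G *m U^T) 0 j0 \notin dvdz p
    & forall j, j != 0 -> j != j0 -> (U *m G *m U^T) 0 j \in dvdz p].
Proof.
move=> v0 qv; have [z zv pz] := isotropic_lift v0 qv.
have [g [U uU zE]] := primitive_completion z.
have gp : g%:~R != 0 :> 'F_p.
  apply: contra v0 => /eqP g0; rewrite -zv zE /red /redmx.
  by apply/eqP/rowP => j; rewrite !mxE rmorphM /= g0 mul0r.
pose H := U *m G *m U^T.
have H00 : H 0 0 \in dvdz (p%:Z ^+ 2).
  move: pz; rewrite zE qformZ /qform bform_row -/H Gauss_dvdzr //.
  by rewrite coprimezXl // coprimezXr // coprimezE /= prime_coprime // -[(_ %| _)%N](Fp_int_eq0 p_pr).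
have vE : v = g%:~R *: red (row 0 U).
  by rewrite -zv zE; apply/rowP => j; rewrite !mxE rmorphM.
have [j0 hj0] : exists j0, H 0 j0 \notin dvdz p.
  have u0 : red (row 0 U) != 0.
    by apply: contra v0 => /eqP u0; rewrite vE u0 scaler0.
  have [k hk] := red_nondegenerate u0.
  apply/existsP; apply: contraNT hk; rewrite negb_exists => /forallP h.
  have rH : row 0 (red H) = 0.
    apply/rowP => j; rewrite [LHS]mxE [LHS]mxE [RHS]mxE; apply/eqP.
    by rewrite Fp_int_eq0 //; have := h j; rewrite negbK.
  have uUT : red U^T \in unitmx.
    by rewrite unitmxE /red /redmx det_map_mx det_tr rmorph_unit // -unitmxE.
  have e : red (row 0 U) *m red G *m red U^T = row 0 (red H).
    by rewrite /red /redmx -!map_mxM -!row_mul map_row.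
  have -> : red (row 0 U) *m red G = 0.
    by rewrite -[LHS](mulmxK uUT) e rH mul0mx.
  by rewrite mxE.
have j00 : j0 != 0.
  apply: contra hj0 => /eqP ->; apply: dvdz_trans H00.
  by rewrite expr2 dvdz_mulr // dvdzz.
have hc0 : (H 0 j0)%:~R != 0 :> 'F_p by rewrite Fp_int_eq0.
pose tf j : int := ((((H 0 j)%:~R / (H 0 j0)%:~R) : 'F_p) : nat).
pose t : 'cV[int]_r.+1 := \col_j (if (j == 0) || (j == j0) then 0 else tf j).
(* [E] squares to zero because [t] vanishes at [j0], so 1 - E is unimodular; the zero of [t] at 0
   keeps the first row unchanged. *)
pose E : 'M[int]_r.+1 := t *m delta_mx 0 j0.
have EE : E *m E = 0.
  rewrite /E mulmxA -[t *m _ *m t]mulmxA -rowE.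
  have -> : row j0 t = 0 by apply/rowP => j; rewrite !mxE eqxx orbT.
  by rewrite mulmx0 mul0mx.
have EH i j : ((1%:M - E) *m U) i j = U i j - t i 0 * U j0 j.
  by rewrite mulmxBl mul1mx /E -mulmxA -rowE mxE [X in _ + X]mxE [X in - X]mxE big_ord1 [row j0 U _ _]mxE.
exists ((1%:M - E) *m U), j0, g%:~R; split.
  split=> //.
    rewrite unitmx_mul uU andbT; 
    suff /mulmx1_unit[] : (1%:M - E) *m (1%:M + E) = 1%:M by [].
    by rewrite mulmxBl !mulmxDr EE !mulmx1 !mul1mx addr0 addrK.
  rewrite vE; congr (_ *: red _); apply/rowP => j.
  by rewrite [LHS]mxE [RHS]mxE EH /t mxE eqxx mul0r subr0.
have HE i j : ((1%:M - E) *m U *m G *m ((1%:M - E) *m U)^T) i j =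
  H i j - t j 0 * H i j0 - t i 0 * (H j0 j - t j 0 * H j0 j0).
  rewrite -bform_row.
  have rE k : row k ((1%:M - E) *m U) = row k U + (- t k 0) *: row j0 U.
    by apply/rowP => l; rewrite [LHS]mxE EH !mxE mulNr.
  rewrite !rE bformDl !bformDr !bformZl !bformZr !bform_row -/H; ring.
have t0 : t 0 0 = 0 by rewrite mxE eqxx.
have tj0 : t j0 0 = 0 by rewrite mxE eqxx orbT.
split=> [||j jn0 jnj0]; rewrite HE t0.
- by rewrite !mul0r !subr0.
- by rewrite tj0 !mul0r !subr0.
have -> : t j 0 = tf j by rewrite mxE (negbTE jn0) (negbTE jnj0).
rewrite mul0r subr0 -Fp_int_eq0 // rmorphB rmorphM /=.
by rewrite /tf -pmulrn natr_Zp divfK // subrr.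
Qed.

(** Kneser's neighbour L' of the lattice L along the line of v. The rows of [Y] span p L', a
    sublattice of L, and [G'] is the Gram matrix of L'. The last two clauses are the membership
    tests for p L' on which the counting in the Hecke relation rests, for vectors that are nonzero
    modulo p and for vectors p w. *)
Lemma neighbour_exists (v : 'rV['F_p]_r.+1) : v != 0 -> qform (red G) v = 0 ->
  exists Y G' : 'M[int]_r.+1,
  [/\ Y *m G *m Y^T = p%:Z ^+ 2 *: G', \det G' = \det G & \det Y != 0] /\
  [/\ (forall z : 'rV[int]_r.+1, red z != 0 -> qform G z \in dvdz (p%:Z ^+ 2) ->
        (exists y, z = y *m Y) <-> exists a, red z = a *: v)
    & forall w : 'rV[int]_r.+1,
        (exists y, p%:Z *: w = y *m Y) <-> bform (red G) (red w) v = 0].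
Proof.
move=> v0 qv.
have [U [j0 [c [[uU j00 c0 vE] [H00 H0j H0]]]]] := isotropic_basis v0 qv.
move: H00 H0j H0; set H := U *m G *m U^T => H00 H0j H0.
have symH : H^T = H by rewrite /H !trmx_mul trmxK symG mulmxA.
(* The elementary divisors 1, p^2, p, ..., p have product p^(r+1), so dividing the new Gram matrix
   by p^2 restores the determinant. *)
pose d : 'rV[int]_r.+1 :=
  \row_j (if j == 0 then 1 else if j == j0 then p%:Z ^+ 2 else p%:Z).
have d0 : d 0 0 = 1 by rewrite mxE eqxx.
have dj0 : d 0 j0 = p%:Z ^+ 2 by rewrite mxE (negbTE j00) eqxx.
have dj j : j != 0 -> j != j0 -> d 0 j = p%:Z.
  by move=> h1 h2; rewrite mxE (negbTE h1) (negbTE h2).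
have pd j : j != 0 -> d 0 j \in dvdz p.
  move=> h; case: (eqVneq j j0) => [->|h2]; last by rewrite dj // dvdzz.
  by rewrite dj0 expr2 dvdz_mulr // dvdzz.
have p0 : p%:Z != 0 by have := prime_gt0 p_pr; lia.
have dH0 j : d 0 0 * d 0 j * H 0 j \in dvdz (p%:Z ^+ 2).
  rewrite d0 mul1r; case: (eqVneq j 0) => [->|h1]; first by rewrite d0 mul1r.
  case: (eqVneq j j0) => [->|h2]; first by rewrite dj0 dvdz_mulr // dvdzz.
  by rewrite dj // expr2 dvdz_mul // ?dvdzz // H0.
have dH i j : d 0 i * d 0 j * H i j \in dvdz (p%:Z ^+ 2).
  case: (eqVneq i 0) => [->|h1]; first exact: dH0.
  case: (eqVneq j 0) => [->|h2].
    by rewrite [d 0 i * _]mulrC -[H]symH [H^T _ _]mxE dH0.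
  by rewrite dvdz_mulr // expr2 dvdz_mul // pd.
pose Y := diag_mx d *m U.
pose G' : 'M[int]_r.+1 := \matrix_(i, j) divz (d 0 i * d 0 j * H i j) (p%:Z ^+ 2).
have YE y : y *m Y = (\row_j (y 0 j * d 0 j)) *m U.
  by rewrite /Y mulmxA mul_mx_diag; congr (_ *m _); apply/rowP => j; rewrite !mxE.
have eG : Y *m G *m Y^T = p%:Z ^+ 2 *: G'.
  rewrite /Y trmx_mul tr_diag_mx !mulmxA.
  rewrite -[diag_mx d *m U *m G]mulmxA -[diag_mx d *m (U *m G) *m _]mulmxA -/H.
  rewrite mul_mx_diag mul_diag_mx; apply/matrixP => i j.
  rewrite [RHS]mxE [G' i j]mxE [RHS]mulrC divzK // [LHS]mxE [X in X * _]mxE.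
  by rewrite mulrAC.
have detd : \det (diag_mx d) = p%:Z ^+ r.+1.
  rewrite det_diag -[in RHS](card_ord r.+1) -prodr_const.
  rewrite (bigD1 0) //= (bigD1 j0) //= [RHS](bigD1 0) //= [X in _ = _ * X](bigD1 j0) //=.
  rewrite d0 dj0 mul1r expr2 mulrA; congr (_ * _).
  by apply: eq_bigr => j /andP[h1 h2]; rewrite dj.
have detY : \det Y = p%:Z ^+ r.+1 * \det U by rewrite /Y det_mulmx detd.
have detU2 : \det U * \det U = 1.
  by move: uU; rewrite unitmxE qualifE /= => /orP[] /eqP ->.
have nY : \det Y != 0.
  rewrite detY mulf_neq0 // ?expf_neq0 //; apply/eqP => h.
  by move: detU2; rewrite h mul0r.
exists Y, G'; split.
  split=> //; have := congr1 determinant eG.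
  rewrite !det_mulmx det_tr detZ detY -exprM mulnC exprM => e.
  have pn0 : (p%:Z ^+ r.+1) ^+ 2 != 0 by rewrite !expf_neq0.
  by apply: (mulfI pn0); rewrite -e detd -[RHS]mulr1 -detU2; ring.
have memY (z : 'rV[int]_r.+1) : (exists y, z = y *m Y) <->
    forall j, (z *m invmx U) 0 j \in dvdz (d 0 j).
  split=> [[y ->] j|h].
    by rewrite YE mulmxK // mxE dvdz_mull // dvdzz.
  exists (\row_j divz ((z *m invmx U) 0 j) (d 0 j)); rewrite YE.
  rewrite -[LHS](mulmxKV uU); congr (_ *m U); apply/rowP => j.
  by rewrite [RHS]mxE [X in _ = X * _]mxE divzK.
have bE (z : 'rV[int]_r.+1) : bform G (row 0 U) z = \sum_j H 0 j * (z *m invmx U) 0 j.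
  rewrite -[z in LHS](mulmxKV uU) rowE bform_mul -/H bformE -rowE.
  by apply: eq_bigr => j _; rewrite [row 0 H 0 j]mxE.
have redu (z : 'rV[int]_r.+1) a : red z = a *: red (row 0 U) <->
    (forall j, j != 0 -> (z *m invmx U) 0 j \in dvdz p) /\ ((z *m invmx U) 0 0)%:~R = a.
  have uR : red U \in unitmx.
    by rewrite unitmxE /red /redmx det_map_mx rmorph_unit // -unitmxE.
  have e1 : red z = red (z *m invmx U) *m red U.
    by rewrite /red /redmx -map_mxM mulmxKV.
  have e2 : a *: red (row 0 U) = (a *: delta_mx 0 0) *m red U.
    by rewrite -scalemxAl -rowE /red /redmx map_row.
  split=> [h|[h1 h2]].
    have e : red (z *m invmx U) = a *: delta_mx 0 0.
      by rewrite -[LHS](mulmxK uR) -[RHS](mulmxK uR) -e1 -e2 h.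
    split=> [j jn0|]; last by move/rowP/(_ 0): e; rewrite [LHS]mxE !mxE eqxx mulr1.
    rewrite -Fp_int_eq0 //; move/rowP/(_ j): e; rewrite [LHS]mxE => ->.
    by rewrite !mxE (negbTE jn0) andbF mulr0.
  rewrite e1 e2; congr (_ *m _); apply/rowP => j; rewrite [LHS]mxE !mxE eqxx /=.
  case: (eqVneq j 0) => [->|jn0]; first by rewrite -h2 mulr1 !mxE.
  by apply/eqP; rewrite mulr0 Fp_int_eq0 //; have := h1 j jn0; rewrite mxE.
have hB w : (bform G (row 0 U) w)%:~R =
    (H 0 j0)%:~R * ((w *m invmx U) 0 j0)%:~R :> 'F_p.
  rewrite bE rmorph_sum (bigD1 j0) //= rmorphM /= big1 ?addr0 // => j jn.
  rewrite rmorphM /=; suff /eqP -> : (H 0 j)%:~R == 0 :> 'F_p by rewrite mul0r.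
  rewrite Fp_int_eq0 //; case: (eqVneq j 0) => [->|j0n]; last exact: H0.
  by apply: dvdz_trans H00; rewrite expr2 dvdz_mulr // dvdzz.
have Hj0 : (H 0 j0)%:~R != 0 :> 'F_p by rewrite Fp_int_eq0.
split.
  move=> z z0 qz; rewrite memY; set k := z *m invmx U.
  split=> [h|[a za]].
    exists ((k 0 0)%:~R / c); rewrite vE scalerA divfK //.
    by apply/redu; split=> // j jn0; apply: dvdz_trans (pd _ jn0) (h j).
  have /redu[h1 h2] : red z = (a * c) *: red (row 0 U) by rewrite za vE scalerA.
  rewrite -/k in h1 h2.
  have ac0 : a * c != 0.
    by apply: contra z0 => /eqP ac; rewrite za vE scalerA ac scale0r.
  pose w : 'rV[int]_r.+1 := (\row_j (if j == 0 then 0 else divz (k 0 j) p)) *m U.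
  have zE : z = k 0 0 *: row 0 U + p%:Z *: w.
    rewrite -[LHS](mulmxKV uU) -/k /w rowE !scalemxAl -mulmxDl; congr (_ *m U).
    apply/rowP => j; rewrite [RHS]mxE [X in X + _]mxE [X in _ + X]mxE.
    rewrite [delta_mx _ _ _ _]mxE [X in _ + _ * X]mxE eqxx /=.
    case: (eqVneq j 0) => [->|jn0]; first by rewrite mulr1 mulr0 addr0.
    by rewrite mulr0 add0r mulrC divzK // h1.
  have wj0 : (w *m invmx U) 0 j0 * p = k 0 j0.
    by rewrite /w mulmxK // mxE (negbTE j00) divzK // h1.
  (* Expanding the norm of z = k_00 u + p w modulo p^2, with u the first row: both p^2 | q(z) and
     p^2 | q(u), so the cross term is divisible by p^2. Hence the [j0]-coordinate of w vanishes
     modulo p, and that of z modulo p^2. *)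
  have : 2 * k 0 0 * bform G (row 0 U) w \in dvdz p.
    have : p%:Z * p%:Z \in dvdz (p%:Z ^+ 2) by rewrite expr2 dvdzz.
    move: qz; rewrite {1}zE qformD // !qformZ bformZl bformZr.
    have -> : qform G (row 0 U) = H 0 0 by rewrite /qform bform_row.
    case/dvdzP=> x hx _; case/dvdzP: H00 => y hy.
    apply/dvdzP; exists (x - k 0 0 ^+ 2 * y - qform G w).
    apply: (mulfI p0); rewrite hy in hx.
    have -> : p%:Z * ((x - k 0 0 ^+ 2 * y - qform G w) * p) =
       x * p%:Z ^+ 2 - k 0 0 ^+ 2 * (y * p%:Z ^+ 2) - p%:Z ^+ 2 * qform G w by ring.
    by rewrite -hx; ring.
  rewrite -Fp_int_eq0 // !rmorphM /= hB h2 mulf_eq0 mulf_eq0 (negbTE ac0) mulf_eq0 (negbTE Hj0).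
  have -> : (2%:~R == 0 :> 'F_p) = false by exact: negbTE two_neq0.
  rewrite Fp_int_eq0 //= => pw j.
  case: (eqVneq j 0) => [->|jn0]; first by rewrite d0 dvd1z.
  case: (eqVneq j j0) => [->|jnj0]; last by rewrite dj // h1.
  by rewrite dj0 -wj0 expr2 dvdz_mul // dvdzz.
move=> w; rewrite memY.
have -> : bform (red G) (red w) v = c * ((H 0 j0)%:~R * ((w *m invmx U) 0 j0)%:~R).
  by rewrite vE bformZr bform_red // (bformC _ _ symG) hB.
rewrite -scalemxAl; set k := w *m invmx U; split=> [/(_ j0)|].
  rewrite dj0 mxE expr2 dvdz_mul2l // -Fp_int_eq0 // => /eqP ->.
  by rewrite !mulr0.
move/eqP; rewrite !mulf_eq0 (negbTE c0) (negbTE Hj0) Fp_int_eq0 //= => pk j.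
rewrite mxE; case: (eqVneq j 0) => [->|jn0]; first by rewrite d0 dvd1z.
case: (eqVneq j j0) => [->|jnj0]; last by rewrite dj // dvdz_mulr // dvdzz.
by rewrite dj0 expr2 dvdz_mul // dvdzz.
Qed.

End Neighbours.

(** * Counting isotropic vectors over a prime field *)

Section CountIsotropic.
Variables (p r : nat) (G : 'M['F_p]_r.+1) (w : 'rV['F_p]_r.+1).
Hypotheses (p_pr : prime p) (p_odd : odd p) (symG : G^T = G).
Hypotheses (qw : qform G w = 0) (wG : exists k, (w *m G) 0 k != 0).
Local Notation vec := 'rV['F_p]_r.+1.

(** [Y] is a union of lines parallel to u, each of which meets [X] exactly once. *)
Lemma card_transversal (X Y : {set vec}) (u : vec) :
  (forall v t, v \in X -> v + t *: u \in Y) ->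
  (forall v, v \in Y -> exists t, v - t *: u \in X) ->
  (forall v t, v \in X -> v + t *: u \in X -> t = 0) ->
  #|Y| = (#|X| * p)%N.
Proof.
move=> XY YX Xu.
have -> : Y = [set x.1 + x.2 *: u | x in finset.setX X [set: 'F_p]].
  apply/finset.setP => v; apply/idP/imsetP => [/YX[t vX]|[[x t]]].
    by exists (v - t *: u, t); rewrite ?subrK // !inE vX.
  by rewrite !inE andbT /= => xX ->; apply: XY.
rewrite card_in_imset ?cardsX ?cardsT ?card_Fp //.
move=> [x t] [y s]; rewrite !inE !andbT /= => xX yX e.
have : y + (s - t) *: u = x by rewrite scalerBl addrA -e addrK.
move=> e2; have ts : s - t = 0 by apply: (Xu y) => //; rewrite e2.
by rewrite -e2 ts scale0r addr0; congr (_, _); apply/eqP; rewrite eq_sym -subr_eq0 ts.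
Qed.

(** As w is isotropic, q(v + t w) = q(v) + 2 t b(w, v) is affine in t, so each line v + F_p w with
    b(w, v) nonzero contains exactly one isotropic vector. The vectors with b(w, v) nonzero number
    (p - 1) p^r, the complement of a hyperplane. *)
Lemma card_isotropic_nonorthogonal :
  #|[set v : vec | (qform G v == 0) && (bform G w v != 0)]| = (p.-1 * p ^ r.-1)%N.
Proof.
pose L v := bform G w v.
have [u Lu] : exists u, L u = 1.
  case: wG => k hk; exists (((w *m G) 0 k)^-1 *: delta_mx 0 k).
  rewrite /L bformZr bformE (bigD1 k) //= big1 ?addr0 => [|j jk].
    by rewrite [delta_mx _ _ _ _]mxE !eqxx mulr1 mulVf.
  by rewrite [delta_mx _ _ _ _]mxE (negbTE jk) andbF mulr0.
have LD v t x : L (v + t *: x) = L v + t * L x by rewrite /L bformDr bformZr.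
pose K := [set v : vec | L v == 0].
pose S0 := [set v : vec | (qform G v == 0) && (L v != 0)].
have c1 : #|[set: vec]| = (#|K| * p)%N.
  apply: (card_transversal (u := u)) => [v t _|v _|v t]; first by rewrite inE.
    by exists (L v); rewrite inE -scaleNr LD Lu mulr1 subrr.
  by rewrite !inE LD Lu mulr1 => /eqP ->; rewrite add0r => /eqP.
have c2 : #|[set v : vec | L v != 0]| = (#|S0| * p)%N.
  have Lw : L w = 0 by exact: qw.
  apply: (card_transversal (u := w)) => [v t|v|v t].
  - by rewrite !inE LD Lw mulr0 addr0 => /andP[].
  - rewrite inE => Lv; exists (qform G v / (2 * L v)).
    rewrite inE -scaleNr LD Lw mulr0 addr0 Lv andbT qformD // bformZr qformZ qw.
    rewrite (bformC _ _ symG) -/(L v) mulr0 addr0 mulrCA mulNr.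
    have two : (2%:R : 'F_p) != 0.
      by rewrite -(dvdn_pcharf (pchar_Fp_prime p_pr)) dvdn_prime2 //; apply: contraL p_odd => /eqP ->.
    by apply/eqP; field; rewrite Lv.
  - rewrite !inE => /andP[/eqP qv Lv] /andP[/eqP].
    rewrite qformD // bformZr qformZ qw qv mulr0 addr0 add0r (bformC _ _ symG) -/(L v) => /eqP.
    rewrite !mulf_eq0 (negbTE Lv) orbF => h _.
    have two : (2%:R : 'F_p) != 0.
      by rewrite -(dvdn_pcharf (pchar_Fp_prime p_pr)) dvdn_prime2 //; apply: contraL p_odd => /eqP ->.
    by move: h; rewrite (negbTE two) => /eqP.
have p0 := prime_gt0 p_pr; have p1 := prime_gt1 p_pr.
have cT : #|[set: vec]| = (p ^ r.+1)%N by rewrite cardsT card_mx card_Fp // mul1n.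
have c3 : #|[set v : vec | L v != 0]| = (p.-1 * p ^ r)%N.
  have eK : #|K| = (p ^ r)%N.
    by apply/eqP; rewrite -(eqn_pmul2r p0) -c1 cT expnS mulnC.
  have := cardsC K; rewrite -[#|vec|]cardsT cT eK expnS.
  have -> : ~: K = [set v | L v != 0] by apply/finset.setP => v; rewrite !inE.
  by move=> e; rewrite -subn1 mulnBl mul1n -e addKn.
move: c2; rewrite c3 -/(L _); move: (#|_|) => a; case: (r) => [|s] /=.
  (* In rank one the count would make p divide p - 1, so the truncated predecessor [r.-1] of 0 never
     matters. *)
  rewrite expn0 muln1 => h.
  have : (p %| p.-1)%N by apply/dvdnP; exists a.
  by rewrite gtnNdvd //; lia.
by rewrite expnSr mulnA => /eqP; rewrite eqn_pmul2r // => /eqP.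
Qed.

End CountIsotropic.

(** * Sums over finite sets and theta coefficients *)

Section FiniteSums.
Variable R : nmodType.

(** [fset_set] sends an infinite set to the empty one, so the sum is then 0 by default; finiteness
    is carried separately by the lemmas that need it. *)
Definition fsum (T : choiceType) (A : set T) (F : T -> R) : R :=
  \sum_(x <- finmap.enum_fset (fset_set A)) F x.

Lemma mem_enum_fset_set (T : choiceType) (A : set T) : finite_set A ->
  forall x, x \in finmap.enum_fset (fset_set A) <-> A x.
Proof. by move=> fA x; rewrite -(in_setE A) -(in_fset_set fA x). Qed.

Lemma fsum_seq (T : choiceType) (A : set T) (F : T -> R) (s : seq T) :
  uniq s -> (forall x, A x <-> x \in s) -> fsum A F = \sum_(x <- s) F x.
Proof.
move=> us As; apply: perm_big; apply: uniq_perm => //.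
have fA : finite_set A.
  have -> : A = [set` s]%classic by apply/seteqP; split => x /As.
  exact: finite_seq.
by move=> x; apply/idP/idP => [/(mem_enum_fset_set fA)/As|/As/(mem_enum_fset_set fA)].
Qed.

Lemma fsum_mem (T : choiceType) (A : set T) : finite_set A ->
  exists2 s : seq T, uniq s & forall x, A x <-> x \in s.
Proof.
move=> fA; exists (finmap.enum_fset (fset_set A)); first exact: finmap.fset_uniq.
by move=> x; rewrite (mem_enum_fset_set fA).
Qed.

Lemma fsum_reindex (T T' : choiceType) (A : set T) (B : set T') (h : T -> T')
  (F : T' -> R) : finite_set A ->
  (forall x, A x -> B (h x)) ->
  (forall x y, A x -> A y -> h x = h y -> x = y) ->
  (forall y, B y -> exists2 x, A x & h x = y) ->
  fsum B F = fsum A (F \o h).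
Proof.
move=> fA AB hI hS; have [s us As] := fsum_mem fA.
rewrite (fsum_seq _ us As) (@fsum_seq _ _ _ (map h s)) ?big_map //.
  by rewrite map_inj_in_uniq // => x y /As Ax /As Ay; apply: hI.
move=> y; split=> [/hS[x /As xs <-]|/mapP[x /As Ax ->]]; last exact: AB.
exact: map_f.
Qed.

Lemma eq_fsum (T : choiceType) (A : set T) (F F' : T -> R) : finite_set A ->
  (forall x, A x -> F x = F' x) -> fsum A F = fsum A F'.
Proof.
move=> fA e; have [s us As] := fsum_mem fA.
by rewrite !(fsum_seq _ us As); apply: eq_big_seq => x /As; apply: e.
Qed.

Lemma fsum_set0 (T : choiceType) (A : set T) (F : T -> R) :
  (forall x, ~ A x) -> fsum A F = 0.
Proof. by move=> A0; rewrite (@fsum_seq _ _ _ [::]) ?big_nil // => x; split=> // /A0. Qed.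

Lemma fsum_cond (T : choiceType) (A : set T) (P : T -> bool) (F : T -> R) :
  finite_set A ->
  fsum [set x | A x /\ P x]%classic F = fsum A (fun x => if P x then F x else 0).
Proof.
move=> fA; have [s us As] := fsum_mem fA.
rewrite (fsum_seq _ us As) -big_mkcond -big_filter; apply: fsum_seq.
  exact: filter_uniq.
by move=> x; rewrite mem_filter; split=> [[/As xs Px]|/andP[Px /As xs]]; rewrite ?xs ?Px.
Qed.

End FiniteSums.

Definition theta_coef (F : fieldType) r (G : 'M[int]_r) (f : 'rV[int]_r -> F)
  (n : nat) : F := fsum [set v | qform G v = n%:Z]%classic f.

Definition periodic (F : fieldType) r (N : nat) (f : 'rV[int]_r -> F) : Prop :=
  forall u v, f (u + N%:Z *: v) = f u.

Definition finite_fibres r (G : 'M[int]_r) : Prop :=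
  forall n : nat, finite_set [set v | qform G v = n%:Z]%classic.

(** Finiteness of the fibres passes along injective linear maps, hence to neighbours and to
    congruent forms; it is established directly only for the explicit forms used later. *)
Definition good_form (p r : nat) (G : 'M[int]_r) : Prop :=
  [/\ posdef G, finite_fibres G & \det G \notin dvdz p].

(** * The Hecke relation between the theta series of a form and of its neighbours *)

Section HeckeRelation.
Variables (F : fieldType) (p N r : nat) (G : 'M[int]_r.+1) (f : 'rV[int]_r.+1 -> F).
Hypotheses (p_pr : prime p) (p_odd : odd p) (pN : p = 1 %[mod N]).
Hypotheses (gG : good_form p G) (fN : periodic N f).
Let red := @redmx p.
Let V := [set v : 'rV['F_p]_r.+1 | (v != 0) && (qform (red G) v == 0)].

(** The vectors p w and w differ by N times a lattice vector; the congruence on p is imposed for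
    this. *)
Lemma periodic_scale (w : 'rV[int]_r.+1) : f (p%:Z *: w) = f w.
Proof.
have /eqP := pN; rewrite eq_sym => h.
have : (N %| p.-1)%N.
  by have := prime_gt0 p_pr; rewrite -subn1 => p0; rewrite -eqn_mod_dvd // eq_sym.
case/dvdnP => k hk.
have -> : p%:Z *: w = w + N%:Z *: (k%:Z *: w).
  rewrite scalerA -[X in X + _]scale1r -scalerDl; congr (_ *: _).
  by have := prime_gt0 p_pr; rewrite -PoszM mulnC -hk; lia.
exact: fN.
Qed.

Lemma neighbour_good (Y G' : 'M[int]_r.+1) :
  Y *m G *m Y^T = p%:Z ^+ 2 *: G' -> \det G' = \det G -> \det Y != 0 ->
  good_form p G'.
Proof.
case: gG => [[symG posG] finG detG] eG dG nY.
have p2 : 0 < p%:Z ^+ 2 by rewrite exprn_gt0 // ltz_nat prime_gt0.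
have injY (y y' : 'rV[int]_r.+1) : y *m Y = y' *m Y -> y = y'.
  move=> /(congr1 (mulmx^~ (\adj Y))); rewrite -!mulmxA mul_mx_adj !mul_mx_scalar.
  by apply: scalemx_inj.
have qY y : qform G (y *m Y) = p%:Z ^+ 2 * qform G' y.
  by rewrite /qform bform_mul eG /bform -scalemxAr -scalemxAl mxE.
split; last by rewrite dG.
  split.
    apply: (scalemx_inj (lt0r_neq0 p2)); rewrite -linearZ /= -eG.
    by rewrite !trmx_mul trmxK symG mulmxA.
  move=> v v0; rewrite -(pmulr_rgt0 _ p2) -qY; apply: posG.
  by apply: contra v0 => /eqP h; apply/eqP/injY; rewrite h mul0mx.
move=> n.
have -> : [set v | qform G' v = n%:Z]%classic =
    ((fun y : 'rV[int]_r.+1 => y *m Y) @^-1` [set z | qform G z = (p ^ 2 * n)%N%:Z])%classic.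
  apply/seteqP; split => y /=; rewrite qY PoszM -[(p ^ 2)%N%:Z]natz natrX natz.
    by move=> ->.
  by move/mulfI; apply; exact: lt0r_neq0.
by apply: finite_preimage; [move=> y y' _ _; exact: injY | exact: finG].
Qed.

Let finG : finite_fibres G. Proof. by case: gG. Qed.

Lemma fsum_red0 (k : nat) (g : 'rV[int]_r.+1 -> F) :
  fsum [set z | qform G z = (p ^ 2 * k)%N%:Z /\ red z == 0]%classic g =
  fsum [set w | qform G w = k%:Z]%classic (fun w => g (p%:Z *: w)).
Proof.
have p0 : p%:Z != 0 by have := prime_gt0 p_pr; lia.
have pk : (p ^ 2 * k)%N%:Z = p%:Z ^+ 2 * k%:Z.
  by rewrite PoszM -[(p ^ 2)%N%:Z]natz natrX natz.
apply: (fsum_reindex (h := fun w => p%:Z *: w)) => //.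
- move=> w /= qw; rewrite qformZ qw pk; split=> //.
  by apply/eqP/redmx_eq0 => //; exists w.
- by move=> x y _ _ /(scalemx_inj p0).
move=> z /= [qz /eqP/redmx_eq0 [//|w zw]]; exists w => //=.
by move: qz; rewrite zw qformZ pk; apply: mulfI; rewrite expf_neq0.
Qed.

(** Double counting of the pairs (v, z) with z in p L'_v of norm p^2 n. A vector z that is nonzero
    modulo p is isotropic there and belongs to the p - 1 lattices given by its own multiples. A
    vector p w belongs to those with v orthogonal to w: all of [V] if w vanishes modulo p, and
    otherwise all but (p - 1) p^(r-1). The latter count needs w isotropic modulo p, whence the
    condition p | n. Summing over vectors v and not over lines produces the factors p - 1. *)
Lemma hecke_relation : exists (Gs : 'rV['F_p]_r.+1 -> 'M[int]_r.+1)
    (fs : 'rV['F_p]_r.+1 -> 'rV[int]_r.+1 -> F),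
  (forall v, v \in V -> [/\ good_form p (Gs v), \det (Gs v) = \det G
                          & periodic N (fs v)]) /\
  forall n, (p %| n)%N ->
    \sum_(v in V) theta_coef (Gs v) (fs v) n =
    p.-1%:R * (theta_coef G f (p ^ 2 * n) - theta_coef G f n)
    + #|V|%:R * theta_coef G f n
    - (p.-1 * p ^ r.-1)%:R * (theta_coef G f n -
        (if (p ^ 2 %| n)%N then theta_coef G f (n %/ p ^ 2) else 0)).
Proof.
have [[symG posG] _ detG] := gG.
pose nb v (YG : 'M[int]_r.+1 * 'M[int]_r.+1) := v \in V ->
  [/\ YG.1 *m G *m YG.1^T = p%:Z ^+ 2 *: YG.2, \det YG.2 = \det G & \det YG.1 != 0] /\
  [/\ (forall z : 'rV[int]_r.+1, red z != 0 -> qform G z \in dvdz (p%:Z ^+ 2) ->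
        (exists y, z = y *m YG.1) <-> exists a, red z = a *: v)
    & forall w : 'rV[int]_r.+1,
        (exists y, p%:Z *: w = y *m YG.1) <-> bform (red G) (red w) v = 0].
have /boolp.choice[YG hYG] : forall v, exists YG, nb v YG.
  move=> v; case vV : (v \in V); last by exists (0, 0); rewrite /nb vV.
  move: vV; rewrite inE => /andP[v0 /eqP qv].
  by have [Y [G' h]] := neighbour_exists p_pr p_odd symG detG v0 qv; exists (Y, G').
(* The weight is read on p L' inside the original lattice, through [Y], so no division by p occurs
   and the period N is kept. *)
exists (fun v => (YG v).2), (fun v y => f (y *m (YG v).1)); split.
  move=> v vV; have [[e1 e2 e3] _] := hYG v vV; split=> //.
    exact: neighbour_good e1 e2 e3.
  by move=> u w; rewrite mulmxDl -scalemxAl fN.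
move=> n pn.
have p2 : p%:Z ^+ 2 != 0 by rewrite expf_neq0 //; have := prime_gt0 p_pr; lia.
have pk k : (p ^ 2 * k)%N%:Z = p%:Z ^+ 2 * k%:Z.
  by rewrite PoszM -[(p ^ 2)%N%:Z]natz natrX natz.
pose A := [set z | qform G z = (p ^ 2 * n)%N%:Z]%classic.
have fA : finite_set A by exact: finG.
pose P v (z : 'rV[int]_r.+1) := `[< exists y : 'rV[int]_r.+1, z = y *m (YG v).1 >].
have thv v : v \in V -> theta_coef (YG v).2 (fun y => f (y *m (YG v).1)) n =
    fsum A (fun z => if P v z then f z else 0).
  move=> vV; have [[e1 e2 e3] _] := hYG v vV.
  have [_ fin' _] := neighbour_good e1 e2 e3.
  have qY y : qform G (y *m (YG v).1) = p%:Z ^+ 2 * qform (YG v).2 y.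
    by rewrite /qform bform_mul e1 /bform -scalemxAr -scalemxAl mxE.
  rewrite -fsum_cond //; apply: esym.
  apply: (fsum_reindex (h := fun y => y *m (YG v).1)) => //.
  - move=> y /= qy; rewrite /A /= qY qy pk; split=> //.
    by apply/asboolP; exists y.
  - move=> y y' _ _ /(congr1 (mulmx^~ (\adj (YG v).1))).
    by rewrite -!mulmxA mul_mx_adj !mul_mx_scalar; apply: scalemx_inj.
  move=> z [/= qz /asboolP[y zy]]; exists y => //.
  by move: qz; rewrite /A /= zy qY pk; apply: mulfI.
rewrite (eq_bigr _ thv).
have [s us As] := fsum_mem fA.
under eq_bigr => v _ do rewrite (fsum_seq _ us As).
rewrite exchange_big /=.
pose cnt z := #|[set v in V | P v z]|.
have -> : \sum_(z <- s) \sum_(v in V) (if P v z then f z else 0) =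
    fsum A (fun z => (cnt z)%:R * f z).
  rewrite (fsum_seq _ us As); apply: eq_bigr => z _.
  rewrite -big_mkcondr /= (eq_bigl (mem [set v in V | P v z])); last first.
    by move=> v; rewrite !inE.
  by rewrite sumr_const mulr_natl.
have Aq z : A z -> qform G z \in dvdz (p%:Z ^+ 2).
  by rewrite /A /= pk => ->; rewrite dvdz_mulr // dvdzz.
have splitA (g : 'rV[int]_r.+1 -> F) : fsum A g = fsum A (fun z => if red z != 0 then g z else 0) +
    fsum [set w | qform G w = n%:Z]%classic (fun w => g (p%:Z *: w)).
  rewrite -(fsum_red0 n g) (fsum_cond (A := A) (fun z => red z == 0)) // !(fsum_seq _ us As) -big_split.
  by apply: eq_bigr => z _ /=; case: eqP => _; rewrite ?add0r ?addr0.
have cnt1 z : A z -> red z != 0 -> cnt z = p.-1.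
  move=> Az z0.
  have qz : qform (red G) (red z) = 0.
    rewrite /qform bform_red //; apply/eqP; rewrite Fp_int_eq0 //.
    by apply: dvdz_trans (Aq _ Az); rewrite expr2 dvdz_mulr // dvdzz.
  rewrite /cnt (_ : [set v in V | P v z] = [set a *: red z | a in [set~ (0 : 'F_p)]]).
    rewrite card_in_imset ?cardsC1 ?card_Fp //.
    move=> a b _ _ /eqP; rewrite -subr_eq0 -scalerBl scalemx_eq0 (negbTE z0) orbF subr_eq0.
    by move/eqP.
  apply/finset.setP => v; rewrite !inE; apply/idP/imsetP.
    case/andP=> /andP[v0 qv] /asboolP; have vV : v \in V by rewrite inE v0.
    case: (hYG v vV) => _ [h _] /(h z z0 (Aq _ Az)) [a za].
    have a0 : a != 0 by apply: contra z0 => /eqP a0; rewrite za a0 scale0r.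
    exists a^-1; first by rewrite !inE invr_eq0.
    by rewrite za scalerA mulVf // scale1r.
  case=> a; rewrite !inE => a0 ->.
  have vV : a *: red z \in V by rewrite inE scalemx_eq0 negb_or a0 z0 qformZ qz mulr0 eqxx.
  have := vV; rewrite inE => -> /=; apply/asboolP.
  case: (hYG _ vV) => _ [h _]; apply/(h z z0 (Aq _ Az)).
  by exists a^-1; rewrite scalerA mulVf // scale1r.
have cnt2 w : qform G w = n%:Z ->
    (cnt (p%:Z *: w))%:R = #|V|%:R - (if red w == 0 then 0 else (p.-1 * p ^ r.-1)%:R) :> F.
  move=> qw.
  have -> : cnt (p%:Z *: w) = #|[set v in V | bform (red G) (red w) v == 0]|.
    apply: eq_card => v; rewrite !inE; case vV: ((v != 0) && _) => //=.
    have vV' : v \in V by rewrite inE.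
    case: (hYG _ vV') => _ [_ h]; apply/asboolP/eqP => [/h|] //.
    by move=> e; apply/h.
  have -> : #|V| = (#|[set v in V | bform (red G) (red w) v == 0%R]| +
      #|[set v | (qform (red G) v == 0%R) && (bform (red G) (red w) v != 0%R)]|)%N.
    rewrite -[in LHS](cardsID [set v | bform (red G) (red w) v == 0]); congr (_ + _)%N.
      by apply: eq_card => v; rewrite !inE.
    apply: eq_card => v; rewrite !inE; case: (qform _ v == 0); rewrite ?andbF ?andbT //=.
    case: eqP => //= hb; apply/eqP => v0; apply: hb.
    by rewrite v0 /bform trmx0 mulmx0 mxE.
  rewrite natrD; case: eqP => [w0|/eqP w0].
    rewrite [X in (_ + X%:R)%R](_ : _ = 0%N) ?addr0 ?subr0 //; apply: eq_card0 => v.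
    by rewrite !inE w0 /bform !mul0mx mxE eqxx andbF.
  rewrite card_isotropic_nonorthogonal ?addrK //.
  - by rewrite /red /redmx map_trmx symG.
  - by rewrite /qform bform_red // -/(qform G w) qw; apply/eqP; rewrite Fp_int_eq0.
  - exact: red_nondegenerate.
pose B := [set w | qform G w = n%:Z]%classic.
have fB : finite_set B by exact: finG.
have [t ut Bt] := fsum_mem fB.
have e1 : fsum B (fun w => f (p%:Z *: w)) = theta_coef G f n.
  by apply: eq_fsum => // w _; rewrite periodic_scale.
have e3 : fsum B (fun w => if red w == 0 then f w else 0) =
    (if (p ^ 2 %| n)%N then theta_coef G f (n %/ p ^ 2) else 0).
  rewrite -(fsum_cond (A := B) (fun w => red w == 0)) //; case: ifP => pn2.
    rewrite /B -[in LHS](divnK pn2) mulnC fsum_red0.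
    by apply: eq_fsum => // w _; rewrite periodic_scale.
  apply: fsum_set0 => w [/= qw /eqP/redmx_eq0 [//|x wx]].
  have : n%:Z \in dvdz (p ^ 2)%N%:Z.
    rewrite -qw wx qformZ -[(p ^ 2)%N%:Z]natz natrX natz.
    by rewrite dvdz_mulr // dvdzz.
  by rewrite dvdzE /= pn2.
have e2 : fsum B (fun w => (cnt (p%:Z *: w))%:R * f (p%:Z *: w)) =
    #|V|%:R * theta_coef G f n - (p.-1 * p ^ r.-1)%:R *
    (theta_coef G f n - fsum B (fun w => if red w == 0 then f w else 0)).
  rewrite /theta_coef !(fsum_seq _ ut Bt) -sumrB !mulr_sumr -sumrB.
  apply: eq_big_seq => w /Bt Bw; rewrite cnt2 // periodic_scale.
  by case: ifP => _; ring.
have e4 : fsum A (fun z => if red z != 0 then (cnt z)%:R * f z else 0) =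
    p.-1%:R * fsum A (fun z => if red z != 0 then f z else 0).
  rewrite !(fsum_seq _ us As) mulr_sumr; apply: eq_big_seq => z /As Az.
  by case: ifP => z0; rewrite ?mulr0 // cnt1.
have e5 : fsum A (fun z => if red z != 0 then f z else 0) =
    theta_coef G f (p ^ 2 * n) - theta_coef G f n.
  by rewrite -e1 {1}/theta_coef (splitA f) addrK.
by rewrite splitA -/B e2 e4 e5 e3 addrA.
Qed.
End HeckeRelation.

(** Vanishing is asked along all multiples of [s], so that two such sequences share a common
    exponent and their sum is again of this kind. *)
Definition hecke_null (F : fieldType) (p : nat) (c : nat -> F) : Prop :=
  exists2 s, (0 < s)%N & forall t n, (0 < t)%N -> ~~ (p %| n)%N ->
    c (p ^ (2 * (s * t) - 1) * n)%N = 0.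

(** * Periodicity of the recursion and finiteness of the family of theta series *)

Section Recursion.
Variables (F : finFieldType) (I : finType) (p : nat) (E : I -> nat -> F).
Variables (a : I -> I -> F) (b : F).
Hypotheses (p_pr : prime p) (b0 : b != 0).
Hypothesis Erec : forall i n, (p %| n)%N -> E i (p ^ 2 * n)%N =
  \sum_k a i k * E k n - b * (if (p ^ 2 %| n)%N then E i (n %/ p ^ 2)%N else 0).

(** The pair formed by the values at p^(2k+1) n and p^(2k-1) n evolves under a linear map of a
    finite set, injective because b is invertible, hence a permutation. For p not dividing n the
    initial second entry is 0, as p^2 does not divide p n. It is 0 again after every multiple of the
    order of the permutation. *)
Lemma recursion_null i : hecke_null p (E i).
Proof.
pose T := ({ffun I -> F} * {ffun I -> F})%type.
pose step (x : T) : T := ([ffun i => \sum_k a i k * x.1 k - b * x.2 i], x.1).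
have step_inj : injective step.
  move=> [x y] [x' y'] [e1 e2]; rewrite -{}e2 in e1 *; congr (_, _); apply/ffunP => j.
  move/ffunP/(_ j): e1; rewrite !ffunE => /addrI/oppr_inj; exact: mulfI.
pose P := perm step_inj.
have Pn k x : (P ^+ k)%g x = iter k step x.
  by rewrite permX; elim: k => //= k ->; rewrite permE.
exists #[P]%g => [|t n t0 pn]; first exact: order_gt0.
have p0 := prime_gt0 p_pr.
pose st k : T := ([ffun i => E i (p ^ (2 * k) * (p * n))%N],
   [ffun i => if k is k'.+1 then E i (p ^ (2 * k') * (p * n))%N else 0]).
have stS k : step (st k) = st k.+1.
  rewrite /step /st /=; congr (_, _); apply/ffunP => j; rewrite !ffunE.
  have -> : (p ^ (2 * k.+1) * (p * n) = p ^ 2 * (p ^ (2 * k) * (p * n)))%N.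
    by rewrite mulnS expnD -!mulnA.
  rewrite Erec; last by rewrite mulnCA dvdn_mulr.
  congr (_ - b * _); first by apply: eq_bigr => l _; rewrite ffunE.
  case: k => [|k].
    by rewrite muln0 mul1n expnS expn1 dvdn_pmul2l // (negbTE pn).
  by rewrite mulnS expnD -mulnA dvdn_mulr // mulKn // expn_gt0 p0.
have stk k : iter k step (st 0) = st k by elim: k => //= k ->.
have : (P ^+ (#[P] * t))%g (st 0) = st 0 by rewrite expgM expg_order expg1n perm1.
rewrite Pn stk.
have [k hk] : exists k, (#[P]%g * t)%N = k.+1.
  by exists (#[P]%g * t).-1; rewrite prednK // muln_gt0 order_gt0.
rewrite hk => -[_ /ffunP/(_ i)]; rewrite !ffunE => <-; congr (E i _).
by rewrite mulnA -expnSr; congr (p ^ _ * n)%N; lia.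
Qed.

End Recursion.

Section ThetaFinite.
Variables (F : finFieldType) (p N r : nat) (d : int).
Hypotheses (p_pr : prime p) (p_odd : odd p) (N0 : (0 < N)%N) (pN : p = 1 %[mod N]).
Hypotheses (p1F : p.-1%:R != 0 :> F) (pF : p%:R != 0 :> F).

Let d_forms (G : 'M[int]_r.+1) := good_form p G /\ \det G = d.

Lemma theta_congr (G U : 'M[int]_r.+1) (f : 'rV[int]_r.+1 -> F) : U \in unitmx ->
  d_forms G -> d_forms (U *m G *m U^T) /\
  forall n, theta_coef (U *m G *m U^T) (fun v => f (v *m U)) n = theta_coef G f n.
Proof.
move=> uU [[pG fG dG] eG].
have injU : injective (fun v : 'rV[int]_r.+1 => v *m U).
  by move=> u v e; rewrite -[u](mulmxK uU) e mulmxK.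
have fib n : [set v | qform (U *m G *m U^T) v = n%:Z]%classic =
    ((fun v : 'rV[int]_r.+1 => v *m U) @^-1` [set v | qform G v = n%:Z])%classic.
  by apply/seteqP; split => v /=; rewrite /qform bform_mul.
have fin : finite_fibres (U *m G *m U^T).
  move=> n; rewrite fib; apply: finite_preimage; last exact: fG.
  by move=> u v _ _; apply: injU.
split.
  by split; rewrite ?det_congr //; split; rewrite ?det_congr //; exact: posdef_congr.
move=> n; rewrite /theta_coef; apply: esym.
apply: (fsum_reindex (h := fun v => v *m U)) => //.
- by move=> v /=; rewrite /qform bform_mul.
- by move=> u v _ _; exact: injU.
move=> v /= qv; exists (v *m invmx U); last by rewrite mulmxKV.
by rewrite /= /qform -bform_mul mulmxKV.
Qed.

(** After a change of basis the entries of the Gram matrix lie in a fixed interval, and a weight of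
    period N is a function on a finite set with values in a finite field. The index type lists all
    such pairs; those encoding no admissible form receive the zero sequence, which is the first
    alternative of the second clause. *)
Lemma theta_finite : exists (I : finType) (E : I -> nat -> F),
  (forall G f, d_forms G -> periodic N f ->
     exists i, forall n, E i n = theta_coef G f n) /\
  (forall i, (forall n, E i n = 0) \/ exists G f, [/\ d_forms G, periodic N f &
     forall n, E i n = theta_coef G f n]).
Proof.
have [C hC] := hermite_reduction r d.
pose c := `|C|%N.
pose I : finType := ({ffun 'I_r.+1 * 'I_r.+1 -> 'I_(c + c).+1} *
  {ffun {ffun 'I_r.+1 -> 'I_N} -> F})%type.
pose mat (g : {ffun 'I_r.+1 * 'I_r.+1 -> 'I_(c + c).+1}) : 'M[int]_r.+1 :=
  \matrix_(i, j) (Posz (g (i, j)) - c%:Z).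
have mN (z : int) : (`|modz z N| < N)%N.
  by have := modz_ge0 z (d := N); have := ltz_pmod z (d := N); lia.
pose vm (v : 'rV[int]_r.+1) : {ffun 'I_r.+1 -> 'I_N} :=
  [ffun j => Ordinal (mN (v 0 j))].
have vmP u v : vm (u + N%:Z *: v) = vm u.
  by apply/ffunP => j; rewrite !ffunE; apply: val_inj; rewrite /= !mxE mulrC addrC modzMDl.
pose E (i : I) n := if `[< d_forms (mat i.1) >] then
   theta_coef (mat i.1) (fun v => i.2 (vm v)) n else 0.
exists I, E; split; last first.
  move=> i; rewrite /E; case: asboolP => h; [right|by left].
  by exists (mat i.1), (fun v => i.2 (vm v)); split=> // u v; rewrite vmP.
move=> G f dG fN.
have [U uU UC] : exists2 U : 'M[int]_r.+1, U \in unitmx &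
    forall i j, `|(U *m G *m U^T) i j| <= C.
  by case: (dG) => [[pG _ _] eG]; apply: hC => //; rewrite eG.
have [dG' th] := theta_congr f uU dG.
set G' := U *m G *m U^T in UC dG' th.
pose f' v := f (v *m U).
have f'N : periodic N f' by move=> u v; rewrite /f' mulmxDl -scalemxAl fN.
have gN i j : (absz (G' i j + c%:Z)%R < (c + c).+1)%N by have := UC i j; rewrite /c; lia.
pose g : {ffun 'I_r.+1 * 'I_r.+1 -> 'I_(c + c).+1} :=
  [ffun x => Ordinal (gN x.1 x.2)].
have matg : mat g = G'.
  apply/matrixP => i j; rewrite mxE ffunE /=.
  by move: (UC i j); rewrite /c; move: (G' i j) => x; lia.
pose h : {ffun {ffun 'I_r.+1 -> 'I_N} -> F} := [ffun x : {ffun 'I_r.+1 -> 'I_N} => f' (\row_j Posz (x j))].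
have hE v : h (vm v) = f' v.
  rewrite /h ffunE -[LHS](f'N _ (\row_j divz (v 0 j) N)); congr f'.
  apply/rowP => j; rewrite !mxE ffunE /=.
  have := modz_ge0 (v 0 j) (d := N); have := divz_eq (v 0 j) N.
  by move: (divz _ _) (modz _ _) => q m e h0; rewrite {1}e; lia.
exists (g, h) => n; rewrite /E /= matg asboolT // -th.
by congr (theta_coef _ _ n); apply: funext => v; rewrite hE.
Qed.

(** Dividing the Hecke relation by p - 1 isolates the coefficient at p^2 n and leaves p^(r-1) in
    front of the one at n/p^2. Both p - 1 and p must therefore be invertible in [F]. *)
Lemma theta_null (G : 'M[int]_r.+1) (f : 'rV[int]_r.+1 -> F) :
  good_form p G -> \det G = d -> periodic N f -> hecke_null p (theta_coef G f).
Proof.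
move=> gG dG fN.
have [I [E [hE1 hE2]]] := theta_finite.
have rec i : exists ai : I -> F, forall n, (p %| n)%N -> E i (p ^ 2 * n)%N =
    \sum_k ai k * E k n - (p ^ r.-1)%:R * (if (p ^ 2 %| n)%N then E i (n %/ p ^ 2)%N else 0).
  case: (hE2 i) => [E0|[G' [f' [[gG' dG'] f'N Ei]]]].
    exists (fun _ => 0) => n _; rewrite !E0 big1 => [|k _]; last by rewrite mul0r.
    by case: ifP; rewrite mulr0 subr0.
  have [Gs [fs [h1 h2]]] := hecke_relation p_pr p_odd pN gG' f'N.
  move: h1 h2; set V := finset _ => h1 h2.
  have /boolp.choice[j hj] : forall v, exists j, v \in V ->
      forall n, E j n = theta_coef (Gs v) (fs v) n.
    move=> v; case vV: (v \in V); last by exists i.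
    have [g1 g2 g3] := h1 v vV.
    by have [j hj] := hE1 (Gs v) (fs v) (conj g1 (etrans g2 dG')) g3; exists j.
  pose K : F := #|V|%:R - p.-1%:R - (p.-1 * p ^ r.-1)%:R.
  exists (fun k => (p.-1%:R)^-1 * ((\sum_(v in V | j v == k) 1) - K * (k == i)%:R)) => n pn.
  have := h2 n pn.
  rewrite (eq_bigr (fun v => E (j v) n)) => [|v vV]; last by rewrite hj.
  rewrite -!Ei => h3.
  have -> : \sum_k (p.-1%:R)^-1 * (\sum_(v in V | j v == k) 1 - K * (k == i)%:R) * E k n =
     (p.-1%:R)^-1 * (\sum_(v in V) E (j v) n - K * E i n).
    under eq_bigr => k _ do rewrite -mulrA mulrBl.
    rewrite -mulr_sumr sumrB; congr (_ * (_ - _)).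
      rewrite [RHS](partition_big j predT) //=; apply: eq_bigr => k _.
      by rewrite mulr_suml; apply: eq_bigr => v /andP[_ /eqP ->]; rewrite mul1r.
    rewrite (bigD1 i) //= eqxx mulr1 big1 ?addr0 // => k /negbTE ->.
    by rewrite mulr0 mul0r.
  rewrite h3 /K natrM.
  move: (if _ then _ else _) => X; field; exact: p1F.
have /boolp.choice[a ha] := rec.
have [i hi] := hE1 G f (conj gG dG) fN.
have b0 : (p ^ r.-1)%:R != 0 :> F by rewrite natrX expf_neq0.
have [s s0 hs] := recursion_null p_pr b0 ha i.
by exists s => // t n t0 pn; rewrite -hi hs.
Qed.

End ThetaFinite.

(** * The ring of formal power series over a field *)

Record series (F : fieldType) := Series { coef : nat -> F }.

Section SeriesRing.
Variable F : fieldType.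
Implicit Types x y z : series F.

HB.instance Definition _ := gen_eqMixin (series F).
HB.instance Definition _ := gen_choiceMixin (series F).

Lemma seriesP x y : (forall n, coef x n = coef y n) -> x = y.
Proof. by case: x y => [f] [g] /= /funext ->. Qed.

Definition add_series x y := Series (fun n => coef x n + coef y n).
Definition opp_series x := Series (fun n => - coef x n).
Definition zero_series : series F := Series (fun _ => 0).
Definition one_series : series F := Series (fun n => (n == 0)%:R).
Definition mul_series x y :=
  Series (fun n => \sum_(i < n.+1) coef x i * coef y (n - i)).

Lemma add_seriesA : associative add_series.
Proof. by move=> x y z; apply: seriesP => n; rewrite /= addrA. Qed.
Lemma add_seriesC : commutative add_series.
Proof. by move=> x y; apply: seriesP => n; rewrite /= addrC. Qed.
Lemma add0series : left_id zero_series add_series.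
Proof. by move=> x; apply: seriesP => n; rewrite /= add0r. Qed.
Lemma addNseries : left_inverse zero_series opp_series add_series.
Proof. by move=> x; apply: seriesP => n; rewrite /= addNr. Qed.

HB.instance Definition _ := GRing.isZmodule.Build (series F)
  add_seriesA add_seriesC add0series addNseries.

(* products of series are computed on polynomials agreeing up to the relevant degree *)
Lemma mul_series_poly (p q : {poly F}) x y n :
  (forall i, (i <= n)%N -> p`_i = coef x i) ->
  (forall i, (i <= n)%N -> q`_i = coef y i) ->
  (p * q)`_n = coef (mul_series x y) n.
Proof.
move=> hp hq; rewrite coefM; apply: eq_bigr => i _.
by rewrite hp ?hq ?leq_subr // -ltnS.
Qed.

Definition trunc n x : {poly F} := \poly_(i < n.+1) coef x i.

Lemma coef_trunc n x i : (i <= n)%N -> (trunc n x)`_i = coef x i.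
Proof. by move=> ilen; rewrite coef_poly ltnS ilen. Qed.

Lemma mul_seriesA : associative mul_series.
Proof.
move=> x y z; apply: seriesP => n.
pose t := trunc n.
rewrite -(@mul_series_poly (t x) (t y * t z)); first last.
- move=> i ilen; apply: mul_series_poly => j jlei; exact: coef_trunc (leq_trans jlei ilen).
- by move=> i; apply: coef_trunc.
rewrite mulrA; apply: mul_series_poly => i ilen; last exact: coef_trunc.
by apply: mul_series_poly => j jlei; exact: coef_trunc (leq_trans jlei ilen).
Qed.

Lemma mul_seriesC : commutative mul_series.
Proof.
move=> x y; apply: seriesP => n.
rewrite -(@mul_series_poly (trunc n x) (trunc n y)); try by move=> i; apply: coef_trunc.
by rewrite mulrC; apply: mul_series_poly => i; apply: coef_trunc.
Qed.

Lemma mul1series : left_id one_series mul_series.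
Proof.
move=> x; apply: seriesP => n; rewrite -(@mul_series_poly 1 (trunc n x)).
- by rewrite mul1r coef_trunc.
- by move=> i _; rewrite coef1.
by move=> i; apply: coef_trunc.
Qed.

Lemma mul_seriesDl : left_distributive mul_series +%R.
Proof.
move=> x y z; apply: seriesP => n /=; rewrite -big_split /=.
by apply: eq_bigr => i _; rewrite mulrDl.
Qed.

Lemma oner_series_neq0 : one_series != 0.
Proof.
by apply/eqP => /(congr1 (fun x => coef x 0)) /= /eqP; rewrite oner_eq0.
Qed.

HB.instance Definition _ := GRing.Zmodule_isComNzRing.Build (series F)
  mul_seriesA mul_seriesC mul1series mul_seriesDl oner_series_neq0.

Lemma coefDs x y n : coef (x + y) n = coef x n + coef y n. Proof. by []. Qed.
Lemma coefNs x n : coef (- x) n = - coef x n. Proof. by []. Qed.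
Lemma coefBs x y n : coef (x - y) n = coef x n - coef y n. Proof. by []. Qed.
Lemma coef0s n : coef (0 : series F) n = 0. Proof. by []. Qed.
Lemma coef1s n : coef (1 : series F) n = (n == 0)%:R. Proof. by []. Qed.
Lemma coefMs x y n : coef (x * y) n = \sum_(i < n.+1) coef x i * coef y (n - i).
Proof. by []. Qed.
Lemma coefM0 x y : coef (x * y) 0 = coef x 0 * coef y 0.
Proof. by rewrite coefMs big_ord1. Qed.
Lemma coefX0 x k : coef (x ^+ k) 0 = coef x 0 ^+ k.
Proof. by elim: k => [|k IH]; rewrite ?coef1s // !exprS coefM0 IH. Qed.

Lemma coef_sums (I : Type) (r : seq I) (P : pred I) (f : I -> series F) n :
  coef (\sum_(i <- r | P i) f i) n = \sum_(i <- r | P i) coef (f i) n.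
Proof. by apply: (big_morph (fun x => coef x n)). Qed.

Lemma coefM_poly (p q : {poly F}) x y n :
  (forall i, (i <= n)%N -> p`_i = coef x i) ->
  (forall i, (i <= n)%N -> q`_i = coef y i) ->
  (p * q)`_n = coef (x * y) n.
Proof. exact: mul_series_poly. Qed.

Lemma coefX_poly x k n : coef (x ^+ k) n = (trunc n x ^+ k)`_n.
Proof.
suff h i : (i <= n)%N -> (trunc n x ^+ k)`_i = coef (x ^+ k) i by rewrite h.
elim: k i => [|k IH] i ilen; first by rewrite !expr0 coef1 coef1s.
rewrite !exprS; apply: coefM_poly => j jlei; last by apply: IH; apply: leq_trans ilen.
exact: coef_trunc (leq_trans jlei ilen).
Qed.

Definition const (c : F) : series F := Series (fun n => if n == 0 then c else 0).

Lemma coef_constM c x n : coef (const c * x) n = c * coef x n.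
Proof.
rewrite coefMs big_ord_recl /= subn0 big1 ?addr0 // => i _.
by rewrite /bump leq0n mul0r.
Qed.

Lemma const_is_additive : additive const.
Proof.
by move=> a b; apply: seriesP => n; rewrite coefBs /=; case: eqP => // _; rewrite subr0.
Qed.
Lemma const_is_monoid_morphism : monoid_morphism const.
Proof.
split; first by apply: seriesP => n; rewrite coef1s /=; case: eqP.
move=> a b; apply: seriesP => n; rewrite coef_constM /=.
by case: eqP => // _; rewrite mulr0.
Qed.
HB.instance Definition _ := GRing.isZmodMorphism.Build F (series F) const const_is_additive.
HB.instance Definition _ := GRing.isMonoidMorphism.Build F (series F) const
  const_is_monoid_morphism.

Lemma const_natr k : const k%:R = k%:R.
Proof. exact: rmorph_nat. Qed.

Lemma coef_natr k n : coef (k%:R : series F) n = if n == 0 then k%:R else 0.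
Proof. by rewrite -const_natr. Qed.

Definition qpow (k : nat) : series F := Series (fun n => (n == k)%:R).

Lemma coef_qpowM k x n : coef (qpow k * x) n = if (k <= n)%N then coef x (n - k) else 0.
Proof.
rewrite coefMs; case: leqP => kn.
  have kn' : (k < n.+1)%N by rewrite ltnS.
  rewrite (bigD1 (Ordinal kn')) //= eqxx mul1r big1 ?addr0 // => i ik.
  rewrite (_ : (i == k :> nat) = false) ?mul0r //.
  by apply/negbTE; apply: contra ik => /eqP h; apply/eqP/val_inj.
rewrite big1 // => i _ /=; rewrite (_ : (i == k :> nat) = false) ?mul0r //=.
by have := ltn_ord i; apply: contraTF => /eqP ->; rewrite -leqNgt.
Qed.

Lemma qpow0 : qpow 0 = 1. Proof. exact: seriesP. Qed.

Lemma qpowD j k : qpow (j + k) = qpow j * qpow k.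
Proof.
apply: seriesP => n; rewrite coef_qpowM /=; case: leqP => jn.
  by rewrite -[in LHS](subnKC jn) eqn_add2l.
by rewrite (_ : (n == _) = false) //; lia.
Qed.

Lemma qpowM k n : qpow (n * k) = qpow k ^+ n.
Proof. by elim: n => [|n IH]; rewrite ?mul0n ?qpow0 ?mulSn ?qpowD ?exprS ?IH. Qed.

Lemma coef_qdiv x : coef x 0 = 0 -> exists y, x = qpow 1%N * y.
Proof.
move=> x0; exists (Series (fun n => coef x n.+1)); apply: seriesP => n.
by rewrite coef_qpowM; case: n => [|n] //=; rewrite subn1.
Qed.

Lemma coefX_lt x k n : coef x 0 = 0 -> (n < k)%N -> coef (x ^+ k) n = 0.
Proof.
case/coef_qdiv=> y -> nk; rewrite exprMn -qpowM muln1 coef_qpowM.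
by rewrite leqNgt nk.
Qed.

(** Coefficient n of the geometric series needs only the powers up to n when u has no constant
    term. *)
Definition inv1_series u : series F :=
  Series (fun n => coef (\sum_(k < n.+1) u ^+ k) n).

Lemma inv1_seriesP u : coef u 0 = 0 -> (1 - u) * inv1_series u = 1.
Proof.
move=> u0; apply: seriesP => n.
have stab i : (i <= n)%N -> coef (inv1_series u) i = coef (\sum_(k < n.+1) u ^+ k) i.
  move=> ilen; rewrite /inv1_series /= !coef_sums (big_ord_widen n.+1 (fun k => coef (u ^+ k) i)) //.
  rewrite big_mkcond; apply: eq_bigr => k _; case: ltnP => // ik.
  by rewrite coefX_lt.
have -> : coef ((1 - u) * inv1_series u) n = coef ((1 - u) * \sum_(k < n.+1) u ^+ k) n.
  by rewrite !coefMs; apply: eq_bigr => i _; rewrite stab // leq_subr.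
have -> : (1 - u) * (\sum_(k < n.+1) u ^+ k) = 1 - u ^+ n.+1 by rewrite -[RHS]opprB subrX1 -mulNr opprB.
by rewrite coefBs coefX_lt // subr0.
Qed.

Definition unit_series : pred (series F) := fun x => coef x 0 != 0.
Definition inv_series x : series F :=
  if unit_series x then const (coef x 0)^-1 * inv1_series (1 - const (coef x 0)^-1 * x) else x.

Lemma mulV_series : {in unit_series, left_inverse 1 inv_series *%R}.
Proof.
move=> x ux; rewrite /inv_series (_ : unit_series x = true) //.
set a := const _; set u := 1 - a * x.
have : (1 - u) * inv1_series u = 1.
  by apply: inv1_seriesP; rewrite /u coefBs coef1s coef_constM mulVf ?subrr.
by rewrite /u; set w := inv1_series _ => <-; ring.
Qed.

Lemma unit_seriesP x y : y * x = 1 -> x \in unit_series.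
Proof.
move=> /(congr1 (fun z => coef z 0)); rewrite coefM0 coef1s /= => h.
apply/negP => /eqP x0; move: h; rewrite x0 mulr0 => /esym/eqP.
by rewrite oner_eq0.
Qed.

Lemma inv_series_out : {in [predC unit_series], inv_series =1 id}.
Proof.
move=> x /negP nu; rewrite /inv_series; case: ifP => // ux; case: nu; exact: ux.
Qed.

HB.instance Definition _ := GRing.ComNzRing_hasMulInverse.Build (series F)
  mulV_series unit_seriesP inv_series_out.

Lemma series_lead x : x != 0 -> exists k y, x = qpow k * y /\ coef y 0 != 0.
Proof.
move=> x0; have ex : exists n, coef x n != 0.
  apply: contrapT => h; move/eqP: x0; apply; apply: seriesP => n.
  by apply/eqP; apply: contraT => hn; case: h; exists n.
case: (ex_minnP ex) => k xk kmin; exists k, (Series (fun n => coef x (n + k))); split=> //.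
apply: seriesP => n; rewrite coef_qpowM; case: leqP => kn /=; first by rewrite subnK.
by apply/eqP; apply: contraTT kn => /kmin; rewrite -leqNgt.
Qed.

Lemma mulf_eq0_series : GRing.integral_domain_axiom (series F).
Proof.
move=> x y xy; apply/orP; case: (eqVneq x 0) => x0; [by left|right].
apply: contraT => y0.
have [j [a [xE a0]]] := series_lead x0; have [k [b [yE b0]]] := series_lead y0.
move/(congr1 (fun z => coef z (j + k))): xy.
have -> : x * y = qpow (j + k) * (a * b) by rewrite xE yE qpowD; ring.
rewrite coef_qpowM leqnn subnn coefM0 /= => /eqP.
by rewrite mulf_eq0 (negbTE a0) (negbTE b0).
Qed.

HB.instance Definition _ := GRing.ComUnitRing_isIntegral.Build (series F) mulf_eq0_series.

Lemma unit_series_coef0 x : (x \is a GRing.unit) = (coef x 0 != 0).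
Proof. by []. Qed.

Lemma series_neq0 x : coef x 0 != 0 -> x != 0.
Proof. by apply: contra => /eqP ->. Qed.

(** In x^k - y^k = (x - y)(...) the second factor has constant term k x_0^(k-1), which is nonzero.
    This extracts square and eighth roots of identities between eta quotients. *)
Lemma series_expr_inj x y k : (0 < k)%N -> k%:R != 0 :> F -> coef x 0 = coef y 0 ->
  coef x 0 != 0 -> x ^+ k = y ^+ k -> x = y.
Proof.
move=> k0 kF xy x0 /eqP; rewrite -subr_eq0 subrXX mulf_eq0 => /orP[|].
  by rewrite subr_eq0 => /eqP.
move=> /eqP /(congr1 (fun z => coef z 0)) /eqP; rewrite coef_sums coef0s.
under eq_bigr => i _ do rewrite coefM0 !coefX0 -xy -exprD.
rewrite (eq_bigr (fun=> coef x 0 ^+ k.-1)) => [|i _]; last first.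
  by congr (_ ^+ _); have := ltn_ord i; lia.
by rewrite sumr_const card_ord -mulr_natr mulf_eq0 expf_eq0 (negbTE x0) andbF (negbTE kF).
Qed.

End SeriesRing.

(** * Substitution, extraction and derivation operators *)

Section Operators.
Variable F : fieldType.
Implicit Types x y z : series F.

(** [Vop k] is q -> q^k, [Uop k e] keeps the progression k n + e, [Dop] is q d/dq, and [neg_arg] is
    q -> -q. *)
Definition Vop (k : nat) x : series F :=
  Series (fun n => if (k %| n)%N then coef x (n %/ k) else 0).
Definition Uop (k e : nat) x : series F := Series (fun n => coef x (k * n + e)).
Definition Dop x : series F := Series (fun n => n%:R * coef x n).
Definition neg_arg x : series F := Series (fun n => (-1) ^+ n * coef x n).

Lemma Vop_additive k : additive (Vop k).
Proof. by move=> x y; apply: seriesP => n; rewrite /= ; case: ifP; rewrite ?subr0. Qed.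

Lemma Vop_monoid_morphism k : monoid_morphism (Vop k.+1).
Proof.
split=> [|x y]; apply: seriesP => n.
  rewrite coef1s /Vop [LHS]/=; case: ifP => [/dvdnP[j ->]|]; last by case: n.
  by rewrite mulnK // muln_eq0 orbF.
have h z i : (i <= n)%N -> (trunc n z \Po 'X^(k.+1))`_i = coef (Vop k.+1 z) i.
  move=> ilen; rewrite coef_comp_poly_Xn //=; case: ifP => // _.
  by rewrite coef_trunc // (leq_trans (leq_div _ _)).
rewrite -(coefM_poly (h x) (h y)) -comp_polyM coef_comp_poly_Xn //=.
case: ifP => // _; apply/esym; apply: coefM_poly => i ile; apply: coef_trunc;
  exact: leq_trans ile (leq_div _ _).
Qed.

HB.instance Definition _ k := GRing.isZmodMorphism.Build _ _ (Vop k) (Vop_additive k).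
HB.instance Definition _ k := GRing.isMonoidMorphism.Build _ _ (Vop k.+1)
  (Vop_monoid_morphism k).

Lemma Vop_coef0 k x : coef (Vop k x) 0 = coef x 0.
Proof. by rewrite /= dvdn0 div0n. Qed.

Lemma Vop_comp j k x : (0 < k)%N -> Vop j (Vop k x) = Vop (j * k) x.
Proof.
move=> k0; apply: seriesP => n /=; case: (posnP j) => [->|j0].
  rewrite mul0n dvd0n; case: eqP => [->|] //; by rewrite !div0n dvdn0.
case: (boolP (j %| n)%N) => [/dvdnP[i ->]|jn]; last first.
  by case: ifP => // /(dvdn_trans (dvdn_mulr k (dvdnn j))); rewrite (negbTE jn).
by rewrite mulnK // (mulnC i) dvdn_pmul2l // divnMl.
Qed.

Lemma Vop_const k c : Vop k (const c) = const c :> series F.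
Proof.
apply: seriesP => n /=; case: (posnP k) => [->|k0].
  by rewrite dvd0n divn0 /=; case: eqP.
case: (boolP (k %| n)%N) => [/dvdnP[i ->]|kn]; last by case: n kn => //=; rewrite dvdn0.
by rewrite mulnK // muln_eq0 [k == _]gtn_eqF // orbF.
Qed.

Lemma Vop_qpow k j : (0 < k)%N -> Vop k (qpow F j) = qpow F (k * j).
Proof.
move=> k0; apply: seriesP => n /=.
case: (boolP (k %| n)%N) => [/dvdnP[i ->]|kn].
  by rewrite mulnK // mulnC eqn_pmul2l.
by rewrite (_ : (n == _) = false) //; apply/negbTE; apply: contra kn => /eqP ->; rewrite dvdn_mulr.
Qed.

Lemma neg_arg_additive : additive neg_arg.
Proof. by move=> x y; apply: seriesP => n; rewrite /= mulrBr. Qed.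
Lemma neg_arg_monoid_morphism : monoid_morphism neg_arg.
Proof.
split=> [|x y]; apply: seriesP => n /=.
  by case: n => [|n]; rewrite ?expr0 ?mulr1 // mulr0.
rewrite mulr_sumr; apply: eq_bigr => i _.
have -> : (-1) ^+ n = (-1) ^+ i * (-1) ^+ (n - i) :> F.
  by rewrite -exprD subnKC // -ltnS.
ring.
Qed.
HB.instance Definition _ := GRing.isZmodMorphism.Build _ _ neg_arg neg_arg_additive.
HB.instance Definition _ := GRing.isMonoidMorphism.Build _ _ neg_arg neg_arg_monoid_morphism.

Lemma neg_argK : involutive neg_arg.
Proof. by move=> x; apply: seriesP => n /=; rewrite mulrA -expr2 sqrr_sign mul1r. Qed.

Lemma neg_arg_coef0 x : coef (neg_arg x) 0 = coef x 0.
Proof. by rewrite /= mul1r. Qed.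

Lemma neg_arg_qpow j : neg_arg (qpow F j) = (-1) ^+ j * qpow F j.
Proof.
apply: seriesP => n; rewrite -[-1](rmorphN1 (@const F)) -rmorphXn coef_constM /=.
by case: eqP => [->|]; rewrite ?mulr0.
Qed.

Lemma neg_arg_Vop_even k x : ~~ odd k -> neg_arg (Vop k x) = Vop k x.
Proof.
move=> ek; apply: seriesP => n /=; case: ifP => [kn|]; last by rewrite mulr0.
have : ~~ odd n by case/dvdnP: kn => i ->; rewrite oddM (negbTE ek) andbF.
by rewrite -signr_odd => /negbTE ->; rewrite mul1r.
Qed.

Lemma neg_arg_Vop_odd k x : odd k -> neg_arg (Vop k x) = Vop k (neg_arg x).
Proof.
move=> ok; apply: seriesP => n /=; case: ifP => [kn|]; last by rewrite mulr0.
congr (_ * _); rewrite -signr_odd -[RHS]signr_odd; congr (_ ^+ _).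
by rewrite -[in LHS](divnK kn) oddM ok andbT.
Qed.

Lemma Dop_additive : additive Dop.
Proof. by move=> x y; apply: seriesP => n; rewrite /= mulrBr. Qed.
HB.instance Definition _ := GRing.isZmodMorphism.Build _ _ Dop Dop_additive.

Lemma DopM x y : Dop (x * y) = Dop x * y + x * Dop y.
Proof.
apply: seriesP => n; rewrite coefDs !coefMs /= mulr_sumr -big_split /=.
apply: eq_bigr => i _; have -> : n%:R = i%:R + (n - i)%:R :> F.
  by rewrite -natrD subnKC // -ltnS.
ring.
Qed.

Lemma Dop1 : Dop 1 = 0.
Proof. by apply: seriesP => -[|n] /=; rewrite ?mul0r ?mulr0. Qed.

Lemma DopX x k : Dop (x ^+ k) = k%:R * x ^+ k.-1 * Dop x.
Proof.
elim: k => [|k IH]; first by rewrite expr0 Dop1 !mul0r.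
rewrite exprS DopM IH; case: k {IH} => [|k] /=.
  by rewrite !expr0; ring.
by rewrite exprS (natrD _ 1 k.+1); ring.
Qed.

Lemma Dop_Vop k x : Dop (Vop k x) = k%:R * Vop k (Dop x).
Proof.
apply: seriesP => n; rewrite -const_natr coef_constM /=.
case: ifP => [kn|]; last by rewrite !mulr0.
by rewrite mulrA -natrM mulnC divnK.
Qed.

Lemma Dop_const c : Dop (const c) = 0 :> series F.
Proof. by apply: seriesP => -[|n] /=; rewrite ?mul0r ?mulr0. Qed.

Lemma Dop_qpow k : Dop (qpow F k) = k%:R * qpow F k.
Proof.
apply: seriesP => n; rewrite -const_natr coef_constM /=.
by case: eqP => [->|]; rewrite ?mulr0.
Qed.

Lemma coefUop k e x n : coef (Uop k e x) n = coef x (k * n + e).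
Proof. by []. Qed.

Lemma Uop_additive k e : additive (Uop k e).
Proof. by move=> x y; apply: seriesP. Qed.
HB.instance Definition _ k e := GRing.isZmodMorphism.Build _ _ (Uop k e) (Uop_additive k e).

Lemma big_dvdn (V : nmodType) k n e (G : nat -> V) : (e < k)%N ->
  \sum_(0 <= i < (k * n + e).+1 | (k %| i)%N) G i = \sum_(0 <= j < n.+1) G (k * j)%N.
Proof.
move=> ek; have k0 : (0 < k)%N by case: k ek.
rewrite -big_filter -[RHS](big_map (muln k) predT G); apply: perm_big.
apply: uniq_perm; first by rewrite filter_uniq ?iota_uniq.
  by rewrite map_inj_uniq ?iota_uniq // => i j /eqP; rewrite eqn_pmul2l // => /eqP.
move=> i; rewrite mem_filter mem_index_iota; apply/andP/mapP => [[/dvdnP[j ->] h]|[j]].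
  exists j; last by rewrite mulnC.
  rewrite mem_index_iota /= ltnNge; apply/negP => nj.
  have : (k * n.+1 <= k * j)%N by rewrite leq_pmul2l.
  by move: h; rewrite mulnC; nia.
rewrite mem_index_iota /= ltnS => jn ->; rewrite dvdn_mulr //; split=> //.
by rewrite ltnS (leq_trans _ (leq_addr _ _)) // leq_pmul2l.
Qed.

Lemma Uop_VopM k e x y : (e < k)%N -> Uop k e (Vop k x * y) = x * Uop k e y.
Proof.
move=> ek; apply: seriesP => n; have k0 : (0 < k)%N by case: k ek.
transitivity (\sum_(0 <= i < (k * n + e).+1 | (k %| i)%N) coef x (i %/ k) * coef y (k * n + e - i)).
  rewrite /= big_mkord [RHS]big_mkcond; apply: eq_bigr => i _.
  by case: ifP => _; rewrite ?mul0r.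
rewrite (big_dvdn n (fun i => coef x (i %/ k) * coef y (k * n + e - i))) // big_mkord.
apply: eq_bigr => j _; rewrite mulKn //=; congr (_ * coef y _).
by have := ltn_ord j; rewrite ltnS => jn; rewrite mulnBr addnBAC // leq_pmul2l.
Qed.

Lemma Uop_Vop k x : (0 < k)%N -> Uop k 0 (Vop k x) = x.
Proof. by move=> k0; apply: seriesP => n /=; rewrite addn0 dvdn_mulr // mulKn. Qed.

Lemma Uop_constM k e c x : Uop k e (const c * x) = const c * Uop k e x.
Proof. by apply: seriesP => n; rewrite coef_constM !coefUop coef_constM. Qed.

Lemma Uop_comp j k x : Uop j 0 (Uop k 0 x) = Uop (k * j) 0 x.
Proof. by apply: seriesP => n /=; rewrite !addn0 mulnA. Qed.

Lemma Uop_qpowM k e x : Uop k e (qpow F e * x) = Uop k 0 x.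
Proof. by apply: seriesP => n; rewrite !coefUop coef_qpowM leq_addl addnK addn0. Qed.

(** Coefficient n is either 0 or the coefficient at n/k, so all those of positive index vanish by
    descent. Identities invariant under q -> q^2 are proved by this rigidity. *)
Lemma Vop_fix k x : (1 < k)%N -> Vop k x = x -> x = const (coef x 0).
Proof.
move=> k1 xV; apply: seriesP => n; elim/ltn_ind: n => n IH; case: n IH => [|n] IH //=.
rewrite -xV /=; case: ifP => // kn; rewrite IH ?ltn_Pdiv // /=.
by rewrite gtn_eqF // divn_gt0 ?(ltn_trans _ k1) // dvdn_leq.
Qed.

End Operators.

(** * Frobenius on power series over F_m *)

Section Frobenius.
Variable m : nat.
Hypothesis m_pr : prime m.
Implicit Types x : series 'F_m.

Lemma poly_Fp_frobenius (P : {poly 'F_m}) : P ^+ m = P \Po 'X^m.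
Proof.
have chm : m \in [pchar {poly 'F_m}] by rewrite pchar_poly pchar_Fp.
rewrite -[P in LHS]coefK poly_def -(pFrobenius_autE chm) rmorph_sum /=.
rewrite comp_polyE; apply: eq_bigr => i _.
rewrite pFrobenius_autE exprZn -exprM mulnC exprM; congr (_ *: _).
by rewrite -[in RHS](expf_card P`_i) card_Fp.
Qed.

Lemma series_frobenius x : x ^+ m = Vop m x.
Proof.
apply: seriesP => n; rewrite coefX_poly poly_Fp_frobenius coef_comp_poly_Xn ?prime_gt0 //=.
by case: ifP => // _; rewrite coef_trunc // leq_div.
Qed.

End Frobenius.

(** * Generating series of statistics with finite sublevel sets *)

Definition proper (T : choiceType) (e : T -> nat) : Prop :=
  forall n, finite_set [set t | (e t <= n)%N]%classic.

Lemma proper_fibre (T : choiceType) (e : T -> nat) n : proper e ->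
  finite_set [set t | e t = n]%classic.
Proof. by move=> /(_ n); apply: sub_finite_set => t /= ->. Qed.

Lemma proper_inj (T T' : choiceType) (e : T' -> nat) (h : T -> T') :
  injective h -> proper e -> proper (e \o h).
Proof.
by move=> hI pe n; apply: (@finite_preimage _ _ [set t | (e t <= n)%N]%classic h) => // x y _ _; apply: hI.
Qed.

Lemma proper_prod (T T' : choiceType) (e : T -> nat) (e' : T' -> nat) :
  proper e -> proper e' -> proper (fun t : T * T' => e t.1 + e' t.2)%N.
Proof.
move=> pe pe' n; apply: (@sub_finite_set _ _ ([set t | (e t <= n)%N] `*` [set t | (e' t <= n)%N])%classic).
  by move=> [x y] /= h; split=> /=; lia.
by apply: finite_setX.
Qed.

Lemma proper_int (e : int -> nat) (K : nat) :
  (forall x, (`|x| <= K * e x + K)%N) -> proper e.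
Proof.
move=> h n.
pose s := [seq Posz i - Posz (K * n + K) | i <- iota 0 (2 * (K * n + K)).+1].
apply: (@sub_finite_set _ _ [set` s]%classic); last exact: finite_seq.
move=> x /= ex; suff : x \in s by []; apply/mapP; exists (absz (x + Posz (K * n + K))); last by have := h x; nia.
by rewrite mem_iota /=; have := h x; nia.
Qed.

Section Gen.
Variable F : fieldType.

Definition gen (T : choiceType) (e : T -> nat) (c : T -> F) : series F :=
  Series (fun n => fsum [set t | e t = n]%classic c).

Lemma gen_ext (T : choiceType) (e e' : T -> nat) (c c' : T -> F) :
  e =1 e' -> c =1 c' -> gen e c = gen e' c'.
Proof. by move=> /funext -> /funext ->. Qed.

Lemma genD (T : choiceType) (e : T -> nat) (c c' : T -> F) :
  gen e (fun t => c t + c' t) = gen e c + gen e c'.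
Proof. by apply: seriesP => n; rewrite coefDs /= /fsum big_split. Qed.

Lemma genZ (T : choiceType) (e : T -> nat) (a : F) (c : T -> F) :
  gen e (fun t => a * c t) = const a * gen e c.
Proof. by apply: seriesP => n; rewrite coef_constM /= /fsum mulr_sumr. Qed.

Lemma genN (T : choiceType) (e : T -> nat) (c : T -> F) :
  gen e (fun t => - c t) = - gen e c.
Proof. by apply: seriesP => n; rewrite coefNs /= /fsum sumrN. Qed.

Lemma gen_Vop (T : choiceType) (e : T -> nat) (c : T -> F) k : (0 < k)%N ->
  Vop k (gen e c) = gen (fun t => k * e t)%N c.
Proof.
move=> k0; apply: seriesP => n /=; case: ifP => [/dvdnP[i ->]|kn].
  rewrite mulnK //; congr fsum; apply/seteqP; split=> t /= => [->|]; first by rewrite mulnC.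
  by rewrite mulnC => /eqP; rewrite eqn_pmul2r // => /eqP.
by apply/esym; apply: fsum_set0 => t /= h; move: kn; rewrite -h dvdn_mulr.
Qed.

Lemma gen_qpow (T : choiceType) (e : T -> nat) (c : T -> F) k :
  qpow F k * gen e c = gen (fun t => k + e t)%N c.
Proof.
apply: seriesP => n; rewrite coef_qpowM /=; case: leqP => kn.
  congr fsum; apply/seteqP; split=> t /=; lia.
by apply/esym; apply: fsum_set0 => t /=; lia.
Qed.

Lemma gen_neg (T : choiceType) (e : T -> nat) (c : T -> F) : proper e ->
  neg_arg (gen e c) = gen e (fun t => (-1) ^+ e t * c t).
Proof.
move=> pe; apply: seriesP => n /=.
have [s us ss] := fsum_mem (proper_fibre n pe).
rewrite !(fsum_seq _ us ss) mulr_sumr; apply: eq_big_seq => t /ss /= <- //.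
Qed.

(** Change of summation variable when the weight vanishes off the image; parity and residue
    conditions enter through the weight. *)
Lemma gen_inj (T T' : choiceType) (h : T -> T') (e : T' -> nat) (c : T' -> F) :
  injective h -> (forall y, c y = 0 \/ exists x, h x = y) -> proper e ->
  gen e c = gen (e \o h) (c \o h).
Proof.
move=> hI hS pe; apply: seriesP => n /=.
have fA := proper_fibre n pe; have fB := proper_fibre n (proper_inj hI pe).
pose P y := `[< exists x, h x = y >].
have -> : fsum [set t | e t = n]%classic c = fsum [set t | e t = n /\ P t]%classic c.
  rewrite (fsum_cond (A := [set t | e t = n]%classic) P) //; apply: eq_fsum => // y _.
  by rewrite /P; case: asboolP => // hy; case: (hS y).
apply: (fsum_reindex (h := h)) => //.
- by move=> x /= ex; split=> //; apply/asboolP; exists x.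
- by move=> x y _ _; apply: hI.
by move=> y [/= ey /asboolP[x xy]]; exists x => //=; rewrite xy.
Qed.

Lemma gen_bij (T T' : choiceType) (h : T -> T') (e : T' -> nat) (c : T' -> F) :
  injective h -> (forall y, exists x, h x = y) -> proper e ->
  gen e c = gen (e \o h) (c \o h).
Proof. by move=> hI hS; apply: gen_inj => // y; right. Qed.

Lemma gen_sum (T T' : choiceType) (e : T -> nat) (e' : T' -> nat) c c' :
  proper e -> proper e' ->
  gen (fun t : T + T' => match t with inl x => e x | inr y => e' y end)
      (fun t : T + T' => match t with inl x => c x | inr y => c' y end) =
  gen e c + gen e' c'.
Proof.
move=> pe pe'; apply: seriesP => n /=.
have [s us ss] := fsum_mem (proper_fibre n pe).
have [s' us' ss'] := fsum_mem (proper_fibre n pe').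
rewrite (fsum_seq _ us ss) (fsum_seq _ us' ss').
rewrite (@fsum_seq _ _ _ _ (map inl s ++ map inr s')) ?big_cat ?big_map //.
  rewrite cat_uniq !map_inj_uniq ?us ?us' /=; try by move=> x y [].
  by rewrite andbT; apply/hasPn => _ /mapP[y _ ->]; apply/mapP => -[].
move=> [x|y] /=; rewrite mem_cat.
  split=> [/ss xs|/orP[/mapP[x' /ss xs [->]]|/mapP[]]] //.
  by rewrite map_f.
split=> [/ss' xs|/orP[/mapP[]|/mapP[x' /ss' xs [->]]]] //.
by rewrite (map_f inr) // orbT.
Qed.

Lemma gen_mul (T T' : choiceType) (e : T -> nat) (e' : T' -> nat) c c' :
  proper e -> proper e' ->
  gen e c * gen e' c' =
  gen (fun t : T * T' => e t.1 + e' t.2)%N (fun t => c t.1 * c' t.2).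
Proof.
move=> pe pe'; apply: seriesP => n; rewrite coefMs /=.
have [a ua ha] := fsum_mem (pe n); have [b ub hb] := fsum_mem (pe' n).
have e1 i : (i <= n)%N -> fsum [set t | e t = i]%classic c = \sum_(x <- a) (e x == i)%:R * c x.
  move=> ilen; rewrite (@fsum_seq _ _ _ _ [seq x <- a | e x == i]) ?filter_uniq //.
    by rewrite big_filter big_mkcond; apply: eq_bigr => x _; case: eqP; rewrite ?mul1r ?mul0r.
  move=> x; rewrite mem_filter; split=> [/= ex|/andP[/eqP] //].
  by rewrite ex eqxx /=; apply/ha; rewrite /= ex.
have e2 i : (i <= n)%N -> fsum [set t | e' t = i]%classic c' = \sum_(x <- b) (e' x == i)%:R * c' x.
  move=> ilen; rewrite (@fsum_seq _ _ _ _ [seq x <- b | e' x == i]) ?filter_uniq //.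
    by rewrite big_filter big_mkcond; apply: eq_bigr => x _; case: eqP; rewrite ?mul1r ?mul0r.
  move=> x; rewrite mem_filter; split=> [/= ex|/andP[/eqP] //].
  by rewrite ex eqxx /=; apply/hb; rewrite /= ex.
rewrite (@fsum_seq _ _ _ _ [seq t <- [seq (x, y) | x <- a, y <- b] | (e t.1 + e' t.2)%N == n]); first last.
- move=> [x y]; rewrite mem_filter /=; split=> [exy|/andP[/eqP] //].
  by rewrite exy eqxx /=; apply/allpairsP; exists (x, y); split=> //=; [apply/ha|apply/hb] => /=; lia.
- by rewrite filter_uniq // allpairs_uniq // => -[x y] [x' y'] _ _.
rewrite [RHS]big_filter [RHS]big_mkcond [RHS]big_allpairs /=.
transitivity (\sum_(i < n.+1) \sum_(x <- a) \sum_(y <- b)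
    ((e x == i)%:R * c x) * ((e' y == n - i)%N%:R * c' y)).
  by apply: eq_bigr => i _; rewrite e1 -1?ltnS // e2 ?leq_subr // big_distrlr.
rewrite exchange_big; apply: eq_bigr => x _; rewrite exchange_big; apply: eq_bigr => y _ /=.
case: (leqP (e x) n) => exn; last first.
  rewrite big1 => [|i _]; first by rewrite gtn_eqF //; lia.
  by rewrite gtn_eqF ?mul0r //; have := ltn_ord i; lia.
have exn' : (e x < n.+1)%N by [].
rewrite (bigD1 (Ordinal exn')) //= eqxx mul1r big1 ?addr0 => [|i ix]; last first.
  rewrite (_ : (e x == i) = false) ?mul0r //.
  by apply: contraNF ix => /eqP h; apply/eqP/val_inj.
rewrite (_ : (e' y == n - e x)%N = (e x + e' y == n)%N); last by lia.
by case: eqP; rewrite ?mul1r // mul0r mulr0.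
Qed.

End Gen.

(** * Classical theta series and their dissections *)

Definition sq (x : int) : nat := (`|x| ^ 2)%N.
Definition tri (x : int) : nat := (absz (x * (x + 1))%R %/ 2)%N.
Definition pent (x : int) : nat := (absz (x * (3 * x + 1))%R %/ 2)%N.
Definition hex (x : int * int) : nat := absz (x.1 ^+ 2 + x.1 * x.2 + x.2 ^+ 2)%R.

Lemma sqE x : (sq x)%:Z = x ^+ 2.
Proof. by rewrite /sq; lia. Qed.

Lemma triE x : 2 * (tri x)%:Z = x ^+ 2 + x.
Proof.
have [k hk] : exists k : int, x = 2 * k \/ x = 2 * k + 1 by exists (divz x 2); lia.
have [y hy] : exists y, x * (x + 1) = 2 * y.
  by case: hk => ->; [exists (k * (2 * k + 1))|exists ((2 * k + 1) * (k + 1))]; ring.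
have y0 : 0 <= y by nia.
by have -> : x ^+ 2 + x = 2 * y by [rewrite -hy; ring]; rewrite /tri hy; lia.
Qed.

Lemma pentE x : 2 * (pent x)%:Z = 3 * x ^+ 2 + x.
Proof.
have [k hk] : exists k : int, x = 2 * k \/ x = 2 * k + 1 by exists (divz x 2); lia.
have [y hy] : exists y, x * (3 * x + 1) = 2 * y.
  by case: hk => ->; [exists (k * (6 * k + 1))|exists ((2 * k + 1) * (3 * k + 2))]; ring.
have y0 : 0 <= y by nia.
by have -> : 3 * x ^+ 2 + x = 2 * y by [rewrite -hy; ring]; rewrite /pent hy; lia.
Qed.

Lemma hexE x : (hex x)%:Z = x.1 ^+ 2 + x.1 * x.2 + x.2 ^+ 2.
Proof. by rewrite /hex; nia. Qed.

Lemma sq_proper : proper sq.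
Proof. by apply: (@proper_int _ 1) => x; have := sqE x; nia. Qed.
Lemma tri_proper : proper tri.
Proof. by apply: (@proper_int _ 2) => x; have := triE x; nia. Qed.
Lemma pent_proper : proper pent.
Proof. by apply: (@proper_int _ 2) => x; have := pentE x; nia. Qed.

Lemma hex_proper : proper hex.
Proof.
move=> n; apply: (@sub_finite_set _ _ ([set t | (sq t <= 2 * n)%N] `*` [set t | (sq t <= 2 * n)%N])%classic).
  move=> [x y] /=; have := hexE (x, y); have := sqE x; have := sqE y => /= h1 h2 h3 h4.
  by split=> /=; nia.
by apply: finite_setX; apply: sq_proper.
Qed.

Lemma proper_mul (T : choiceType) (e : T -> nat) k : (0 < k)%N -> proper e ->
  proper (fun t => k * e t)%N.
Proof. by move=> k0 pe n; apply: sub_finite_set (pe n) => t /=; nia. Qed.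

Lemma proper_lin2 (T T' : choiceType) (e : T -> nat) (e' : T' -> nat) j a b :
  (0 < a)%N -> (0 < b)%N -> proper e -> proper e' ->
  proper (fun t : T * T' => j + (a * e t.1 + b * e' t.2))%N.
Proof.
by move=> a0 b0 pe pe' n; apply: sub_finite_set (proper_prod pe pe' n) => t /=; nia.
Qed.

Lemma int_parity (x : int) : exists k : int, x = 2 * k \/ x = 2 * k + 1.
Proof. by exists (divz x 2); lia. Qed.

Section ThetaIdentities.
Variable F : fieldType.
Hypothesis F2 : 2 != 0 :> F.

Definition phi : series F := gen sq (fun _ => 1).
(* twice Ramanujan's psi *)
Definition psi2 : series F := gen tri (fun _ => 1).

(** Pairs of equal parity are (u + v, u - v), the others are the same shifted by (1, 0). In
    classical terms, phi(q)^2 = phi(q^2)^2 + 4 q psi(q^4)^2. *)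
Lemma phi_sqr : phi ^+ 2 = Vop 2 phi ^+ 2 + qpow F 1 * Vop 4 psi2 ^+ 2.
Proof.
have ps := sq_proper; have pt := tri_proper.
rewrite !expr2 /phi /psi2 !gen_Vop // !gen_mul //; try exact: proper_mul.
rewrite gen_qpow.
pose h (t : (int * int) + (int * int)) : int * int := match t with
  | inl (u, v) => (u + v, u - v) | inr (u, v) => (u + v + 1, u - v) end.
rewrite (@gen_bij _ _ _ h); first last.
- exact: proper_prod.
- move=> [x y]; have [k [xy|xy]] := int_parity (x - y).
    by exists (inl (y + k, k)) => /=; congr (_, _); lia.
  by exists (inr (y + k, k)) => /=; congr (_, _); lia.
- move=> [[u v]|[u v]] [[u' v']|[u' v']] [] e1 e2;
    first [by congr (inl (_, _)); lia | by congr (inr (_, _)); lia | exfalso; lia].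
rewrite -gen_sum; first last.
- exact: (@proper_lin2 _ _ tri tri 1 4 4).
- exact: (@proper_lin2 _ _ sq sq 0 2 2).
apply: gen_ext; last by move=> [] [u v].
move=> [] [u v] /=.
  by have := sqE (u + v); have := sqE (u - v); have := sqE u; have := sqE v; lia.
by have := sqE (u + v + 1); have := sqE (u - v); have := triE u; have := triE v; lia.
Qed.

(** The same rotation applied to pairs of triangular indices, where the two parity classes
    contribute equally; classically psi(q)^2 = phi(q) psi(q^2). *)
Lemma psi2_sqr : psi2 ^+ 2 = 2 * (phi * Vop 2 psi2).
Proof.
have ps := sq_proper; have pt := tri_proper.
rewrite expr2 /phi /psi2 !gen_Vop // !gen_mul //; try exact: proper_mul.
pose h (t : (int * int) + (int * int)) : int * int := match t with
  | inl (v, u) => (u + v, u - v) | inr (v, u) => (u + v, v - u - 1) end.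
rewrite (@gen_bij _ _ _ h); first last.
- exact: proper_prod.
- move=> [x y]; have [k [xy|xy]] := int_parity (x + y).
    by exists (inl (x - k, k)) => /=; congr (_, _); lia.
  by exists (inr (k + 1, x - k - 1)) => /=; congr (_, _); lia.
- move=> [[u v]|[u v]] [[u' v']|[u' v']] [] e1 e2;
    first [by congr (inl (_, _)); lia | by congr (inr (_, _)); lia | exfalso; lia].
have pp : proper (fun t : int * int => sq t.1 + 2 * tri t.2)%N.
  by apply: (@proper_prod _ _ sq (fun y => 2 * tri y)%N) => //; apply: proper_mul.
rewrite mulr2n mulrDl !mul1r -gen_sum //.
apply: gen_ext; last by move=> [] [u v] /=; rewrite ?mulr1.
move=> [] [v u] /=.
  by have := triE (u + v); have := triE (u - v); have := triE u; have := sqE v; lia.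
by have := triE (u + v); have := triE (v - u - 1); have := triE u; have := sqE v; lia.
Qed.

(** The left side is twice the part with odd exponents. The form x^2 + 3 y^2 is odd exactly when x =
    2 v + 1 - y, which the injection [h] parametrises. Classically the right side is 4 q psi(q^2)
    psi(q^6). *)
Lemma phi_phi3_odd :
  phi * Vop 3 phi - neg_arg (phi * Vop 3 phi) = qpow F 1 * (Vop 2 psi2 * Vop 6 psi2).
Proof.
have ps := sq_proper; have pt := tri_proper.
rewrite /phi /psi2 !gen_Vop // !gen_mul //; try exact: proper_mul.
have pp : proper (fun t : int * int => sq t.1 + 3 * sq t.2)%N.
  by apply: (@proper_prod _ _ sq (fun y => 3 * sq y)%N) => //; apply: proper_mul.
rewrite gen_neg // gen_qpow -genN -genD.
pose h (t : int * int) : int * int := (2 * t.1 + 1 - t.2, t.2).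
rewrite (@gen_inj _ _ _ h) //; first last.
- move=> [x y]; have [k [xy|xy]] := int_parity (x + y).
    left; rewrite /= -signr_odd; have -> : odd (sq x + 3 * sq y) = false.
      by have := sqE x; have := sqE y; have : exists j, x = 2 * j - y by [exists k; lia]; case=> j -> ; nia.
    by rewrite expr0 !mul1r subrr.
  by right; exists (k, y); rewrite /h /=; congr (_, _); lia.
- by move=> [u v] [u' v'] [] e1 e2; congr (_, _); lia.
(* The pairs of triangular indices split, by the parity of their difference, into two copies of the
   odd vectors; this accounts for the factor 2. *)
pose g (t : (int * int) + (int * int)) : int * int := match t with
  | inl (v, b) => (v - 2 * b, v) | inr (v, b) => (v - 2 * b, - 1 - v) end.
rewrite [RHS](@gen_bij _ _ _ g); first last.
- exact: (@proper_lin2 _ _ tri tri 1 2 6).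
- move=> [u v]; have [k [uv|uv]] := int_parity (v - u).
    by exists (inl (v, k)) => /=; congr (_, _); lia.
  by exists (inr (-1 - v, - (k + u + 1))) => /=; congr (_, _); lia.
- move=> [[u v]|[u v]] [[u' v']|[u' v']] [] e1 e2;
    first [by congr (inl (_, _)); lia | by congr (inr (_, _)); lia | exfalso; lia].
have hI : injective h by move=> [u v] [u' v'] [] e1 e2; congr (_, _); lia.
transitivity (gen ((fun t : int * int => sq t.1 + 3 * sq t.2)%N \o h) (fun=> 1 : F) +
              gen ((fun t : int * int => sq t.1 + 3 * sq t.2)%N \o h) (fun=> 1 : F)).
  rewrite -genD; apply: gen_ext => // -[v b] /=; rewrite -signr_odd.
  have -> : odd (sq (2 * v + 1 - b) + 3 * sq b) = true.
    by have := sqE (2 * v + 1 - b); have := sqE b; nia.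
  by rewrite expr1 !mulr1 opprK.
rewrite -gen_sum; try exact: proper_inj.
apply: gen_ext; last by move=> [] [u v] /=; rewrite ?mulr1.
move=> [] [v b] /=.
  by have := sqE (2 * v + 1 - b); have := sqE b; have := triE (v - 2 * b); have := triE v; lia.
by have := sqE (2 * v + 1 - b); have := sqE b; have := triE (v - 2 * b); have := triE (-1 - v); lia.
Qed.

Definition sgn (x : int) : F := (-1) ^+ `|x|%N.

Lemma sgn_eq (x y z : int) : x = y + 2 * z -> sgn x = sgn y.
Proof.
by move=> ->; rewrite /sgn -signr_odd -[RHS]signr_odd; congr (_ ^+ nat_of_bool _); lia.
Qed.

Lemma sgn_opp (x y z : int) : x = y + 2 * z + 1 -> sgn x = - sgn y.
Proof.
move=> ->; rewrite /sgn -signr_odd -[in RHS]signr_odd.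
have -> : odd (absz (y + 2 * z + 1)) = ~~ odd (absz y) by lia.
by case: (odd _); rewrite ?expr1 ?expr0 ?opprK.
Qed.

Lemma sgnD (x y : int) : sgn (x + y) = sgn x * sgn y.
Proof. by rewrite /sgn -exprD -signr_odd -[RHS]signr_odd; congr (_ ^+ nat_of_bool _); lia. Qed.

Definition pent_series : series F := gen pent sgn.

(* Borwein's b(q), weighted non-symmetrically on the classes x - y mod 3 *)
Definition borwein_b : series F := gen hex
  (fun t => (modz (t.1 - t.2) 3 == 0)%:R - (modz (t.1 - t.2) 3 == 2)%:R).

(** Three pentagonal indices are replaced by their sum s and two consecutive differences: the
    exponent becomes tri(s) plus the hexagonal form, on the sublattice where s agrees modulo 3 with
    the difference of the two coordinates. Under s -> -1 - s the class 1 cancels itself and the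
    class 2 is minus the class 0, which leaves the weights 1, 0, -1 of [borwein_b]. *)
Lemma pent_cube : pent_series ^+ 3 = Vop 3 pent_series * borwein_b.
Proof.
have pp := pent_proper; have pt := tri_proper; have ph := hex_proper.
have pp2 : proper (fun t : int * int => pent t.1 + pent t.2)%N by exact: proper_prod.
have pth : proper (fun t : int * (int * int) => tri t.1 + hex t.2)%N by exact: proper_prod.
pose S (j : int) : series F := gen tri (fun x => sgn x * (modz x 3 == j)%:R).
pose A (j : int) : series F := gen hex (fun t => (modz (t.1 - t.2) 3 == j)%:R).
have S0 : S 0 = Vop 3 pent_series.
  rewrite /S /pent_series gen_Vop // (@gen_inj _ _ _ (fun k : int => 3 * k)) //.
  - apply: gen_ext => k /=; first by have := triE (3 * k); have := pentE k; lia.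
    have -> : modz (3 * k) 3 = 0 by lia.
    by rewrite eqxx mulr1; apply: (@sgn_eq _ k k); lia.
  - by move=> x y; lia.
  move=> x; case: (eqVneq (modz x 3) 0) => x3; last by left; rewrite mulr0.
  by right; exists (divz x 3); lia.
have flip (g : int -> F) : gen tri g = gen tri (fun x => g (- 1 - x)).
  rewrite (@gen_bij _ _ _ (fun x : int => - 1 - x)) //.
  - by apply: gen_ext => x //=; have := triE (- 1 - x); have := triE x; lia.
  - by move=> x y; lia.
  by move=> y; exists (- 1 - y); lia.
have S1 : S 1 = 0.
  have : S 1 = - S 1.
    rewrite {1}/S flip -genN; apply: gen_ext => // x.
    rewrite (@sgn_opp _ x (- 1 - x)) ?mulNr; last lia.
    by congr (- (_ * _%:R)); lia.
  move/eqP; rewrite -addr_eq0 -mulr2n -mulr_natl mulf_eq0 => /orP[|/eqP //].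
  by rewrite -const_natr => /eqP /(congr1 (fun z => coef z 0)) /eqP; rewrite /= (negbTE F2).
have S2 : S 2 = - S 0.
  rewrite {1}/S flip -genN; apply: gen_ext => // x.
  rewrite (@sgn_opp _ x (- 1 - x)) ?mulNr; last lia.
  by congr (- (_ * _%:R)); lia.
have -> : borwein_b = A 0 - A 2.
  by rewrite -genN -genD.
have -> : pent_series ^+ 3 = S 0 * A 0 + S 1 * A 1 + S 2 * A 2; last first.
  by rewrite S1 S2 S0; ring.
rewrite !exprS expr0 mulr1 /pent_series !gen_mul // -!genD.
pose h (t : int * (int * int)) : int * (int * int) :=
  (t.1 + t.2.1 + t.2.2, (t.1 - t.2.1, t.2.1 - t.2.2)).
rewrite [RHS](@gen_inj _ _ _ h) //; first last.
- move=> [s [a b]]; case: (eqVneq (modz (s - a + b) 3) 0) => h3.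
    right; exists (divz (s + 2 * a + b) 3, (divz (s + 2 * a + b) 3 - a, divz (s + 2 * a + b) 3 - a - b)).
    by rewrite /h /=; congr (_, (_, _)); lia.
  left => /=.
  have e j : (modz s 3 == j)%:R * (modz (a - b) 3 == j)%:R = 0 :> F.
    by case: eqP => [e1|_]; rewrite ?mul0r // mul1r; case: eqP => [e2|//]; exfalso; lia.
  by rewrite -!mulrA !e !mulr0 !addr0.
- by move=> [x [y z]] [x' [y' z']] [] e1 e2 e3; congr (_, (_, _)); lia.
apply: gen_ext => -[x [y z]] /=.
  have := pentE x; have := pentE y; have := pentE z; have := triE (x + y + z).
  by have := hexE (x - y, y - z) => /=; lia.
rewrite -!sgnD addrA; set s := x + y + z; set d := x - y - (y - z).
have sd : modz s 3 = modz d 3 by rewrite /s /d; lia.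
rewrite sd -!mulrA -!mulrDr -!natrM -!natrD.
suff -> : ((modz d 3 == 0) * (modz d 3 == 0) + (modz d 3 == 1) * (modz d 3 == 1) +
           (modz d 3 == 2) * (modz d 3 == 2))%N = 1%N by rewrite mulr1.
by lia.
Qed.

End ThetaIdentities.

(** * The finite form of Jacobi's triple product *)

Section FiniteJTP.
Variables (R : idomainType) (a b : R).
Let x := a * b.

Definition qpoch n : R := \prod_(i < n) (1 - x ^+ i.+1).
(** Each factor 1 + b x^i / X of the two-sided product is multiplied by X, giving a polynomial of
    degree at most 2n whose central index is n. *)
Definition jtp_poly n : {poly R} :=
  \prod_(i < n) ((1 + (a * x ^+ i) *: 'X) * ('X + (b * x ^+ i)%:P)).

Definition jtp_term (k : int) : R := a ^+ tri k * b ^+ tri (- k).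

Lemma qpochS n : qpoch n.+1 = qpoch n * (1 - x ^+ n.+1).
Proof. by rewrite /qpoch big_ord_recr. Qed.

Let leq_pred2 i j : (i <= j)%N -> (i.-1 <= j.-1)%N.
Proof. by rewrite -!subn1; exact: leq_sub2r. Qed.

Lemma size_jtp_poly n : (size (jtp_poly n) <= (2 * n).+1)%N.
Proof.
elim: n => [|n IH]; first by rewrite /jtp_poly big_ord0 size_poly1.
rewrite /jtp_poly big_ord_recr /= -/(jtp_poly n).
apply: leq_trans (size_polyMleq _ _) _.
have h1 : (size (1 + (a * x ^+ n) *: 'X : {poly R})%R <= 2)%N.
  apply: leq_trans (size_polyD _ _) _; rewrite geq_max size_poly1 /=.
  by apply: leq_trans (size_scale_leq _ _) _; rewrite size_polyX.
have h2 : (size ('X + (b * x ^+ n)%:P : {poly R})%R <= 2)%N.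
  apply: leq_trans (size_polyD _ _) _; rewrite geq_max size_polyX /=.
  by apply: leq_trans (size_polyC_leq1 _) _.
have h3 := size_polyMleq (1 + (a * x ^+ n) *: 'X : {poly R}) ('X + (b * x ^+ n)%:P).
have h4 := leq_trans h3 (leq_trans (leq_pred2 (leq_add h1 h2)) (leqnn 3)).
by apply: leq_trans (leq_pred2 (leq_add IH h4)) _; lia.
Qed.

Lemma jtp_coef_rec n j : (jtp_poly n.+1)`_j =
  b * x ^+ n * (jtp_poly n)`_j +
  (1 + x ^+ (2 * n).+1) * (if j is j1.+1 then (jtp_poly n)`_j1 else 0) +
  a * x ^+ n * (if j is j2.+2 then (jtp_poly n)`_j2 else 0).
Proof.
rewrite /jtp_poly big_ord_recr /= -/(jtp_poly n).
have -> : jtp_poly n * ((1 + (a * x ^+ n) *: 'X) * ('X + (b * x ^+ n)%:P)) =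
  (b * x ^+ n) *: jtp_poly n + (1 + x ^+ (2 * n).+1) *: (jtp_poly n * 'X) +
  (a * x ^+ n) *: (jtp_poly n * 'X * 'X).
  rewrite -!mul_polyC !rmorphD !rmorphM !rmorph1 /=.
  have -> : (x ^+ (2 * n).+1)%:P = a%:P * b%:P * (x ^+ n)%:P ^+ 2 :> {poly R}.
    by rewrite exprS mulnC exprM !rmorphM !rmorphXn.
  ring.
rewrite !coefD !coefZ !coefMX; by case: j => [|[|j]] //=; rewrite ?coefMX ?mulr0 ?addr0.
Qed.

Lemma jtp_termS (k : int) (n : nat) : (0 <= n%:Z + k + 1) ->
  b * x ^+ n * jtp_term (k + 1) = jtp_term k * x ^+ absz (n%:Z + k + 1).
Proof.
move=> h; rewrite /jtp_term /x !exprMn.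
have e1 := triE k; have e2 := triE (k + 1); have e3 := triE (- k); have e4 := triE (- (k + 1)).
have -> : b * (a ^+ n * b ^+ n) * (a ^+ tri (k + 1) * b ^+ tri (- (k + 1))) =
   a ^+ (n + tri (k + 1)) * b ^+ (n + tri (- (k + 1))).+1 by rewrite exprS !exprD; ring.
have -> : (n + tri (k + 1) = tri k + absz (n%:Z + k + 1)%R)%N by lia.
have -> : ((n + tri (- (k + 1))).+1 = tri (- k) + absz (n%:Z + k + 1)%R)%N by lia.
by rewrite !exprD; ring.
Qed.

Lemma jtp_term_pred (k : int) (n : nat) : (0 <= n%:Z - k + 1) ->
  a * x ^+ n * jtp_term (k - 1) = jtp_term k * x ^+ absz (n%:Z - k + 1).
Proof.
move=> h; rewrite /jtp_term /x !exprMn.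
have e1 := triE k; have e2 := triE (k - 1); have e3 := triE (- k); have e4 := triE (- (k - 1)).
have -> : a * (a ^+ n * b ^+ n) * (a ^+ tri (k - 1) * b ^+ tri (- (k - 1))) =
   a ^+ (n + tri (k - 1)).+1 * b ^+ (n + tri (- (k - 1))) by rewrite exprS !exprD; ring.
have -> : ((n + tri (k - 1)).+1 = tri k + absz (n%:Z - k + 1)%R)%N by lia.
have -> : (n + tri (- (k - 1)) = tri (- k) + absz (n%:Z - k + 1)%R)%N by lia.
by rewrite !exprD; ring.
Qed.

(** This is the q-binomial theorem cleared of denominators: the coefficient is the Gaussian binomial
    of 2n and j in base x, times a theta term. In the induction each of the three terms of
    [jtp_coef_rec] becomes a common factor times a polynomial in powers of x, and the three
    polynomials add up to (1 - x^(2n+1))(1 - x^(2n+2)). *)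
Lemma jtp_coef n j : (j <= 2 * n)%N ->
  (jtp_poly n)`_j * (qpoch j * qpoch (2 * n - j)) = qpoch (2 * n) * jtp_term (j%:Z - n%:Z).
Proof.
elim: n j => [|n IH] j jn.
  have -> : j = 0%N by lia.
  rewrite /jtp_poly big_ord0 coef1 /qpoch muln0 sub0n big_ord0 subrr /jtp_term oppr0.
  by rewrite (_ : tri 0 = 0%N) // !expr0 !mulr1.
have big0 i : (2 * n < i)%N -> (jtp_poly n)`_i = 0.
  by move=> h; apply: nth_default; apply: leq_trans (size_jtp_poly n) h.
set J := j; set K := (2 * n.+1 - j)%N; set s := j%:Z - n.+1%:Z.
have t1 : b * x ^+ n * (jtp_poly n)`_j * (qpoch J * qpoch K) =
   qpoch (2 * n) * jtp_term s * (x ^+ J * ((1 - x ^+ K.-1) * (1 - x ^+ K))).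
  case: (leqP j (2 * n)) => h.
    have -> : qpoch K = qpoch (2 * n - j) * ((1 - x ^+ K.-1) * (1 - x ^+ K)).
      have -> : K = (2 * n - j).+2 by rewrite /K; lia.
      by rewrite !qpochS /=; ring.
    have := IH j h; have -> : j%:Z - n%:Z = s + 1 by rewrite /s; lia.
    have := @jtp_termS s n; have -> : absz (n%:Z + s + 1) = J by rewrite /s /J; lia.
    move=> h1 h2; have {}h1 : b * x ^+ n * jtp_term (s + 1) = jtp_term s * x ^+ J by apply: h1; rewrite /s; lia.
    transitivity (b * x ^+ n * ((jtp_poly n)`_j * (qpoch J * qpoch (2 * n - j))) *
       ((1 - x ^+ K.-1) * (1 - x ^+ K))); first by ring.
    rewrite h2; transitivity (qpoch (2 * n) * (b * x ^+ n * jtp_term (s + 1)) *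
       ((1 - x ^+ K.-1) * (1 - x ^+ K))); first by ring.
    by rewrite h1; ring.
  (* Beyond the degree of the polynomial [K] is 0 or 1, and the factor 1 - x^(K.-1) vanishes
     together with the coefficient. *)
  rewrite big0 //; have -> : K.-1 = 0%N by rewrite /K; lia.
  by rewrite expr0; ring.
have t2 : (1 + x ^+ (2 * n).+1) * (if j is j1.+1 then (jtp_poly n)`_j1 else 0) * (qpoch J * qpoch K) =
   qpoch (2 * n) * jtp_term s * ((1 + x ^+ (2 * n).+1) * ((1 - x ^+ J) * (1 - x ^+ K))).
  rewrite /J; case: (posnP j) => [->|j0]; first by rewrite expr0; ring.
  have [j1 j1E] : exists j1, j = j1.+1 by exists j.-1; lia.
  have -> : (if j is j1.+1 then (jtp_poly n)`_j1 else 0) = (jtp_poly n)`_j1 by rewrite j1E.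
  case: (posnP K) => [KE|K0].
    by rewrite big0 ?KE ?expr0; [ring | move: KE; rewrite /K; lia].
  have j1n : (j1 <= 2 * n)%N by rewrite /K in K0; lia.
  have -> : qpoch j = qpoch j1 * (1 - x ^+ j) by rewrite j1E qpochS.
  have -> : qpoch K = qpoch (2 * n - j1) * (1 - x ^+ K).
    have -> : K = (2 * n - j1).+1 by rewrite /K; lia.
    by rewrite qpochS.
  have := IH j1 j1n; have -> : j1%:Z - n%:Z = s by rewrite /s; lia.
  move=> h; transitivity ((1 + x ^+ (2 * n).+1) * ((jtp_poly n)`_j1 * (qpoch j1 * qpoch (2 * n - j1)))
    * ((1 - x ^+ j) * (1 - x ^+ K))); first by ring.
  by rewrite h; ring.
have t3 : a * x ^+ n * (if j is j2.+2 then (jtp_poly n)`_j2 else 0) * (qpoch J * qpoch K) =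
   qpoch (2 * n) * jtp_term s * (x ^+ K * ((1 - x ^+ J) * (1 - x ^+ J.-1))).
  rewrite /J; case: (leqP j 1) => j2.
    have -> : (if j is j2.+2 then (jtp_poly n)`_j2 else 0) = 0 by case: j j2 {jn J K s t1 t2} => [|[|]].
    have -> : j.-1 = 0%N by lia.
    by rewrite expr0; ring.
  have [j1 j1E] : exists j1, j = j1.+2 by exists j.-2; lia.
  have -> : (if j is j2.+2 then (jtp_poly n)`_j2 else 0) = (jtp_poly n)`_j1 by rewrite j1E.
  have j1n : (j1 <= 2 * n)%N by lia.
  have -> : qpoch j = qpoch j1 * ((1 - x ^+ j) * (1 - x ^+ j.-1)).
    by rewrite j1E !qpochS /=; ring.
  have -> : K = (2 * n - j1)%N by rewrite /K; lia.
  have := @jtp_term_pred s n; have -> : absz (n%:Z - s + 1) = (2 * n - j1)%N by rewrite /s; lia.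
  move=> h1; have {}h1 : a * x ^+ n * jtp_term (s - 1) = jtp_term s * x ^+ (2 * n - j1) by apply: h1; rewrite /s; lia.
  have := IH j1 j1n; have -> : j1%:Z - n%:Z = s - 1 by rewrite /s; lia.
  move=> h; transitivity (a * x ^+ n * ((jtp_poly n)`_j1 * (qpoch j1 * qpoch (2 * n - j1)))
    * ((1 - x ^+ j) * (1 - x ^+ j.-1))); first by ring.
  rewrite h; transitivity (qpoch (2 * n) * (a * x ^+ n * jtp_term (s - 1))
    * ((1 - x ^+ j) * (1 - x ^+ j.-1))); first by ring.
  by rewrite h1; ring.
rewrite jtp_coef_rec 2!mulrDl t1 t2 t3 -!mulrDr.
have -> : qpoch (2 * n.+1) = qpoch (2 * n) * ((1 - x ^+ (2 * n).+1) * (1 - x ^+ (2 * n).+2)).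
  have -> : (2 * n.+1)%N = (2 * n).+2 by lia.
  by rewrite !qpochS; ring.
rewrite [RHS]mulrAC; congr (_ * _ * _).
have JK : (J + K = (2 * n).+2)%N by rewrite /J /K; lia.
clear t1 t2 t3; clearbody J K; case: J JK => [|J] JK.
  have <- : K = (2 * n).+2 by lia.
  have <- : K.-1 = (2 * n).+1 by lia.
  by rewrite expr0; ring.
case: K JK => [|K] JK.
  have <- : J = (2 * n).+1 by lia.
  by rewrite /= expr0; ring.
have -> : (2 * n).+2 = (J + K).+2 by lia.
have -> : (2 * n).+1 = (J + K).+1 by lia.
by rewrite /= !exprS exprD; ring.
Qed.

Lemma jtp_poly_eval n : (jtp_poly n).[1] = \prod_(i < n) ((1 + a * x ^+ i) * (1 + b * x ^+ i)).
Proof.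
rewrite /jtp_poly horner_prod; apply: eq_bigr => i _.
by rewrite hornerM !hornerD !hornerE.
Qed.

End FiniteJTP.

(** * Congruence modulo q^N and the limit of the triple product *)

Section Congruence.
Variable F : fieldType.
Implicit Types x y z : series F.

Definition cong N x y := forall i, (i < N)%N -> coef x i = coef y i.

Lemma cong_refl N x : cong N x x. Proof. by []. Qed.
Lemma cong_sym N x y : cong N x y -> cong N y x.
Proof. by move=> h i /h. Qed.
Lemma cong_trans N y x z : cong N x y -> cong N y z -> cong N x z.
Proof. by move=> h1 h2 i iN; rewrite h1 // h2. Qed.
Lemma congM N x x' y y' : cong N x x' -> cong N y y' -> cong N (x * y) (x' * y').
Proof.
move=> h1 h2 i iN; rewrite !coefMs; apply: eq_bigr => j _.
by rewrite h1 ?h2 //; have := ltn_ord j; lia.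
Qed.
Lemma cong_sum N (I : Type) (r : seq I) (f g : I -> series F) :
  (forall i, cong N (f i) (g i)) -> cong N (\sum_(i <- r) f i) (\sum_(i <- r) g i).
Proof.
by move=> h i iN; rewrite !coef_sums; apply: eq_bigr => j _; rewrite h.
Qed.
Lemma cong_prod N (I : Type) (r : seq I) (f g : I -> series F) :
  (forall i, cong N (f i) (g i)) -> cong N (\prod_(i <- r) f i) (\prod_(i <- r) g i).
Proof. by move=> h; elim/big_rec2: _ => // i x y _; apply: congM. Qed.
Lemma cong_cancel N u x y : coef u 0 != 0 -> cong N (u * x) (u * y) -> cong N x y.
Proof.
move=> u0 h; have uu : u \is a GRing.unit by [].
by rewrite -[x](mulKr uu) -[y](mulKr uu); apply: congM.
Qed.
Lemma cong_qpow0 N e x : (N <= e)%N -> cong N (qpow F e * x) 0.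
Proof. by move=> Ne i iN; rewrite coef_qpowM ifF //; lia. Qed.
Lemma cong_eq x y : (forall N, cong N x y) -> x = y.
Proof. by move=> h; apply: seriesP => n; apply: (h n.+1). Qed.

Section JTPLimit.
Variables (al be : nat) (sa sb : F).
Hypothesis ab0 : (0 < al + be)%N.
Let a : series F := const sa * qpow F al.
Let b : series F := const sb * qpow F be.
Let x := a * b.

Let xE i : x ^+ i = const ((sa * sb) ^+ i) * qpow F (i * (al + be)).
Proof.
rewrite /x /a /b; have -> : const sa * qpow F al * (const sb * qpow F be) =
  const (sa * sb) * qpow F (al + be) by rewrite qpowD rmorphM /=; ring.
by rewrite exprMn rmorphXn qpowM.
Qed.

Let qpoch_cong N n : cong N (qpoch a b (N + n)) (qpoch a b N).
Proof.
elim: n => [|n IH]; first by rewrite addn0.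
rewrite addnS qpochS; rewrite -[qpoch a b N]mulr1; apply: congM => //.
move=> i iN; rewrite coefBs -/x xE mulrC.
by rewrite (@cong_qpow0 N _ _ _ i iN) ?subr0 //; have := ab0; nia.
Qed.

Let qpoch_coef0 n : coef (qpoch a b n) 0 = 1.
Proof.
elim: n => [|n IH]; first by rewrite /qpoch big_ord0.
rewrite qpochS coefM0 IH mul1r coefBs -/x xE coef_constM /=.
have -> : (0 == n.+1 * (al + be))%N = false by have := ab0; lia.
by rewrite mulr0 subr0.
Qed.

Let e (k : int) := (al * tri k + be * tri (- k))%N.

Let termE k : jtp_term a b k = const (sa ^+ tri k * sb ^+ tri (- k)) * qpow F (e k).
Proof.
rewrite /jtp_term /a /b !exprMn -!rmorphXn /= -!qpowM /e qpowD rmorphM /=.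
by rewrite ![(tri _ * _)%N]mulnC; ring.
Qed.

Let e_lower k : (`|k| <= (e k).+1)%N.
Proof.
have := triE k; have := triE (- k); rewrite /e; have := ab0 => h e1 e2.
have h1 : (`|k| <= (tri k).+1)%N by nia.
have h2 : (`|k| <= (tri (- k)).+1)%N by nia.
by nia.
Qed.

(** For central j the Pochhammer products of lengths j and 2n - j are both congruent to the full
    one, so the Gaussian binomial disappears. For the remaining j the theta exponent, at least |k| -
    1, already reaches N, and the coefficient vanishes modulo q^N as well. *)
Lemma jacobi_triple N n : (2 * N + 2 <= n)%N ->
  cong N (qpoch a b n * \prod_(i < n) ((1 + a * x ^+ i) * (1 + b * x ^+ i)))
    (gen e (fun k => sa ^+ tri k * sb ^+ tri (- k))).
Proof.
move=> Nn; rewrite -jtp_poly_eval (horner_coef_wide _ (size_jtp_poly a b n)).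
under eq_bigr => j _ do rewrite expr1n mulr1.
have P0 m : coef (qpoch a b m) 0 != 0 by rewrite qpoch_coef0 oner_eq0.
have Pc m m' : (N <= m)%N -> (N <= m')%N -> cong N (qpoch a b m) (qpoch a b m').
  move=> h h'; have := @qpoch_cong N (m - N)%N; have := @qpoch_cong N (m' - N)%N.
  by rewrite !subnKC // => h1 h2; apply: cong_trans h2 (cong_sym h1).
have cj (j : 'I_(2 * n).+1) :
    cong N (qpoch a b n * (jtp_poly a b n)`_j) (jtp_term a b (j%:Z - n%:Z)).
  have jn : (j <= 2 * n)%N by rewrite -ltnS.
  have := jtp_coef a b jn => hj.
  case: (boolP ((N <= j) && (N <= 2 * n - j))%N) => [/andP[h1 h2]|h].
    apply: (@cong_cancel N (qpoch a b n)) => //.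
    apply: (@cong_trans N (qpoch a b (2 * n) * jtp_term a b (j%:Z - n%:Z))).
      rewrite -hj mulrA [X in cong _ X _]mulrC; apply: congM => //.
      by apply: congM; apply: Pc => //; lia.
    by apply: congM => //; apply: Pc; lia.
  have t0 : cong N (jtp_term a b (j%:Z - n%:Z)) 0.
    rewrite termE mulrC; apply: cong_qpow0; have := e_lower (j%:Z - n%:Z).
    by move: h; lia.
  apply: (@cong_trans N 0); last exact: cong_sym.
  have : cong N ((jtp_poly a b n)`_j) 0.
    apply: (@cong_cancel N (qpoch a b j * qpoch a b (2 * n - j))).
      by rewrite coefM0 mulf_neq0.
    by rewrite mulrC hj mulr0 -[0 in X in cong _ _ X](mulr0 (qpoch a b (2 * n))); apply: congM.
  by move=> h3; have := congM (@cong_refl N (qpoch a b n)) h3; rewrite mulr0.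
rewrite mulr_sumr; apply: (cong_trans (cong_sum _ cj)).
move=> i iN; rewrite coef_sums [RHS]/=.
have big (k : int) : e k = i -> (`|k| <= n)%N by have := e_lower k; lia.
pose r : seq int := [seq j%:Z - n%:Z | j <- iota 0 (2 * n).+1].
rewrite (@fsum_seq _ _ _ _ [seq k <- r | e k == i]); first last.
- move=> k; rewrite mem_filter; split=> [/= ek|/andP[/eqP] //].
  rewrite ek eqxx /=; apply/mapP; exists (absz (k + n%:Z)); last by have := big k ek; lia.
  by rewrite mem_iota; have := big k ek; lia.
- by rewrite filter_uniq // map_inj_uniq ?iota_uniq // => j j'; lia.
rewrite big_filter [RHS]big_mkcond /r big_map.
rewrite -(big_mkord predT (fun j : nat => coef (jtp_term a b (j%:Z - n%:Z)) i)) /index_iota subn0.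
apply: eq_bigr => j _; rewrite termE coef_constM /= eq_sym.
by case: eqP; rewrite ?mulr1 ?mulr0.
Qed.

End JTPLimit.
End Congruence.

(** * Euler's product and the product formulas for phi and psi *)

Section EulerProduct.
Variable F : fieldType.

Definition euler_fin n : series F := \prod_(i < n) (1 - qpow F i.+1).
Definition euler : series F := Series (fun n => coef (euler_fin n.+1) n).

Lemma euler_finS n : euler_fin n.+1 = euler_fin n * (1 - qpow F n.+1).
Proof. by rewrite /euler_fin big_ord_recr. Qed.

Lemma cong_one_qpow N n : (N <= n)%N -> cong N (1 - qpow F n) 1.
Proof. by move=> Nn i iN; rewrite coefBs /= (_ : (i == n) = false) ?subr0 //; lia. Qed.

Lemma euler_fin_stable N n : cong N (euler_fin (N + n)) (euler_fin N).
Proof.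
elim: n => [|n IH]; first by rewrite addn0.
rewrite addnS euler_finS -[euler_fin N]mulr1; apply: congM => //.
by apply: cong_one_qpow; lia.
Qed.

Lemma euler_fin_cong N n : (N <= n)%N -> cong N (euler_fin n) euler.
Proof.
move=> Nn i iN /=; have := @euler_fin_stable i.+1 (n - i.+1)%N i (ltnSn i).
by rewrite subnKC //; lia.
Qed.

Lemma euler_coef0 : coef euler 0 = 1.
Proof. by rewrite /= /euler_fin big_ord1 coefBs /= subr0. Qed.

Lemma cong_Vop N k (x y : series F) : cong N x y -> cong N (Vop k x) (Vop k y).
Proof.
move=> h i iN /=; case: ifP => // _; apply: h.
exact: leq_ltn_trans (leq_div _ _) iN.
Qed.

Lemma Vop_euler_fin k n : Vop k.+1 (euler_fin n) = \prod_(i < n) (1 - qpow F (k.+1 * i.+1)).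
Proof.
by rewrite rmorph_prod; apply: eq_bigr => i _; rewrite rmorphB rmorph1 /= Vop_qpow.
Qed.

Let qpowX k i : qpow F k ^+ i = qpow F (i * k). Proof. by rewrite qpowM. Qed.

(** The triple product at a = -q and b = -q^2: the three families of factors are the classes 1, 2
    and 0 modulo 3. *)
Lemma euler_pentagonal : euler = pent_series F.
Proof.
apply: cong_eq => N; have := @jacobi_triple F 1 2 (-1) (-1) isT N (2 * N + 2) (leqnn _).
set a := const (-1) * qpow F 1; set b := const (-1) * qpow F 2.
have ab : a * b = qpow F 3.
  by rewrite /a /b !rmorphN1 (qpowD F 1 2); ring.
have -> : qpoch a b (2 * N + 2) * \prod_(i < 2 * N + 2) ((1 + a * (a * b) ^+ i) * (1 + b * (a * b) ^+ i))
   = euler_fin (3 * (2 * N + 2)).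
  elim: (2 * N + 2)%N => [|n IH]; first by rewrite /qpoch /euler_fin !big_ord0 mulr1.
  rewrite mulnS -[(3 + _)%N]/(_.+3) !euler_finS -IH qpochS big_ord_recr /= ab !qpowX.
  rewrite /a /b !rmorphN1.
  have -> : qpow F (3 * n).+1 = qpow F 1 * qpow F (n * 3) by rewrite -qpowD; congr qpow; lia.
  have -> : qpow F (3 * n).+2 = qpow F 2 * qpow F (n * 3) by rewrite -qpowD; congr qpow; lia.
  have -> : (3 * n).+3 = (n.+1 * 3)%N by lia.
  ring.
move=> h; apply: (@cong_trans _ _ (euler_fin (3 * (2 * N + 2)))).
  by apply: cong_sym; apply: euler_fin_cong; lia.
apply: (cong_trans h); rewrite (@gen_bij _ _ _ (fun k : int => - k)); first last.
- apply: (@proper_int _ 1) => k; have := triE k; have := triE (- k); nia.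
- by move=> y; exists (- y); rewrite opprK.
- exact: oppr_inj.
apply: (eq_ind _ (cong N _) (@cong_refl _ _ _)); apply: gen_ext => k /=.
  by rewrite opprK; have := triE k; have := triE (- k); have := pentE k; lia.
have ek : odd (tri (- k) + tri k)%N = odd (absz k).
  by have := triE k; have := triE (- k); nia.
by rewrite opprK -exprD /sgn -[LHS]signr_odd ek signr_odd.
Qed.

Lemma phi_neg_product : neg_arg (phi F) * Vop 2 euler = euler ^+ 2.
Proof.
apply: cong_eq => N; have := @jacobi_triple F 1 1 (-1) (-1) isT N (2 * N + 2) (leqnn _).
set a := const (-1) * qpow F 1.
have ab : a * a = qpow F 2.
  by rewrite /a !rmorphN1 (qpowD F 1 1); ring.
have e1 : qpoch a a (2 * N + 2) * \prod_(i < 2 * N + 2) ((1 + a * (a * a) ^+ i) * (1 + a * (a * a) ^+ i))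
   * Vop 2 (euler_fin (2 * N + 2)) = euler_fin (2 * (2 * N + 2)) ^+ 2.
  rewrite Vop_euler_fin.
  elim: (2 * N + 2)%N => [|n IH]; first by rewrite /qpoch /euler_fin !big_ord0; ring.
  rewrite [in RHS]mulnS -[(2 + _)%N]/(_.+2) !euler_finS !exprMn -IH qpochS !big_ord_recr /= ab !qpowX.
  rewrite /a !rmorphN1.
  have -> : qpow F (2 * n).+1 = qpow F 1 * qpow F (n * 2) by rewrite -qpowD; congr qpow; lia.
  have -> : (2 * n).+2 = (n.+1 * 2)%N by lia.
  rewrite [(2 * n.+1)%N]mulnC.
  ring.
move=> h; apply: (@cong_trans _ _ (euler_fin (2 * (2 * N + 2)) ^+ 2)); last first.
  by rewrite !expr2; apply: congM; apply: euler_fin_cong; lia.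
rewrite -e1; apply: cong_sym; apply: congM; last first.
  by apply: cong_Vop; apply: euler_fin_cong; lia.
apply: (cong_trans h); rewrite gen_neg; last exact: sq_proper.
apply: (eq_ind _ (cong N _) (@cong_refl _ _ _)); apply: gen_ext => k /=.
  by have := triE k; have := triE (- k); have := sqE k; lia.
rewrite -exprD mulr1; congr (_ ^+ _).
by have := triE k; have := triE (- k); have := sqE k; lia.
Qed.

(** The triple product at a = 1 and b = q. The factor 1 + a of index 0 equals 2, in accordance with
    [psi2] summing over all integers. *)
Lemma psi2_product : psi2 F * euler = 2 * Vop 2 euler ^+ 2.
Proof.
apply: cong_eq => N; have := @jacobi_triple F 0 1 1 1 isT N (2 * N + 1).+1 _.
have -> : (2 * N + 2 <= (2 * N + 1).+1)%N by lia.
move=> /(_ isT); set n := (2 * N + 1)%N.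
set a := const 1 * qpow F 0; set b := const 1 * qpow F 1.
have ab : a * b = qpow F 1 by rewrite /a /b !rmorph1 qpow0; ring.
(* The constant factor 2 leaves one nontrivial factor fewer in the a-product, hence truncations of
   two consecutive lengths on the right. *)
have e1 : qpoch a b n.+1 * \prod_(i < n.+1) ((1 + a * (a * b) ^+ i) * (1 + b * (a * b) ^+ i))
   * euler_fin n.+1 = 2 * Vop 2 (euler_fin n.+1) * Vop 2 (euler_fin n) * (1 - qpow F n.+1).
  rewrite big_split /= big_ord_recl /= [euler_fin n.+1 in LHS]euler_finS !Vop_euler_fin.
  have a1 : a = 1 by rewrite /a rmorph1 qpow0 mulr1.
  rewrite ab expr0 !mulr1.
  have f1 k : \prod_(i < k) (1 + a * (a * b) ^+ (bump 0 i)) * euler_fin k =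
      \prod_(i < k) (1 - qpow F (2 * i.+1)).
    rewrite /euler_fin -big_split; apply: eq_bigr => i _ /=.
    rewrite ab qpowX /bump /= /a rmorph1 qpow0 !mul1r !muln1 add1n.
    by rewrite (_ : (2 * i.+1 = i.+1 + i.+1)%N) ?qpowD; [ring|lia].
  have f2 k : qpoch a b k * \prod_(i < k) (1 + b * (a * b) ^+ i) =
      \prod_(i < k) (1 - qpow F (2 * i.+1)).
    rewrite /qpoch -big_split; apply: eq_bigr => i _ /=.
    rewrite ab !qpowX /b rmorph1 mul1r -qpowD !muln1 add1n.
    by rewrite (_ : (2 * i.+1 = i.+1 + i.+1)%N) ?qpowD; [ring|lia].
  rewrite -(f2 n.+1) -(f1 n) ab a1; ring.
move=> h; apply: (@cong_trans _ _ (2 * Vop 2 (euler_fin n.+1) * Vop 2 (euler_fin n) * (1 - qpow F n.+1))); last first.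
  have -> : 2 * Vop 2 euler ^+ 2 = 2 * Vop 2 euler * Vop 2 euler * 1 by ring.
  apply: congM; last by apply: cong_one_qpow; rewrite /n; lia.
  by repeat apply: congM => //; apply: cong_Vop; apply: euler_fin_cong; rewrite /n; lia.
rewrite -e1; apply: cong_sym; apply: congM; last by apply: euler_fin_cong; rewrite /n; lia.
apply: (cong_trans h); rewrite (@gen_bij _ _ _ (fun k : int => - k)); first last.
- apply: (@proper_int _ 1) => k; have := triE k; have := triE (- k); nia.
- by move=> y; exists (- y); rewrite opprK.
- exact: oppr_inj.
apply: (eq_ind _ (cong N _) (@cong_refl _ _ _)); apply: gen_ext => k /=.
  by rewrite opprK; lia.
by rewrite !expr1n mulr1.
Qed.

End EulerProduct.

(** * Landen's transformation and the differential equation of alpha *)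

Section AGM.
Variable F : fieldType.
Hypothesis F2 : 2 != 0 :> F.

(** In the nome q, [agm_a] and [agm_c] are the fourth powers of the Jacobi theta constants theta_3
    and theta_2, and their difference is that of theta_4. The parameter alpha is the quotient of
    [agm_c] by [agm_a], the modular lambda function. *)
Definition agm_a : series F := phi F ^+ 4.
Definition agm_c : series F := qpow F 1 * Vop 2 (psi2 F) ^+ 4.

Let P := Vop 2 (phi F) ^+ 2.
Let K := qpow F 1 * Vop 4 (psi2 F) ^+ 2.

Lemma phi_coef0 : coef (phi F) 0 = 1.
Proof.
rewrite /= (@fsum_seq _ _ _ _ [:: 0]) ?big_seq1 // => x; rewrite inE /=.
split=> [h|/eqP -> //]; apply/eqP; have := sqE x; nia.
Qed.

Lemma psi2_coef0 : coef (psi2 F) 0 = 2.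
Proof.
rewrite /= (@fsum_seq _ _ _ _ [:: 0; -1]) ?big_cons ?big_nil ?addr0 // => x; rewrite !inE /=.
split=> [h|/orP[] /eqP -> //]; have := triE x; nia.
Qed.

Lemma phi2E : phi F ^+ 2 = P + K. Proof. exact: phi_sqr. Qed.

Lemma phi2E_neg : neg_arg (phi F) ^+ 2 = P - K.
Proof.
rewrite -rmorphXn phi2E rmorphD /P /K rmorphM !rmorphXn /= !neg_arg_Vop_even //.
by rewrite neg_arg_qpow; ring.
Qed.

Lemma agm_aE : agm_a = (P + K) ^+ 2. Proof. by rewrite -phi2E -exprM. Qed.

Lemma agm_cE : agm_c = 4 * (P * K).
Proof.
have := congr1 (Vop 2) (psi2_sqr F2); rewrite rmorphXn !rmorphM /= Vop_comp // rmorph_nat -[(2 * 2)%N]/4%N => h.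
have e4 : Vop 2 (psi2 F) ^+ 4 = (Vop 2 (psi2 F) ^+ 2) ^+ 2 by rewrite -exprM.
by rewrite /agm_c /P /K e4 h; ring.
Qed.

Lemma agm_bE : agm_a - agm_c = neg_arg (phi F) ^+ 4.
Proof. by rewrite (exprM _ 2 2) phi2E_neg agm_aE agm_cE; ring. Qed.

Lemma Vop2_agm_a : Vop 2 agm_a = P ^+ 2.
Proof. by rewrite /agm_a /P rmorphXn -exprM. Qed.

Lemma Vop2_agm_c : Vop 2 agm_c = K ^+ 2.
Proof.
by rewrite /agm_c /K rmorphM rmorphXn /= Vop_comp // Vop_qpow // exprMn -exprM -qpowM.
Qed.

Lemma agm_a0 : coef agm_a 0 = 1. Proof. by rewrite coefX0 phi_coef0 expr1n. Qed.
Lemma agm_c0 : coef agm_c 0 = 0. Proof. by rewrite coefM0 /= mul0r. Qed.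

Let qpow_neq0 n : qpow F n != 0.
Proof. by apply/eqP => /(congr1 (fun z => coef z n)) /= /eqP; rewrite eqxx oner_eq0. Qed.

(** The quadratic expressions of A and C in p and k, against p^2 and k^2 for their images under q ->
    q^2, turn both sides into polynomials in p, k and their derivatives. Since D V_2 = 2 V_2 D, the
    factor 2 has to be cancelled. *)
Lemma landen_wronskian (A C p k : series F) : A = (p + k) ^+ 2 -> C = 4 * (p * k) ->
  Vop 2 A = p ^+ 2 -> Vop 2 C = k ^+ 2 ->
  (A * Dop C - C * Dop A) * Vop 2 (A * C * (A - C)) =
  (A * C * (A - C)) * Vop 2 (A * Dop C - C * Dop A).
Proof.
move=> HA HC VA VC.
have S2 : 2 != 0 :> series F by apply: series_neq0; rewrite coef_natr.
have VDA : Vop 2 (Dop A) = p * Dop p.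
  apply: (mulfI S2); have := Dop_Vop 2 A; rewrite VA DopX /= expr1 => <-; ring.
have VDC : Vop 2 (Dop C) = k * Dop k.
  apply: (mulfI S2); have := Dop_Vop 2 C; rewrite VC DopX /= expr1 => <-; ring.
have DA : Dop A = 2 * (p + k) * (Dop p + Dop k) by rewrite HA DopX raddfD /= expr1; ring.
have DC : Dop C = 4 * (Dop p * k + p * Dop k).
  by rewrite HC -const_natr DopM Dop_const mul0r add0r DopM; ring.
rewrite !rmorphM !rmorphB !rmorphM /= VDA VDC VA VC DA DC HA HC; ring.
Qed.

(* the quotient of the two sides is invariant under q -> q^2 *)
Lemma Vop2_wronskian (A C u : series F) : C = qpow F 1 * u -> coef A 0 = 1 -> coef u 0 != 0 ->
  (A * Dop C - C * Dop A) * Vop 2 (A * C * (A - C)) =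
  (A * C * (A - C)) * Vop 2 (A * Dop C - C * Dop A) ->
  A * Dop C - C * Dop A = A * C * (A - C).
Proof.
move=> Cu A0 u0.
have [w wE] : exists w, w = A * (u + Dop u) - u * Dop A by eexists.
have [e eE] : exists e, e = A * u * (A - C) by eexists.
have -> : A * Dop C - C * Dop A = qpow F 1 * w by rewrite wE Cu DopM Dop_qpow; ring.
have -> : A * C * (A - C) = qpow F 1 * e by rewrite eE Cu; ring.
have C0 : coef C 0 = 0 by rewrite Cu coefM0 /= mul0r.
have e0 : coef e 0 = coef u 0 by rewrite eE !coefM0 coefBs A0 C0 subr0 mulr1 mul1r.
have w0 : coef w 0 = coef u 0.
  by rewrite wE coefBs !coefM0 coefDs A0 /= !mul0r mulr0 subr0 addr0 mul1r.
move=> key; congr (_ * _).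
have key2 : w * Vop 2 e = e * Vop 2 w.
  apply: (mulfI (qpow_neq0 3)); move: key; rewrite !rmorphM /= Vop_qpow // => key.
  have -> : qpow F 3 = qpow F 1 * qpow F 2 by rewrite -qpowD.
  transitivity (qpow F 1 * w * (qpow F (2 * 1) * Vop 2 e)); first by rewrite muln1; ring.
  by rewrite key muln1; ring.
have ue : e \is a GRing.unit by rewrite unit_series_coef0 e0.
have uVe : Vop 2 e \is a GRing.unit by rewrite unit_series_coef0 Vop_coef0 e0.
have fixr : Vop 2 (w / e) = w / e.
  rewrite rmorphM /=; have -> : Vop 2 e^-1 = (Vop 2 e)^-1.
    by apply: (mulrI uVe); rewrite mulrV // -rmorphM /= mulrV // rmorph1.
  apply: (mulIr uVe); rewrite divrK //; apply: (mulIr ue).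
  by rewrite [RHS]mulrAC divrK // key2 mulrC.
have : w / e = 1.
  rewrite (Vop_fix _ fixr) //; have -> : coef (w / e) 0 = 1; last by rewrite rmorph1.
  have h : coef (w / e * e) 0 = coef w 0 by rewrite divrK.
  rewrite (coefM0 (w / e) e) e0 w0 in h.
  by apply: (mulIf u0); rewrite mul1r.
by move=> h; rewrite -[w](divrK ue) h mul1r.
Qed.

(** For alpha = C/A this reads D alpha = alpha (1 - alpha) phi^4. *)
Lemma agm_derivative :
  agm_a * Dop agm_c - agm_c * Dop agm_a = agm_a * agm_c * (agm_a - agm_c).
Proof.
apply: (@Vop2_wronskian _ _ (Vop 2 (psi2 F) ^+ 4)) => //; first exact: agm_a0.
  by rewrite coefX0 Vop_coef0 psi2_coef0 expf_neq0.
exact: landen_wronskian agm_aE agm_cE Vop2_agm_a Vop2_agm_c.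
Qed.

End AGM.

(** * The Hasse invariant of the Legendre family *)

Section Hasse.
Variables (m n : nat).
Hypotheses (m_pr : prime m) (mn : m = (2 * n).+1).

(** Modulo m the integer n is -1/2, and C(-1/2, j) = (-1/4)^j C(2j, j). *)
Lemma bin_half j : (j <= n)%N ->
  (4 ^ j * 'C(n, j))%:R = (-1) ^+ j * 'C(2 * j, j)%:R :> 'F_m.
Proof.
have chm := pchar_Fp m_pr.
have j0 k : (k < m)%N -> (0 < k)%N -> k%:R != 0 :> 'F_m.
  by move=> km k0; rewrite -(dvdn_pcharf chm) gtnNdvd.
have mm : m%:R = 0 :> 'F_m by apply/eqP; rewrite -(dvdn_pcharf chm).
elim: j => [|j IH] jn; first by rewrite expn0 !bin0 mul1n expr0 mul1r.
have jF : j.+1%:R != 0 :> 'F_m by apply: j0; lia.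
apply: (mulfI jF).
have e1 : (j.+1 * 'C(n, j.+1) = (n - j) * 'C(n, j))%N.
  by rewrite mulnC -mul_bin_left mulnC.
have e2 : (j.+1 * 'C(2 * j.+1, j.+1) = 2 * (2 * j + 1) * 'C(2 * j, j))%N.
  have a1 := mul_bin_diag (2 * j).+1 j.
  have a2 := mul_bin_left (2 * j).+1 j.
  have a3 := mul_bin_down (2 * j).+1 j.
  have -> : (2 * j.+1 = (2 * j).+2)%N by lia.
  have s1 : ((2 * j).+1 - j = j.+1)%N by lia.
  by rewrite binS; rewrite /= s1 in a1 a2 a3; lia.
rewrite -natrM mulnCA e1 mulnCA natrM.
have -> : j.+1%:R * ((-1) ^+ j.+1 * 'C(2 * j.+1, j.+1)%:R) =
    (-1) ^+ j.+1 * (j.+1 * 'C(2 * j.+1, j.+1))%:R :> 'F_m by rewrite natrM mulrCA.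
rewrite e2.
have e3 : (4 * (n - j))%:R = - (2 * (2 * j + 1))%:R :> 'F_m.
  apply/eqP; rewrite -addr_eq0 -natrD.
  have -> : (4 * (n - j) + 2 * (2 * j + 1) = 2 * m)%N by lia.
  by rewrite natrM mm mulr0.
have -> : (n - j)%:R * (4 ^ j.+1 * 'C(n, j))%:R = (4 * (n - j))%:R * (4 ^ j * 'C(n, j))%:R :> 'F_m.
  by rewrite -!natrM expnS; congr (_%:R); lia.
by rewrite e3 IH ?(ltnW jn) // natrM exprS; ring.
Qed.

(** The homogenised Hasse polynomial of the Legendre curve, with n = (m - 1)/2. *)
Definition hasse (R : comNzRingType) (x y : R) : R :=
  \sum_(j < n.+1) ('C(n, j) ^ 2)%:R * x ^+ (n - j) * y ^+ j.

Lemma coef_linX (R : comNzRingType) (c d : R) k i : (i <= k)%N ->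
  ((c%:P + d%:P * 'X) ^+ k)`_i = c ^+ (k - i) * d ^+ i *+ 'C(k, i).
Proof.
move=> ik; rewrite exprDn.
rewrite (eq_bigr (fun l : 'I_k.+1 => (c ^+ (k - l) * d ^+ l *+ 'C(k, l)) *: 'X^l)) => [|l _].
  by rewrite -(poly_def k.+1 (fun l => c ^+ (k - l) * d ^+ l *+ 'C(k, l))) coef_poly ltnS ik.
by rewrite exprMn -!rmorphXn /= mulrA -rmorphM /= mul_polyC scalerMnl.
Qed.

(** Both sides are the coefficient of X^n in the n-th power of (x + y)^2 X - x y (1 + X)^2 = (x - y
    X)(x X - y), expanded in two ways. *)
Lemma hasse_landen_int (R : comNzRingType) (x y : R) :
  \sum_(j < n.+1) ((x + y) ^+ 2) ^+ (n - j) * (- (x * y)) ^+ j *+ 'C(2 * j, j) *+ 'C(n, j) =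
  hasse (x ^+ 2) (y ^+ 2).
Proof.
have e : (((x + y) ^+ 2)%:P * 'X + (- (x * y))%:P * (1 + 'X) ^+ 2) ^+ n =
   (x%:P + (- y)%:P * 'X) ^+ n * ((- y)%:P + x%:P * 'X) ^+ n.
  by rewrite -exprMn; congr (_ ^+ _); rewrite rmorphXn rmorphD !rmorphN rmorphM /=; ring.
have := congr1 (fun p : {poly R} => p`_n) e.
rewrite exprDn coef_sum coefM => e1.
transitivity (\sum_(j < n.+1) ((x%:P + (- y)%:P * 'X) ^+ n)`_j * (((- y)%:P + x%:P * 'X) ^+ n)`_(n - j)).
  rewrite -e1; apply: eq_bigr => j _.
  have jn : (j <= n)%N by rewrite -ltnS.
  have AB (A B : R) : (A%:P * 'X) ^+ (n - j) * (B%:P * (1 + 'X) ^+ 2) ^+ j =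
      (A ^+ (n - j) * B ^+ j)%:P * ('X^(n - j) * (1 + 'X) ^+ (2 * j)).
    rewrite (exprMn (n - j)%N A%:P 'X) (exprMn j B%:P ((1 + 'X) ^+ 2)) -(exprM (1 + 'X) 2 j).
    by rewrite polyCM !polyC_exp mulrACA.
  rewrite AB.
  rewrite coefMn coefCM.
  rewrite coefXnM ltnNge leq_subr /= subKn //.
  have := @coef_linX R 1 1 (2 * j) j; rewrite !rmorph1 mul1r => -> //; last by lia.
  by rewrite !expr1n mulr1 mulrnAr mulr1.
apply: eq_bigr => j _; have jn : (j <= n)%N by rewrite -ltnS.
rewrite coef_linX // coef_linX ?leq_subr // subKn // bin_sub //.
have -> : (x ^+ 2) ^+ (n - j) = x ^+ (n - j) * x ^+ (n - j) by rewrite -exprM mulnC exprM expr2.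
have -> : (y ^+ 2) ^+ j = (- y) ^+ j * (- y) ^+ j by rewrite -exprMn mulrNN -expr2.
move: (x ^+ (n - j)) ((- y) ^+ j) ('C(n, j)) => X Y c.
by rewrite -[X * Y *+ c]mulr_natr -[Y * X *+ c]mulr_natr natrX; ring.
Qed.

Lemma hasse_landen (x y : series 'F_m) :
  hasse ((x + y) ^+ 2) (4 * (x * y)) = hasse (x ^+ 2) (y ^+ 2).
Proof.
rewrite -hasse_landen_int; apply: eq_bigr => j _; have jn : (j <= n)%N by rewrite -ltnS.
have h : 4 ^+ j * 'C(n, j)%:R = (-1) ^+ j * 'C(2 * j, j)%:R :> series 'F_m.
  rewrite -natrX -natrM -[LHS]const_natr bin_half // -[in RHS]const_natr.
  rewrite -signr_odd -[in RHS]signr_odd.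
  by case: (odd j); rewrite ?expr1 ?expr0 ?mulN1r ?mul1r // rmorphN.
have aux (R0 : comNzRingType) (S Y c d f : R0) : f * c = (-1) ^+ j * d ->
    c ^+ 2 * S * (f * Y ^+ j) = S * (- Y) ^+ j * d * c.
  move=> e; rewrite exprNn; move: e; move: ((-1) ^+ j) (Y ^+ j) => s Yj e.
  transitivity (c * S * Yj * (f * c)); first by ring.
  by rewrite e; ring.
rewrite -[RHS]mulr_natr -[X in _ = X * _]mulr_natr natrX (exprMn j 4 (x * y)).
exact: aux.
Qed.

Lemma hasse_landen_fix (F : fieldType) (A C p k : series F) :
  hasse ((p + k) ^+ 2) (4 * (p * k)) = hasse (p ^+ 2) (k ^+ 2) ->
  A = (p + k) ^+ 2 -> C = 4 * (p * k) ->
  Vop 2 A = p ^+ 2 -> Vop 2 C = k ^+ 2 -> coef A 0 = 1 -> coef C 0 = 0 ->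
  hasse A C = 1.
Proof.
move=> e HA HC VA VC A0 C0; rewrite -HA -HC in e.
have fixr : Vop 2 (hasse A C) = hasse A C.
  rewrite [RHS]e -VA -VC /hasse rmorph_sum.
  by apply: eq_bigr => j _; rewrite !rmorphM !rmorphXn /= rmorph_nat.
apply: (etrans (Vop_fix (isT : (1 < 2)%N) fixr)).
suff -> : coef (hasse A C) 0 = 1 by rewrite rmorph1.
rewrite /hasse coef_sums big_ord_recl big1 => [|j _].
  by rewrite !coefM0 !coefX0 A0 C0 expr1n bin0 coef_natr expr0 /= !mulr1 addr0.
by rewrite !coefM0 [X in _ * X]coefX0 C0 expr0n mulr0.
Qed.

Lemma Fp_two_neq0 : 2 != 0 :> 'F_m.
Proof.
rewrite -(dvdn_pcharf (pchar_Fp m_pr)) gtnNdvd //.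
by have := prime_gt1 m_pr; lia.
Qed.

(** A form of weight m - 1 with expansion 1 modulo m, as for the Eisenstein series of that weight.
    It allows weights to be raised without changing the series. *)
Lemma hasse_agm : hasse (agm_a 'F_m) (agm_c 'F_m) = 1.
Proof.
apply: (@hasse_landen_fix _ _ _ (Vop 2 (phi 'F_m) ^+ 2) (qpow 'F_m 1 * Vop 4 (psi2 'F_m) ^+ 2)).
- exact: hasse_landen.
- by first [exact: agm_aE | exact: (agm_aE Fp_two_neq0)].
- by apply: agm_cE; exact: Fp_two_neq0.
- by first [exact: Vop2_agm_a | exact: (Vop2_agm_a Fp_two_neq0)].
- by first [exact: Vop2_agm_c | exact: (Vop2_agm_c Fp_two_neq0)].
- by first [exact: agm_a0 | exact: (agm_a0 Fp_two_neq0)].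
- by first [exact: agm_c0 | exact: (agm_c0 Fp_two_neq0)].
Qed.

End Hasse.

(** * Polynomials evaluated at a power series *)

Section PolyEval.
Variable F : fieldType.

Definition peval (P : {poly F}) (x : series F) : series F := (map_poly (@const F) P).[x].

Lemma pevalM P Q x : peval (P * Q) x = peval P x * peval Q x.
Proof. by rewrite /peval rmorphM hornerM. Qed.
Lemma pevalD P Q x : peval (P + Q) x = peval P x + peval Q x.
Proof. by rewrite /peval rmorphD hornerD. Qed.
Lemma pevalX P k x : peval (P ^+ k) x = peval P x ^+ k.
Proof. by rewrite /peval rmorphXn horner_exp. Qed.
Lemma peval_X x : peval 'X x = x.
Proof. by rewrite /peval map_polyX hornerX. Qed.
Lemma peval_C c x : peval c%:P x = const c.
Proof. by rewrite /peval map_polyC hornerC. Qed.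
Lemma peval_sum (I : Type) (r : seq I) (Q : pred I) (f : I -> {poly F}) x :
  peval (\sum_(i <- r | Q i) f i) x = \sum_(i <- r | Q i) peval (f i) x.
Proof.
by rewrite (big_morph _ (fun P Q => pevalD P Q x) (_ : peval 0 x = 0)) // /peval rmorph0 horner0.
Qed.
Lemma pevalN P x : peval (- P) x = - peval P x.
Proof. by rewrite /peval rmorphN hornerN. Qed.
Lemma peval_1 x : peval 1 x = 1.
Proof. by rewrite -polyC1 peval_C rmorph1. Qed.
Lemma peval_nat k x : peval k%:R x = k%:R.
Proof. by rewrite /peval rmorph_nat -polyC_natr hornerC. Qed.
Lemma pevalE (P : {poly F}) x n : (size P <= n)%N -> peval P x = \sum_(0 <= i < n) const P`_i * x ^+ i.
Proof.
move=> sP; rewrite /peval (@horner_coef_wide _ n) ?big_mkord.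
  by apply: eq_bigr => i _; rewrite coef_map.
by rewrite size_map_poly.
Qed.

(** The counterpart on polynomials of the extraction of exponents divisible by m. *)
Definition Upoly (m : nat) (P : {poly F}) : {poly F} := \poly_(i < size P) P`_(m * i).

Lemma coef_Upoly m P i : (0 < m)%N -> (Upoly m P)`_i = P`_(m * i).
Proof.
move=> m0; rewrite coef_poly; case: ltnP => // h; rewrite nth_default //.
by apply: leq_trans h _; rewrite leq_pmull.
Qed.

Lemma size_Upoly m (P : {poly F}) k : (0 < m)%N -> (size P <= m * k)%N -> (size (Upoly m P) <= k)%N.
Proof.
move=> m0 h; apply/leq_sizeP => i ki; rewrite coef_Upoly // nth_default //.
by apply: leq_trans h _; rewrite leq_pmul2l.
Qed.

Definition pseries (P : {poly F}) : series F := Series (fun i => P`_i).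

Lemma pseries_inj : injective pseries.
Proof. by move=> P Q e; apply/polyP => i; have := congr1 (fun x => coef x i) e. Qed.

Lemma pseriesM P Q : pseries (P * Q) = pseries P * pseries Q.
Proof. by apply: seriesP => n; rewrite coefMs /= coefM. Qed.

Lemma invr_expr (u : series F) k : (0 < k)%N -> u \is a GRing.unit -> u^-1 = u^-1 ^+ k * u ^+ k.-1.
Proof. by case: k => // k _ uu; rewrite exprS -mulrA -exprMn mulVr // expr1n mulr1. Qed.

End PolyEval.

(** * The Cartier operator *)

Section Cartier.
Variable m : nat.
Hypothesis m_pr : prime m.
Local Notation F := 'F_m.
Implicit Types x y d w : series F.

Let m0 : (0 < m)%N := prime_gt0 m_pr.
Let mF : m%:R = 0 :> F.
Proof. by apply/eqP; rewrite -(dvdn_pcharf (pchar_Fp m_pr)). Qed.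

Lemma Upoly_frobenius (P Q : {poly F}) : Upoly m (P ^+ m * Q) = P * Upoly m Q.
Proof.
have pU R : pseries (Upoly m R) = Uop m 0 (pseries R).
  by apply: seriesP => n /=; rewrite coef_Upoly // addn0.
apply: pseries_inj; rewrite pU pseriesM pseriesM pU.
have -> : pseries (P ^+ m) = Vop m (pseries P).
  apply: seriesP => n /=; rewrite poly_Fp_frobenius // coef_comp_poly_Xn //.
by rewrite Uop_VopM.
Qed.

Lemma Uop_Dop x : Uop m 0 (Dop x) = 0.
Proof. by apply: seriesP => n /=; rewrite addn0 natrM mF !mul0r. Qed.

(** On differentials d dq/q the operator U_m is the Cartier operator, and logarithmic differentials
    are to be shown fixed by it. *)
Definition dlog_fixed y : Prop := exists d, Dop y = y * d /\ Uop m 0 d = d.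

Lemma dlog_fixedM x y : dlog_fixed x -> dlog_fixed y -> dlog_fixed (x * y).
Proof.
move=> [d [h1 h2]] [d' [h3 h4]]; exists (d + d'); rewrite raddfD /= h2 h4; split=> //.
by rewrite DopM h1 h3; ring.
Qed.

(** Writing 1/(1 + s) = (1 + s)^(m-1) / (1 + s)^m, the denominator is a series in q^m and leaves the
    operator. If m does not divide n, only the top term s^m of s (1 + s)^(m-1) has an exponent
    divisible by m; if m divides n, the logarithmic derivative is zero. *)
Lemma dlog_fixed_lin (c : F) n : (0 < n)%N -> dlog_fixed (1 + const c * qpow F n).
Proof.
move=> n0; have [s sE] : exists s, s = const c * qpow F n by eexists.
rewrite -sE.
have Ds : Dop s = n%:R * s.
  by rewrite sE DopM Dop_const mul0r add0r Dop_qpow; ring.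
have s0 : coef s 0 = 0 by rewrite sE coef_constM /= (_ : (0 == n)%N = false) ?mulr0 //; lia.
have u : (1 + s) \is a GRing.unit.
  by rewrite unit_series_coef0 coefDs s0 addr0 oner_eq0.
exists (n%:R * s / (1 + s)); split.
  by rewrite raddfD /= Dop1 add0r Ds [RHS]mulrC divrK.
case: (boolP (m %| n)%N) => mn.
  have -> : n%:R = 0 :> series F.
    rewrite -const_natr; have -> : n%:R = 0 :> F by apply/eqP; rewrite -(dvdn_pcharf (pchar_Fp m_pr)).
    by rewrite rmorph0.
  by rewrite !mul0r raddf0.
have dE : n%:R * s / (1 + s) = Vop m (1 + s)^-1 * (n%:R * s * (1 + s) ^+ m.-1).
  by rewrite {1}(invr_expr m0 u) (series_frobenius m_pr) mulrCA.
rewrite {1}dE Uop_VopM // [RHS]mulrC; congr (_ * _).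
rewrite -const_natr -mulrA Uop_constM; congr (_ * _).
rewrite exprDn mulr_sumr raddf_sum big_ord_recr /= big1 => [|j _].
  rewrite subnn expr0 mul1r binn mulr1n -exprS prednK // (series_frobenius m_pr) Uop_Vop //.
  by rewrite add0r.
rewrite expr1n mul1r mulrnAr raddfMn /= -exprS.
suff -> : Uop m 0 (s ^+ j.+1) = 0 by rewrite mul0rn.
apply: seriesP => i; rewrite coefUop addn0 sE exprMn -rmorphXn coef_constM /=.
rewrite -qpowM /= (_ : (m * i == j.+1 * n)%N = false) ?mulr0 //.
apply/negP => /eqP h; have : (m %| j.+1 * n)%N by rewrite -h dvdn_mulr.
rewrite Euclid_dvdM // (negbTE mn) orbF gtnNdvd //.
by have := ltn_ord j; lia.
Qed.

(** To any finite order a series with constant term 1 is a product of factors 1 + c q^n, each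
    correcting one coefficient. *)
Lemma dlog_approx y N : coef y 0 = 1 ->
  exists g, [/\ cong N.+1 y g, coef g 0 = 1 & dlog_fixed g].
Proof.
move=> y0; elim: N => [|N [g [yg g0 dg]]].
  exists 1; split=> [i|//|]; first by rewrite ltnS leqn0 => /eqP ->; rewrite y0.
  by exists 0; rewrite Dop1 mulr0 raddf0.
pose c := coef (y / g) N.+1.
have ug : g \is a GRing.unit by rewrite unit_series_coef0 g0 oner_eq0.
exists (g * (1 + const c * qpow F N.+1)); split.
- have h : cong N.+1 (y / g) 1.
    by rewrite -(divrr ug); apply: congM.
  have h2 : cong N.+2 (y / g) (1 + const c * qpow F N.+1).
    move=> i; rewrite ltnS leq_eqVlt => /orP[/eqP ->|iN].
      by rewrite coefDs coef_constM /= eqxx mulr1 add0r.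
    by rewrite h // coefDs coef_constM /= (ltn_eqF iN) mulr0 addr0.
  by rewrite -[y](divrK ug) mulrC; apply: congM.
- by rewrite coefM0 g0 mul1r coefDs coef_constM /= mulr0 addr0.
- by apply: dlog_fixedM => //; apply: dlog_fixed_lin.
Qed.

(** A leading monomial contributes only a constant to d. Coefficient n of U_m d depends on d up to
    order m n, so an approximation by a finite product of that order suffices. *)
Lemma Uop_dlog x d : x != 0 -> Dop x = x * d -> Uop m 0 d = d.
Proof.
move=> x0 Dx; have [k [z [xE z0]]] := series_lead x0.
pose y := const (coef z 0)^-1 * z.
have y0 : coef y 0 = 1 by rewrite coef_constM mulVf.
have uy : y \is a GRing.unit by rewrite unit_series_coef0 y0 oner_eq0.
have zy : z = const (coef z 0) * y by rewrite /y mulrA -rmorphM mulfV // rmorph1 mul1r.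
have [d' d'E] : exists d', d' = d - const k%:R by eexists.
have Dy : Dop y = y * d'.
  have e : Dop x = const k%:R * x + qpow F k * const (coef z 0) * Dop y.
    have Dz : Dop z = const (coef z 0) * Dop y by rewrite {1}zy DopM Dop_const mul0r add0r.
    by rewrite xE DopM Dop_qpow Dz const_natr; ring.
  have xy : x = qpow F k * const (coef z 0) * y by rewrite xE {1}zy mulrA.
  have nz : qpow F k * const (coef z 0) != 0.
    apply: contra x0 => /eqP h; rewrite xE zy mulrA h mul0r //.
  apply: (mulfI nz); move: e; rewrite Dx d'E => e.
  have -> : qpow F k * const (coef z 0) * Dop y = x * d - const k%:R * x by rewrite e; ring.
  by rewrite xy; ring.
suff e : Uop m 0 d' = d'.
  have -> : d = d' + const k%:R by rewrite d'E; ring.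
  rewrite raddfD /= e; congr (_ + _); apply: seriesP => n /=.
  by rewrite addn0 muln_eq0 (gtn_eqF m0).
apply: seriesP => n; rewrite coefUop addn0.
have [g [yg g0 [dg [h1 h2]]]] := dlog_approx (m * n) y0.
have c : cong (m * n).+1 d' dg.
  apply: (@cong_cancel _ _ y); first by rewrite y0 oner_eq0.
  rewrite -Dy; apply: (@cong_trans _ _ (Dop g)).
    by move=> i iN; change (i%:R * coef y i = i%:R * coef g i); rewrite yg.
  by rewrite h1; apply: congM => //; apply: cong_sym.
rewrite c // c; last by rewrite ltnS leq_pmull.
by rewrite -[in RHS]h2 coefUop addn0.
Qed.

(** If m does not divide i, then x^i d is D(x^i)/i, an exact differential, which U_m kills. If i = m
    j, Frobenius takes x^j out of the operator and d is fixed. *)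
Lemma cartier_step x d (P : {poly F}) : x != 0 -> Dop x = x * d ->
  Uop m 0 (peval P x * d) = peval (Upoly m P) x * d.
Proof.
move=> x0 Dx; have Ud := Uop_dlog x0 Dx.
have Ui i : Uop m 0 (x ^+ i * d) = if (m %| i)%N then x ^+ (i %/ m) * d else 0.
  case: ifP => [/dvdnP[j ->]|mi].
    by rewrite mulnK // exprM (series_frobenius m_pr) Uop_VopM // Ud.
  have iF : i%:R != 0 :> F by rewrite -(dvdn_pcharf (pchar_Fp m_pr)) mi.
  have i0 : (0 < i)%N by case: i mi iF => //; rewrite dvdn0.
  have : Dop (x ^+ i) = const i%:R * (x ^+ i * d).
    have xi : x ^+ i = x * x ^+ i.-1 by rewrite -exprS prednK.
    by rewrite DopX Dx const_natr xi; ring.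
  move=> h; have := Uop_Dop (x ^+ i); rewrite h Uop_constM => /eqP.
  rewrite mulf_eq0 => /orP[/eqP h0|/eqP //].
  by have := congr1 (fun z => coef z 0) h0 => /= e; rewrite e eqxx in iF.
pose n := size P.
rewrite (@pevalE _ P x (m * n + 0).+1); last by rewrite addn0 -/n; nia.
rewrite mulr_suml raddf_sum /=.
transitivity (\sum_(0 <= i < (m * n + 0).+1 | (m %| i)%N) const P`_i * (x ^+ (i %/ m) * d)).
  rewrite [RHS]big_mkcond; apply: eq_bigr => i _.
  by rewrite -mulrA Uop_constM Ui; case: ifP => _; rewrite ?mulr0.
rewrite (big_dvdn n (fun i => const P`_i * (x ^+ (i %/ m) * d)) m0).
rewrite (@pevalE _ (Upoly m P) x n.+1); last first.
  by apply: size_Upoly => //; rewrite -/n; nia.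
rewrite mulr_suml; apply: eq_bigr => j _.
by rewrite coef_Upoly // mulKn // mulrA.
Qed.

Definition Upoly2 (P : {poly F}) := Upoly m (Upoly m P).

Lemma Upoly2_frobenius (P Q : {poly F}) : Upoly2 (P ^+ (m * m) * Q) = P * Upoly2 Q.
Proof. by rewrite /Upoly2 exprM Upoly_frobenius Upoly_frobenius. Qed.

Lemma coef0_Upoly2 P : (Upoly2 P)`_0 = P`_0.
Proof. by rewrite /Upoly2 !coef_Upoly // !muln0. Qed.

Lemma size_Upoly2 (P : {poly F}) k : (size P <= m * m * k)%N -> (size (Upoly2 P) <= k)%N.
Proof. by move=> h; do 2! apply: size_Upoly => //; rewrite mulnA. Qed.

Lemma frobenius2 x : x ^+ (m * m) = Vop (m * m) x.
Proof. by rewrite exprM !(series_frobenius m_pr) Vop_comp. Qed.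

(* the weight of W is raised until the differential becomes an m^2-th power
   times a polynomial in x *)
Lemma cartier_main x W (l K N : {poly F}) : x != 0 ->
  Dop x = x * (peval l x * W ^+ 2) -> W ^+ m.-1 * peval K x = 1 -> peval l x * W ^+ 2 != 0 ->
  Uop (m * m) 0 (peval N x) =
  W ^+ (m * m).-1 * peval (Upoly2 (N * K ^+ (m.+1 * (m * m - 2)) * l ^+ (m * m).-1)) x.
Proof.
move=> x0 Dx WK nz.
have M2 : (2 <= m * m)%N by have := prime_gt1 m_pr; nia.
have [K2 K2E] : exists K2, K2 = K ^+ m.+1 by eexists.
have WK2 : W ^+ (m * m).-1 * peval K2 x = 1.
  have -> : (m * m).-1 = (m.-1 * m.+1)%N by have := prime_gt1 m_pr; nia.
  by rewrite K2E pevalX exprM -exprMn WK expr1n.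
rewrite exprM -K2E; set P := _ * l ^+ _.
have h1 : Uop (m * m) 0 (peval P x * (peval l x * W ^+ 2)) = peval (Upoly2 P) x * (peval l x * W ^+ 2).
  by rewrite -Uop_comp !(cartier_step _ x0 Dx).
have h2 : peval P x * (peval l x * W ^+ 2) =
    Vop (m * m) (peval l x * peval K2 x * W ^+ 2) * peval N x.
  rewrite -frobenius2 /P !pevalM !pevalX.
  have [M ME] : exists M, (m * m = M.+2)%N by exists (m * m - 2)%N; lia.
  rewrite ME /= subn2 /=; rewrite ME /= in WK2.
  move: WK2; move: (peval K2 x) (peval l x) (peval N x) => k ll nn WK2.
  (* Here m^2 = M + 2, and the relation W^(m^2-1) k = 1 is inserted twice to complete an m^2-th
     power. *)
  have e : W ^+ 2 * k ^+ M = (k * W ^+ 2) ^+ M.+2.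
    rewrite exprMn -exprM -[k ^+ M.+2]/(k ^+ (2 + M)) exprD.
    have -> : W ^+ (2 * M.+2) = W ^+ 2 * (W ^+ M.+1 * W ^+ M.+1) by rewrite -!exprD; congr (_ ^+ _); lia.
    have -> : k ^+ 2 * k ^+ M * (W ^+ 2 * (W ^+ M.+1 * W ^+ M.+1)) =
       (W ^+ 2 * k ^+ M) * ((W ^+ M.+1 * k) * (W ^+ M.+1 * k)) by ring.
    by rewrite WK2 !mulr1.
  have -> : ll * k * W ^+ 2 = ll * (k * W ^+ 2) by ring.
  by rewrite exprMn -e [ll ^+ M.+2]exprS; ring.
rewrite h2 Uop_VopM in h1; last by nia.
have h3 : peval K2 x * Uop (m * m) 0 (peval N x) = peval (Upoly2 P) x.
  by apply: (mulIf nz); rewrite -h1; ring.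
by rewrite -h3 mulrA WK2 mul1r.
Qed.

End Cartier.

(** * Linear combinations of theta series with periodic weights *)

Section ThetaLike.
Variables (F : finFieldType) (p N : nat).
Hypothesis p_pr : prime p.

Definition qexp r (G : 'M[int]_r) (v : 'rV[int]_r) : nat := absz (qform G v).

Lemma posdef_ge0 r (G : 'M[int]_r) v : posdef G -> 0 <= qform G v.
Proof.
move=> [_ pG]; have [->|v0] := eqVneq v 0; last exact/ltW/pG.
by rewrite /qform /bform !mul0mx mxE.
Qed.

Lemma qexpE r (G : 'M[int]_r) v : posdef G -> qform G v = (qexp G v)%:Z.
Proof. by move=> pG; rewrite /qexp gez0_abs // posdef_ge0. Qed.

Lemma theta_gen r (G : 'M[int]_r) (f : 'rV[int]_r -> F) : posdef G ->
  Series (theta_coef G f) = gen (qexp G) f.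
Proof.
move=> pG; apply: seriesP => n /=; rewrite /theta_coef; congr (fsum _ f).
by apply/seteqP; split=> v /=; rewrite qexpE // => h; [case: h|rewrite h].
Qed.

Lemma good_proper r (G : 'M[int]_r) : good_form p G -> proper (qexp G).
Proof.
move=> [pG fG _] n.
apply: (@sub_finite_set _ _ (\bigcup_(i in [set i | (i < n.+1)%N]%classic) [set v | qform G v = i%:Z]%classic)).
  by move=> v /= vn; exists (qexp G v) => //=; rewrite -qexpE.
by apply: bigcup_finite => [|i _]; [exact: finite_II|exact: fG].
Qed.

Lemma good_formP r (G : 'M[int]_r) : posdef G -> ~~ (p%:Z %| \det G)%Z ->
  proper (qexp G) -> good_form p G.
Proof.
move=> pG dG prG; split=> // n; apply: (sub_finite_set _ (proper_fibre n prG)).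
by move=> v /=; rewrite qexpE // => -[].
Qed.

Inductive theta_like : series F -> Prop :=
| theta_like_form r (G : 'M[int]_r.+1) (f : 'rV[int]_r.+1 -> F) :
    good_form p G -> periodic N f -> theta_like (Series (theta_coef G f))
| theta_like0 : theta_like 0
| theta_likeD x y : theta_like x -> theta_like y -> theta_like (x + y).

Lemma theta_like_gen r (G : 'M[int]_r.+1) (f : 'rV[int]_r.+1 -> F) :
  good_form p G -> periodic N f -> theta_like (gen (qexp G) f).
Proof.
move=> gG fN; rewrite -theta_gen; first exact: theta_like_form.
by case: gG.
Qed.

Lemma theta_likeZ a x : theta_like x -> theta_like (const a * x).
Proof.
elim=> [r G f gG fN||y z _ hy _ hz]; last by rewrite mulrDr; exact: theta_likeD.
  rewrite theta_gen -?genZ; last by case: gG.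
  by apply: theta_like_gen => // u v; rewrite fN.
by rewrite mulr0; exact: theta_like0.
Qed.

Lemma theta_like_sum (I : Type) (r : seq I) (P : pred I) (x : I -> series F) :
  (forall i, P i -> theta_like (x i)) -> theta_like (\sum_(i <- r | P i) x i).
Proof. by move=> h; apply: big_ind => //; [exact: theta_like0|exact: theta_likeD]. Qed.

Lemma qform_block r1 r2 (G1 : 'M[int]_r1) (G2 : 'M[int]_r2) v :
  qform (block_mx G1 0 0 G2) v = qform G1 (lsubmx v) + qform G2 (rsubmx v).
Proof.
rewrite /qform /bform -{1 2}(hsubmxK v) mul_row_block tr_row_mx mul_row_col.
by rewrite !mulmx0 addr0 add0r mxE.
Qed.

Lemma qexp_block r1 r2 (G1 : 'M[int]_r1) (G2 : 'M[int]_r2) v : posdef G1 -> posdef G2 ->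
  qexp (block_mx G1 0 0 G2) v = (qexp G1 (lsubmx v) + qexp G2 (rsubmx v))%N.
Proof.
by move=> p1 p2; rewrite {1}/qexp qform_block !qexpE // -PoszD.
Qed.

Definition split_row r1 r2 (v : 'rV[int]_(r1 + r2)) : 'rV[int]_r1 * 'rV[int]_r2 :=
  (lsubmx v, rsubmx v).

Lemma split_row_inj r1 r2 : injective (@split_row r1 r2).
Proof. by move=> u v [h1 h2]; rewrite -[u]hsubmxK -[v]hsubmxK h1 h2. Qed.

Lemma good_form_block r1 r2 (G1 : 'M[int]_r1) (G2 : 'M[int]_r2) :
  good_form p G1 -> good_form p G2 -> good_form p (block_mx G1 0 0 G2).
Proof.
move=> g1 g2; have [[s1 p1] _ d1] := g1; have [[s2 p2] _ d2] := g2.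
have P1 : posdef G1 by []. have P2 : posdef G2 by [].
apply: good_formP.
- split=> [|v v0]; first by rewrite tr_block_mx s1 s2 !trmx0.
  rewrite qform_block; have [l0|l0] := eqVneq (lsubmx v) 0.
    apply: ltr_wpDl; first exact: posdef_ge0.
    apply: p2; apply: contra v0 => /eqP r0; rewrite -[v]hsubmxK l0 r0 row_mx0 //.
  by apply: ltr_wpDr; [exact: posdef_ge0|exact: p1].
- move: d1 d2; rewrite det_ublock !dvdzE abszM Euclid_dvdM // => /negbTE -> /negbTE -> //.
- move=> n.
  have pr := proper_inj (@split_row_inj r1 r2) (proper_prod (good_proper g1) (good_proper g2)).
  by apply: (sub_finite_set _ (pr n)) => v /=; rewrite qexp_block.
Qed.

(** Products correspond to orthogonal sums of forms with the product weight. *)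
Lemma theta_likeM x y : theta_like x -> theta_like y -> theta_like (x * y).
Proof.
elim=> [r G f gG fN||x1 x2 _ h1 _ h2] hy; last by rewrite mulrDl; apply: theta_likeD; auto.
  elim: hy => [r' G' f' gG' fN'||y1 y2 _ h1 _ h2]; last by rewrite mulrDr; exact: theta_likeD.
    have P1 : posdef G by case: gG. have P2 : posdef G' by case: gG'.
    rewrite !theta_gen // gen_mul; try exact: good_proper.
    rewrite (@gen_bij _ _ _ (@split_row r.+1 r'.+1)) /=.
    - rewrite (@gen_ext _ _ _ (qexp (block_mx G 0 0 G')) _ (fun v => f (lsubmx v) * f' (rsubmx v))) //.
        apply: (@theta_like_gen (r + r'.+1)%N (block_mx G 0 0 G')) => [|u v].
          exact: (good_form_block gG gG').
        by rewrite !linearD !linearZ /= fN fN'.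
      by move=> v /=; rewrite qexp_block.
    - exact: split_row_inj.
    - by move=> [u v]; exists (row_mx u v); rewrite /split_row row_mxKl row_mxKr.
    - by apply: proper_prod; exact: good_proper.
  by rewrite mulr0; exact: theta_like0.
by rewrite mul0r; exact: theta_like0.
Qed.

(** Forms have positive rank and no constructor gives the unit series; the last factor y takes care
    of k = 0. *)
Lemma theta_likeXM x y k : theta_like x -> theta_like y -> theta_like (x ^+ k * y).
Proof.
move=> hx hy; elim: k => [|k IH]; first by rewrite expr0 mul1r.
by rewrite exprS -mulrA; exact: theta_likeM.
Qed.

Lemma theta_like_sq c (f : int -> F) : (0 < c)%N -> ~~ (p %| c)%N ->
  (forall x y : int, f (x + N%:Z * y) = f x) -> theta_like (gen (fun x => c * sq x)%N f).
Proof.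
move=> c0 pc fN.
pose G : 'M[int]_1 := (c%:Z)%:M.
have qG v : qform G v = c%:Z * v 0%R 0%R ^+ 2.
  by rewrite /qform /bform mul_mx_scalar mxE big_ord1 !mxE; ring.
have eG v : qexp G v = (c * sq (v 0%R 0%R))%N.
  by rewrite /qexp qG -sqE -PoszM.
have v00 (v : 'rV[int]_1) : v = const_mx (v 0%R 0%R) by apply/rowP => i; rewrite mxE (ord1 i).
have gG : good_form p G.
  apply: good_formP.
  - split=> [|v v0]; first by rewrite tr_scalar_mx.
    rewrite qG; apply: mulr_gt0; first by lia.
    rewrite lt_neqAle sqr_ge0 andbT eq_sym sqrf_eq0; apply: contra v0 => /eqP h.
    by rewrite (v00 v) h; apply/eqP/rowP => i; rewrite !mxE.
  - by rewrite det_scalar expr1 dvdzE.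
  - move=> n; have hi : injective (fun v : 'rV[int]_1 => v 0%R 0%R).
      by move=> u v h; rewrite (v00 u) (v00 v) h.
    have pr := proper_inj hi (proper_mul c0 sq_proper).
    by apply: (sub_finite_set _ (pr n)) => v /=; rewrite eG.
have -> : gen (fun x => c * sq x)%N f = gen (qexp G) (fun v => f (v 0%R 0%R)).
  rewrite [RHS](@gen_bij _ _ _ (fun x : int => const_mx x : 'rV[int]_1)); last exact: good_proper gG.
  - by apply: gen_ext => x /=; rewrite ?eG mxE.
  - by move=> x y /rowP /(_ 0); rewrite !mxE.
  - by move=> v; exists (v 0%R 0%R).
by apply: theta_like_gen => // u v; rewrite !mxE fN.
Qed.

(** The cross term of the hexagonal form is odd, so an even multiple is taken to have an integral
    Gram matrix. Its determinant 3 c^2 explains the condition at 3. *)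
Lemma theta_like_hex c (f : int * int -> F) : (0 < c)%N -> ~~ (p %| c)%N -> ~~ (p %| 3)%N ->
  (forall t s : int * int, f (t.1 + N%:Z * s.1, t.2 + N%:Z * s.2) = f t) ->
  theta_like (gen (fun t => 2 * c * hex t)%N f).
Proof.
move=> c0 pc p3 fN.
pose G : 'M[int]_2 := \matrix_(i, j) (if i == j then 2 * c%:Z else c%:Z).
have qG v : qform G v = 2 * c%:Z * (v 0 0 ^+ 2 + v 0 0 * v 0 1 + v 0 1 ^+ 2).
  rewrite /qform /bform mxE big_ord_recl big_ord1 !mxE !big_ord_recl !big_ord0 !mxE /=.
  have -> : lift ord0 ord0 = 1 :> 'I_2 by apply/val_inj.
  by ring.
pose h (v : 'rV[int]_2) : int * int := (v 0 0, v 0 1).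
have eG v : qexp G v = (2 * c * hex (h v))%N.
  by rewrite /qexp qG !abszM.
have hi : injective h.
  move=> u v [h1 h2]; apply/rowP => i.
  have i01 : i = 0 \/ i = 1 by case: i => [[|[|//]] ?]; [left|right]; apply/val_inj.
  by case: i01 => ->.
have gG : good_form p G.
  apply: good_formP.
  - split=> [|v v0]; first by apply/matrixP => i j; rewrite !mxE eq_sym.
    rewrite qG; apply: mulr_gt0; first by lia.
    have : h v != (0, 0).
      apply: contra v0 => /eqP e; apply/eqP/hi; rewrite e /h !mxE //.
    rewrite xpair_eqE negb_and; move: (v 0 0) (v 0 1) => a b0.
    case/orP=> nz; nia.
  - have -> : \det G = (3 * (c * c))%N%:Z.
      rewrite (expand_det_row _ 0) !big_ord_recl big_ord0 /cofactor !det_mx11 !mxE /= /bump /=.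
      by rewrite ?add0n ?addn0 ?expr0 ?expr1 !PoszM; ring.
    rewrite dvdzE.
    by rewrite /= !Euclid_dvdM // (negbTE pc) (negbTE p3).
  - move=> n; have c2 : (0 < 2 * c)%N by lia.
    have pr := proper_inj hi (proper_mul c2 hex_proper).
    by apply: (sub_finite_set _ (pr n)) => v /=; rewrite eG.
have -> : gen (fun t => 2 * c * hex t)%N f = gen (qexp G) (fun v => f (h v)).
  pose g (t : int * int) : 'rV[int]_2 := \row_j (if j == 0 then t.1 else t.2).
  have hg t : h (g t) = t by rewrite /h /g !mxE /=; case: t.
  rewrite [RHS](@gen_bij _ _ _ g); last exact: good_proper gG.
  - by apply: gen_ext => x /=; rewrite ?eG hg.
  - by move=> x y e; rewrite -(hg x) -(hg y) e.
  - by move=> v; exists (h v); apply: hi; rewrite hg.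
by apply: theta_like_gen => // u v; rewrite /h !mxE -(fN (h u) (h v)).
Qed.

Lemma theta_like_phi k : (0 < k)%N -> ~~ (p %| k)%N -> theta_like (Vop k (phi F)).
Proof. by move=> k0 pk; rewrite /phi gen_Vop //; exact: theta_like_sq. Qed.

(** Since (2x + 1)^2 = 8 tri(x) + 1, this is the sum of q^(c x^2) over the odd integers, an
    indicator of even period. *)
Lemma theta_like_psi2 c : (0 < c)%N -> ~~ (p %| c)%N -> ~~ odd N ->
  theta_like (qpow F c * Vop (8 * c) (psi2 F)).
Proof.
move=> c0 pc N2; rewrite /psi2 gen_Vop ?muln_gt0 // gen_qpow.
pose f (x : int) : F := (odd `|x|%N)%:R.
have -> : gen (fun t => c + 8 * c * tri t)%N (fun=> 1) = gen (fun x => c * sq x)%N f.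
  rewrite [RHS](@gen_inj _ _ _ (fun x : int => 2 * x + 1)); last exact: proper_mul sq_proper.
  - apply: gen_ext => x /=; last by rewrite /f (_ : odd _ = true) //; lia.
    have := triE x; have := sqE (2 * x + 1); nia.
  - by move=> x y; lia.
  - move=> y; have [k [e|e]] := int_parity y; last by right; exists k.
    by left; rewrite /f (_ : odd _ = false) //; lia.
apply: theta_like_sq => // x y; rewrite /f; congr (_%:R); congr nat_of_bool.
have [k kE] : exists k, N = (2 * k)%N by exists (N./2); lia.
rewrite kE; have [u [e|e]] := int_parity x; have -> : x + (2 * k)%N%:Z * y = 2 * (u + k%:Z * y) + (x - 2 * u) by rewrite PoszM; ring.
all: rewrite e; lia.
Qed.

(** Since (6x + 1)^2 = 24 pent(x) + 1, the exponents are 2 (6x + 1)^2. The sign of the pentagonal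
    series becomes the indicator of 1 minus that of 7 modulo 12. *)
Lemma theta_like_euler : ~~ (p %| 2)%N -> (12 %| N)%N ->
  theta_like (qpow F 2 * Vop 48 (euler F)).
Proof.
move=> p2 N12; rewrite euler_pentagonal /pent_series gen_Vop // gen_qpow.
pose f (x : int) : F := (modz x 12 == 1)%:R - (modz x 12 == 7)%:R.
have -> : gen (fun t => 2 + 48 * pent t)%N (sgn F) = gen (fun x => 2 * sq x)%N f.
  rewrite [RHS](@gen_inj _ _ _ (fun x : int => 6 * x + 1)); last exact: proper_mul sq_proper.
  - apply: gen_ext => x /=; last first.
      rewrite /sgn /f; have [u [->|->]] := int_parity x.
        have -> : absz (2 * u) = (2 * absz u)%N by lia.
        have -> : modz (6 * (2 * u) + 1) 12 = 1 by lia.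
        by rewrite exprM sqrrN expr1n expr1n subr0.
      have -> : modz (6 * (2 * u + 1) + 1) 12 = 7 by lia.
      by rewrite -signr_odd (_ : odd _ = true) ?sub0r //; lia.
    have := pentE x; have := sqE (6 * x + 1); nia.
  - by move=> x y; lia.
  - move=> y; case: (boolP (modz y 6 == 1)) => e; first by right; exists (divz y 6); rewrite [RHS](divz_eq y 6) (eqP e) mulrC.
    have aux (r : int) : modz r 6 = 1 -> (modz y 12 == r) = false.
      move=> hr; apply/negP => /eqP h; move/negP: e; apply; rewrite (divz_eq y 12) h.
      have -> : divz y 12 * 12 + r = (divz y 12 * 2) * 6 + r by ring.
      by rewrite modzMDl hr.
    by left; rewrite /f (aux 1) // (aux 7) // subrr.
apply: theta_like_sq => // x y; rewrite /f; case/dvdnP: N12 => k ->.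
have -> : modz (x + (k * 12)%N%:Z * y) 12 = modz x 12.
  have -> : x + (k * 12)%N%:Z * y = k%:Z * y * 12 + x by rewrite PoszM; ring.
  by rewrite modzMDl.
by [].
Qed.

Lemma theta_like_borwein k : (0 < k)%N -> ~~ (p %| k)%N -> ~~ (p %| 12)%N -> (12 %| N)%N ->
  theta_like (Vop (24 * k) (borwein_b F)).
Proof.
move=> k0 pk p12 N12; rewrite /borwein_b gen_Vop ?muln_gt0 //.
pose f (t : int * int) : F := (modz (t.1 - t.2) 3 == 0)%:R - (modz (t.1 - t.2) 3 == 2)%:R.
rewrite (@gen_ext _ _ _ (fun t => 2 * (12 * k) * hex t)%N _ f) //; last by move=> t /=; lia.
apply: theta_like_hex; first by rewrite muln_gt0.
- by rewrite Euclid_dvdM // negb_or p12.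
- by apply: contra p12 => h; apply: dvdn_trans h _.
- move=> t s; rewrite /f /=; case/dvdnP: N12 => j ->.
  suff -> : modz (t.1 + (j * 12)%N%:Z * s.1 - (t.2 + (j * 12)%N%:Z * s.2)) 3 = modz (t.1 - t.2) 3 by [].
  have -> : t.1 + (j * 12)%N%:Z * s.1 - (t.2 + (j * 12)%N%:Z * s.2) = (j%:Z * 4 * (s.1 - s.2)) * 3 + (t.1 - t.2).
    by rewrite PoszM; ring.
  by rewrite modzMDl.
Qed.

Lemma theta_like_hecke x : odd p -> (0 < N)%N -> p = 1 %[mod N] ->
  p.-1%:R != 0 :> F -> p%:R != 0 :> F -> theta_like x -> hecke_null p (coef x).
Proof.
move=> p_odd N0 pN p1F pF; elim=> [r G f gG fN||y z _ [s s0 hs] _ [t t0 ht]].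
- exact: theta_null p_pr p_odd N0 pN p1F pF G f gG erefl fN.
- by exists 1%N.
- exists (s * t)%N; first by rewrite muln_gt0 s0.
  move=> u n u0 pn; rewrite coefDs.
  have h1 := hs (t * u)%N n _ pn; have h2 := ht (s * u)%N n _ pn.
  rewrite [(s * (t * u))%N]mulnA in h1; rewrite [(t * (s * u))%N]mulnCA [(s * (t * u))%N]mulnA in h2.
  by rewrite h1 ?h2 ?addr0 // muln_gt0 ?s0 ?t0 u0.
Qed.

(** As p is prime to D, the class r modulo D can be combined with the class of q = p^(2s-1) modulo q
    p. The resulting indices are q (p j + 1), where the sequence vanishes. *)
Lemma hecke_progression (c : nat -> F) D r : coprime p D -> hecke_null p c ->
  exists A B, (0 < A)%N /\ forall n, c (D * (A * n + B) + r)%N = 0.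
Proof.
move=> cpD [s s0 hs].
have p1 := prime_gt1 p_pr.
have [q qE] : exists q, q = (p ^ (2 * s - 1))%N by eexists.
have q0 : (0 < q)%N by rewrite qE expn_gt0; lia.
have qp : (p ^ (2 * s) = q * p)%N by rewrite qE -expnSr; congr (_ ^ _)%N; lia.
have m0 : (0 < q * p)%N by rewrite muln_gt0 q0; lia.
(* Bezout gives a D = -1 modulo p^(2s). *)
have [a _ /dvdnP[k kE]] := Bezoutl D m0.
have g1 : gcdn (q * p) D = 1%N by apply/eqP; rewrite -qp; exact: coprimeXl.
rewrite g1 in kE.
(* [X] represents r - q modulo q p, with q p added to remain a natural number; then D a X + r = q
   modulo q p. *)
have [X XE] : exists X, (X + q = r + q * p)%N by exists (r + q * p - q)%N; nia.
exists (q * p)%N, (a * X)%N; split=> // n.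
have X0 : (0 < X)%N by nia.
have k0 : (0 < k)%N by nia.
have [Y YE] : exists Y, (k * X = Y.+1)%N by exists (k * X).-1; nia.
have e : (D * (q * p * n + a * X) + r = q * (p * (D * n + Y) + 1))%N.
  have e1 : (X + a * D * X = (k * X) * (q * p))%N by rewrite [(k * X * _)%N]mulnAC -kE mulnDl mul1n.
  rewrite YE in e1; nia.
rewrite e qE.
have := hs 1%N (p * (D * n + Y) + 1)%N; rewrite muln1; apply => //.
by rewrite dvdn_addr ?dvdn_mulr // dvdn1; lia.
Qed.

Lemma theta_like_progression D r (g : series F) :
  odd p -> (0 < N)%N -> p = 1 %[mod N] -> p.-1%:R != 0 :> F -> p%:R != 0 :> F ->
  (0 < D)%N -> coprime p D -> theta_like (qpow F r * Vop D g) ->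
  exists A B, (0 < A)%N /\ forall n, coef g (A * n + B) = 0.
Proof.
move=> p_odd N0 pN p1F pF D0 cpD h.
have [A [B [A0 hAB]]] := @hecke_progression _ D r cpD (theta_like_hecke p_odd N0 pN p1F pF h).
exists A, B; split=> // n; have := hAB n.
by rewrite coef_qpowM leq_addl addnK /= dvdn_mulr // mulKn.
Qed.

End ThetaLike.

(** * The generating function of k-regular partitions *)

Section RegularGenerating.
Variables (F : fieldType) (k : nat).
Hypothesis k0 : (0 < k)%N.

Definition regular_series : series F := Series (fun n => (b k n)%:R).

(** The factor of the part i.+1, cut at multiplicity n as in the encoding of partitions, and reduced
    to multiplicity 0 when k divides the part. *)
Definition geom (n i : nat) : series F :=
  \sum_(j < n.+1) ((k %| i.+1)%N ==> (j == 0 :> nat))%:R * qpow F (j * i.+1).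

(** Expanding the product of sums chooses one multiplicity for each part, that is, one function in
    the encoding. *)
Lemma coef_prod_geom n : coef (\prod_(i < n) geom n i) n = (b k n)%:R.
Proof.
rewrite /geom (bigA_distr_bigA (fun (i : 'I_n) (j : 'I_n.+1) =>
  ((k %| i.+1)%N ==> (j == 0 :> nat))%:R * qpow F (j * i.+1))) /= coef_sums.
rewrite /b -sum1_card natr_sum [RHS]big_mkcond /=; apply: eq_bigr => f _.
have -> : \prod_(i < n) (((k %| i.+1)%N ==> (f i == 0 :> nat))%:R * qpow F (f i * i.+1)) =
    const (k_regular k f)%:R * qpow F (\sum_(i < n) f i * i.+1).
  rewrite big_split /=; congr (_ * _); last by rewrite (big_morph (qpow F) (@qpowD F) (qpow0 F)).
  have bm (P : 'I_n -> bool) : \prod_(i < n) (P i)%:R = [forall i, P i]%:R :> series F.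
    have [/forallP h|] := boolP [forall i, P i]; first by rewrite big1 // => i _; rewrite h.
    by rewrite negb_forall => /existsP[i hi]; rewrite (bigD1 i) //= (negbTE hi) mul0r.
  rewrite bm const_natr; congr (nat_of_bool _)%:R; apply: eq_forallb => i.
  by rewrite lt0n; case: (_ %| _)%N; case: (_ == _).
rewrite inE coef_constM /is_partition /= eq_sym.
by case: (_ == _); case: (k_regular k f); rewrite /= ?mulr1 ?mulr0.
Qed.

Lemma geom_telescope N d : (\sum_(j < N) qpow F (j * d)) * (1 - qpow F d) = 1 - qpow F (N * d).
Proof.
elim: N => [|N IH]; first by rewrite big_ord0 mul0r mul0n qpow0 subrr.
by rewrite big_ord_recr /= mulrDl IH mulSn addnC qpowD; ring.
Qed.

Lemma geom_cong n i : cong n.+1 (geom n i * (1 - qpow F i.+1))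
  (if (k %| i.+1)%N then 1 - qpow F i.+1 else 1).
Proof.
rewrite /geom; case: ifP => ki /=.
  rewrite big_ord_recl /= mul0n qpow0 big1 ?addr0 ?mulr1 ?mul1r //.
  by move=> j _; rewrite mul0r.
under eq_bigr => j _ do rewrite mul1r.
by rewrite geom_telescope; apply: cong_one_qpow; nia.
Qed.

Let dfac i : series F := if (k %| i.+1)%N then 1 - qpow F i.+1 else 1.

Lemma prod_dvd_euler n : \prod_(0 <= i < k * n) dfac i = Vop k (euler_fin F n).
Proof.
rewrite /dfac; case: k k0 => // k' _; elim: n => [|n IH].
  by rewrite muln0 big_nil /euler_fin big_ord0 rmorph1.
rewrite euler_finS rmorphM rmorphB rmorph1 /= Vop_qpow // -IH.
rewrite (@big_cat_nat _ _ _ (k'.+1 * n)) //=; last by rewrite leq_pmul2l.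
have E : (k'.+1 * n.+1 = (k'.+1 * n + k').+1)%N by lia.
congr (_ * _); rewrite E big_nat_recr ?leq_addr //= -E dvdn_mulr //.
rewrite big_nat big1 ?mul1r // => i /andP[i1 i2]; rewrite ifF //.
apply/negP => /dvdnP[j jE].
have h1 : (n < j)%N by rewrite -(ltn_pmul2r (ltn0Sn k')) -jE mulnC; lia.
have : (j < n.+1)%N by rewrite -(ltn_pmul2r (ltn0Sn k')) -jE mulnC E; lia.
by lia.
Qed.

Lemma euler_fin_congS n : cong n.+1 (euler_fin F n) (euler F).
Proof.
apply: (@cong_trans _ _ (euler_fin F n.+1)); last exact: euler_fin_cong.
rewrite euler_finS -[X in cong _ X _]mulr1; apply: congM => //.
by apply: cong_sym; exact: cong_one_qpow.
Qed.

Lemma prod_dfac_cong n : cong n.+1 (\prod_(0 <= i < n) dfac i) (Vop k (euler F)).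
Proof.
apply: (@cong_trans _ _ (Vop k (euler_fin F n))); last by apply: cong_Vop; exact: euler_fin_congS.
rewrite -prod_dvd_euler (@big_cat_nat _ _ _ n 0 (k * n)) //=; last by rewrite leq_pmull.
rewrite -[X in cong _ X _]mulr1; apply: congM => //; apply: cong_sym.
rewrite big_nat; apply: (big_ind (fun x => cong n.+1 x 1)) => [//|x y hx hy|i /andP[ni _]].
  by rewrite -(mulr1 1); exact: congM.
by rewrite /dfac; case: ifP => // _; apply: cong_one_qpow; lia.
Qed.

Lemma regular_seriesM : regular_series * euler F = Vop k (euler F).
Proof.
have eu : euler F \is a GRing.unit by rewrite unit_series_coef0 euler_coef0 oner_eq0.
suff -> : regular_series = (euler F)^-1 * Vop k (euler F) by rewrite mulrAC mulVr // mul1r.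
apply: seriesP => n /=; rewrite -coef_prod_geom.
suff h : cong n.+1 (\prod_(i < n) geom n i) ((euler F)^-1 * Vop k (euler F)) by exact: h.
apply: (@cong_cancel _ _ (euler F)); first by rewrite euler_coef0 oner_eq0.
rewrite mulrA divrr // mul1r.
apply: (@cong_trans _ _ (euler_fin F n * \prod_(i < n) geom n i)).
  by apply: congM => //; apply: cong_sym; exact: euler_fin_congS.
apply: cong_trans (@prod_dfac_cong n).
rewrite big_mkord mulrC /euler_fin -big_split /=; apply: cong_prod => i.
exact: geom_cong.
Qed.

Lemma regular_series0 : coef regular_series 0 = 1.
Proof.
have := congr1 (fun x => coef x 0) regular_seriesM.
by rewrite coefM0 Vop_coef0 euler_coef0 mulr1.
Qed.

End RegularGenerating.

(** * From vanishing in F_m to congruences, and b_4 modulo 2 *)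

Lemma congruence_of_Fp k m A B : prime m -> (forall n, (b k (A * n + B))%:R = 0 :> 'F_m) ->
  ramanujan_congruence k m A B.
Proof.
move=> m_pr h n; apply/eqP; rewrite mod0n; change (m %| b k (A * n + B))%N.
by rewrite (dvdn_pcharf (pchar_Fp m_pr)) h.
Qed.

Lemma infinitely_many_of_one k m A B : (0 < A)%N -> ramanujan_congruence k m A B ->
  infinitely_many_ramanujan_congruences k m.
Proof.
move=> A0 h fin; apply: infinite_nat.
have hi : injective (fun j : nat => (A * j.+1, B)%N).
  by move=> i j [] /eqP; rewrite eqn_pmul2l // => /eqP [].
have := finite_preimage (f := fun j : nat => (A * j.+1, B)%N) (fun x y _ _ => @hi x y) fin.
apply: sub_finite_set => j _ /=; split; first by rewrite muln_gt0 A0.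
by move=> n; rewrite -mulnA; exact: h.
Qed.

(** Modulo 2, E(q^4)/E(q) = E(q)^3 = E(q^2) E(q). Completing squares in the two pentagonal
    exponents, an index 25 n + 23 asks for 2 X^2 + Y^2 = 600 n + 555. As -2 is not a square modulo
    5, both X and Y are divisible by 5, while 25 does not divide 555. *)
Lemma regular4_mod2 : ramanujan_congruence 4 2 25 23.
Proof.
apply: congruence_of_Fp => // n.
have p2 : prime 2 by [].
have e0 : euler 'F_2 != 0 by apply: series_neq0; rewrite euler_coef0 oner_eq0.
have e : regular_series 'F_2 4 = Vop 2 (euler 'F_2) * euler 'F_2.
  apply: (mulIf e0); rewrite regular_seriesM // -[4%N]/(2 * 2)%N -Vop_comp //.
  by rewrite -!(series_frobenius p2); ring.
transitivity (coef (regular_series 'F_2 4) (25 * n + 23)); first by [].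
rewrite e euler_pentagonal /pent_series gen_Vop // gen_mul; last 2 first.
- exact: proper_mul pent_proper.
- exact: pent_proper.
apply: fsum_set0 => -[x y] /= h.
have := pentE x; have := pentE y => hy hx.
have h2 : 2 * (6 * x + 1) ^+ 2 + (6 * y + 1) ^+ 2 = 600 * n%:Z + 555 by lia.
have [u [v [r [t [xE yE [r5 t5]]]]]] : exists u v (r t : int), [/\ 6 * x + 1 = 5 * u + r,
    6 * y + 1 = 5 * v + t & 0 <= r < 5 /\ 0 <= t < 5].
  exists (divz (6 * x + 1) 5), (divz (6 * y + 1) 5), (modz (6 * x + 1) 5), (modz (6 * y + 1) 5).
  by split; lia.
rewrite xE yE in h2.
have h3 : 2 * r ^+ 2 + t ^+ 2 =
    5 * (120 * n%:Z + 111 - 10 * u ^+ 2 - 4 * (u * r) - 5 * v ^+ 2 - 2 * (v * t)).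
  have -> : 2 * r ^+ 2 + t ^+ 2 = (2 * (5 * u + r) ^+ 2 + (5 * v + t) ^+ 2)
    - 5 * (10 * u ^+ 2 + 4 * (u * r) + 5 * v ^+ 2 + 2 * (v * t)) by ring.
  by rewrite h2; ring.
have [r0 t0] : r = 0 /\ t = 0.
  have : r = 0 \/ r = 1 \/ r = 2 \/ r = 3 \/ r = 4 by lia.
  have : t = 0 \/ t = 1 \/ t = 2 \/ t = 3 \/ t = 4 by lia.
  move: (120 * _ + _ - _ - _ - _ - _) h3 => Y h3.
  by move=> [|[|[|[|]]]] te [|[|[|[|]]]] re; move: h3; rewrite te re; lia.
subst r t; lia.
Qed.

(** * Degree bounds for polynomials *)

Section PolyDegree.
Variable F : fieldType.
Implicit Types P Q : {poly F}.

Definition deg_le d P := (size P <= d.+1)%N.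

Lemma deg_leW d d' P : (d <= d')%N -> deg_le d P -> deg_le d' P.
Proof. by rewrite /deg_le => h1 h2; apply: leq_trans h2 _. Qed.
Lemma deg_leM a c P Q : deg_le a P -> deg_le c Q -> deg_le (a + c) (P * Q).
Proof. by rewrite /deg_le => h1 h2; have := size_polyMleq P Q; lia. Qed.
Lemma deg_leX a k P : deg_le a P -> deg_le (k * a) (P ^+ k).
Proof.
move=> h; elim: k => [|k IH]; first by rewrite expr0 /deg_le size_poly1.
by rewrite exprS mulSn; exact: deg_leM.
Qed.
Lemma deg_leD a P Q : deg_le a P -> deg_le a Q -> deg_le a (P + Q).
Proof. by move=> h1 h2; apply: leq_trans (size_polyD _ _) _; rewrite geq_max; apply/andP. Qed.
Lemma deg_leN a P : deg_le a P -> deg_le a (- P).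
Proof. by rewrite /deg_le size_polyN. Qed.
Lemma deg_le_nat k a : deg_le a k%:R.
Proof. by rewrite /deg_le -polyC_natr; apply: leq_trans (size_polyC_leq1 _) _. Qed.
Lemma deg_le1 a : deg_le a 1. Proof. exact: deg_le_nat 1%N a. Qed.
Lemma deg_le_X : deg_le 1 'X. Proof. by rewrite /deg_le size_polyX. Qed.
Lemma deg_le_hasse n d P Q : deg_le d P -> deg_le d Q -> deg_le (n * d) (hasse n P Q).
Proof.
move=> hP hQ; rewrite /hasse; apply: (big_ind (deg_le (n * d))) => [|x y|j _].
- by rewrite /deg_le size_poly0.
- exact: deg_leD.
- have -> : (n * d = 0 + (n - j) * d + j * d)%N by rewrite add0n -mulnDl subnK // -ltnS.
  by apply: deg_leM; [apply: deg_leM; [exact: deg_le_nat|exact: deg_leX]|exact: deg_leX].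
Qed.

Lemma poly_divX P : P`_0 = 0 -> P = 'X * drop_poly 1 P.
Proof.
move=> h; apply/polyP => -[|i]; rewrite coefXM //= coef_drop_poly addn1 //.
Qed.

Lemma peval_hasse n P Q x : peval (hasse n P Q) x = hasse n (peval P x) (peval Q x).
Proof.
rewrite /hasse peval_sum; apply: eq_bigr => j _.
by rewrite !pevalM !pevalX peval_nat.
Qed.

End PolyDegree.

Lemma hasse_scale (R : comNzRingType) n (u x y : R) : hasse n (u * x) (u * y) = u ^+ n * hasse n x y.
Proof.
rewrite /hasse mulr_sumr; apply: eq_bigr => j _; rewrite !exprMn.
have -> : u ^+ n = u ^+ (n - j) * u ^+ j by rewrite -exprD subnK // -ltnS.
by ring.
Qed.

(** Since n (m + 1) = 4 s, the two sides are 32 s^2 + 11 s + 1 and 32 s^2 + 12 s + 1. This replaces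
    the condition at the cusp where alpha is infinite. *)
Lemma degree_bound4 m n s : m = (2 * n).+1 -> (m * m)%N = (8 * s).+1 -> (0 < s)%N ->
  ((m * m - s) * 1 + m.+1 * (m * m - 2) * (n * 1) + (m * m).-1 * 1 < m * m * (4 * s + 1))%N.
Proof.
move=> mn ms; have n4 : (n * m.+1 = 4 * s)%N by nia.
rewrite !muln1 mulnAC [(m.+1 * n)%N]mulnC n4 ms; case: s {ms n4} => // t _.
have -> : ((8 * t.+1).+1 - t.+1 = 7 * t + 8)%N by lia.
have -> : ((8 * t.+1).+1 - 2 = 8 * t + 7)%N by lia.
have -> : ((8 * t.+1).+1.-1 = 8 * t + 8)%N by lia.
lia.
Qed.

(** * The congruences for b_4 modulo odd primes *)

Section ModularFour.
Variable F : fieldType.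
Hypothesis F2 : 2 != 0 :> F.

(** At -q the generating function of b_4 is psi/phi. The two sides are compared after squaring,
    where [psi2_sqr] and the eta products apply; the constant terms select the root. *)
Lemma regular4_neg : 2 * neg_arg (regular_series F 4) * phi F = psi2 F.
Proof.
have F20 : 2%:R != 0 :> F by [].
have k4 : (0 < 4)%N by [].
have e20 : Vop 2 (euler F) != 0 by apply: series_neq0; rewrite Vop_coef0 euler_coef0 oner_eq0.
have ph0 : phi F != 0 by apply: series_neq0; rewrite (phi_coef0 F2) oner_eq0.
have h1 : neg_arg (regular_series F 4) * neg_arg (euler F) = Vop 4 (euler F).
  by rewrite -rmorphM regular_seriesM //= neg_arg_Vop_even.
have h2 : phi F * Vop 2 (euler F) = neg_arg (euler F) ^+ 2.
  by rewrite -rmorphXn -phi_neg_product rmorphM /= neg_argK neg_arg_Vop_even.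
have h4 : Vop 2 (psi2 F) * Vop 2 (euler F) = 2 * Vop 4 (euler F) ^+ 2.
  by rewrite -rmorphM psi2_product rmorphM rmorph_nat rmorphXn /= Vop_comp.
have c0 : coef (2 * neg_arg (regular_series F 4) * phi F) 0 = 2.
  by rewrite !coefM0 neg_arg_coef0 (regular_series0 F k4) (phi_coef0 F2) coef_natr /= !mulr1.
apply: (@series_expr_inj _ _ _ 2) => //.
- by rewrite c0 (psi2_coef0 F2).
- by rewrite c0.
have nz : phi F * Vop 2 (euler F) != 0 by rewrite mulf_neq0.
apply: (mulIf nz); transitivity (4 * phi F ^+ 2 * Vop 4 (euler F) ^+ 2).
  by rewrite h2 -h1; ring.
rewrite (psi2_sqr F2).
have -> : 2 * (phi F * Vop 2 (psi2 F)) * (phi F * Vop 2 (euler F)) =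
  2 * phi F ^+ 2 * (Vop 2 (psi2 F) * Vop 2 (euler F)) by ring.
by rewrite h4; ring.
Qed.

Lemma Vop_agm_c j : (0 < j)%N -> Vop (4 * j) (agm_c F) = (qpow F j * Vop (8 * j) (psi2 F)) ^+ 4.
Proof.
case: j => // j _; have e : (4 * j.+1 = (4 * j + 3).+1)%N by lia.
rewrite e /agm_c rmorphM rmorphXn /= Vop_qpow // Vop_comp // -e muln1 [RHS]exprMn -qpowM.
by have -> : (4 * j.+1 * 2 = 8 * j.+1)%N by lia.
Qed.

Lemma agm_ratio : exists al, al * agm_a F = agm_c F.
Proof.
exists (agm_c F / agm_a F); rewrite divrK // unit_series_coef0 (agm_a0 F2) oner_eq0 //.
Qed.

Lemma agm_a_neq0 : agm_a F != 0.
Proof. by apply: series_neq0; rewrite (agm_a0 F2) oner_eq0. Qed.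

Lemma agm_c_neq0 : agm_c F != 0.
Proof.
rewrite /agm_c mulf_neq0 //; last first.
  by rewrite expf_neq0 // series_neq0 // Vop_coef0 (psi2_coef0 F2).
apply/eqP => /(congr1 (fun x => coef x 1)) /= /eqP; rewrite oner_eq0 //.
Qed.

Lemma Dop_agm_ratio al : al * agm_a F = agm_c F -> Dop al = al * ((1 - al) * agm_a F).
Proof.
move=> alA; have := agm_derivative F2; rewrite -alA DopM => e.
have nz : agm_a F * agm_a F != 0 by rewrite mulf_neq0 ?agm_a_neq0.
apply: (mulfI nz).
transitivity (agm_a F * (Dop al * agm_a F + al * Dop (agm_a F)) - al * agm_a F * Dop (agm_a F)).
  by ring.
by rewrite e; ring.
Qed.

Lemma agm_ratio0 al : al * agm_a F = agm_c F -> coef al 0 = 0.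
Proof.
move=> /(congr1 (fun x => coef x 0)); rewrite coefM0 (agm_a0 F2) mulr1 => ->.
exact: agm_c0.
Qed.

Lemma agm_ratio_neq0 al : al * agm_a F = agm_c F -> al != 0.
Proof. by move=> e; apply: contra agm_c_neq0 => /eqP al0; rewrite -e al0 mul0r. Qed.

End ModularFour.

Section RegularFour.
Variable m : nat.
Hypotheses (m_pr : prime m) (m_odd : odd m).
Local Notation F := 'F_m.

Lemma Fp_two : 2 != 0 :> F.
Proof.
rewrite -(dvdn_pcharf (pchar_Fp m_pr)); apply/negP => /(dvdn_leq (isT : (0 < 2)%N)) h.
by have := prime_gt1 m_pr; move: m_odd h; lia.
Qed.
Let F2 := Fp_two.

(** For G equal to twice the series of b_4 at -q, q G^8 = 16 al and Frobenius give q^s V G = 16^s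
    al^s G, with V the substitution q -> q^(m^2). Multiplying by al^(m^2-s) completes al^s to a
    series in q^(m^2), so the extraction acts on a power of al alone, by [cartier_main] with W =
    phi^2 and the Hasse polynomial as K. *)
Lemma Uop_regular4 n s al : m = (2 * n).+1 -> (m * m)%N = (8 * s).+1 -> al * agm_a F = agm_c F ->
  exists Q : {poly F}, (size Q <= 4 * s)%N /\
  16 ^+ s * Uop (m * m) s (2 * neg_arg (regular_series F 4)) =
  2 * neg_arg (regular_series F 4) * (phi F ^+ 2) ^+ (m * m).-1 * peval Q al.
Proof.
move=> mn ms alA; have := regular4_neg F2.
move: (2 * neg_arg (regular_series F 4)) => G Gphi.
have s0 : (0 < s)%N by have := prime_gt1 m_pr; nia.
have al0 : al != 0 := agm_ratio_neq0 F2 alA.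
have ph0 : phi F ^+ 8 != 0 by rewrite expf_neq0 // series_neq0 // (phi_coef0 F2) oner_eq0.
have qG8 : qpow F 1 * G ^+ 8 = 16 * al.
  apply: (mulIf ph0); transitivity (qpow F 1 * (psi2 F ^+ 2) ^+ 4); first by rewrite -Gphi; ring.
  rewrite (psi2_sqr F2); have -> : 16 * al * phi F ^+ 8 = 16 * (al * agm_a F) * phi F ^+ 4.
    by rewrite /agm_a; ring.
  by rewrite alA /agm_c; ring.
have qs : qpow F s = qpow F 1 ^+ s by rewrite -qpowM muln1.
have V1 : qpow F s * Vop (m * m) G = 16 ^+ s * (al ^+ s * G).
  rewrite -(frobenius2 m_pr) ms exprS exprM qs mulrCA -exprMn qG8 exprMn.
  by rewrite [RHS]mulrA [RHS]mulrC.
have sM : (s < m * m)%N by lia.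
have e : qpow F s * (Vop (m * m) G * al ^+ (m * m - s)) = const (16 ^+ s) * (Vop (m * m) al * G).
  rewrite mulrA V1 -(frobenius2 m_pr) rmorphXn /= const_natr -{2}(subnKC (ltnW sM)) exprD.
  by move: (al ^+ s) (al ^+ (m * m - s)) (16 ^+ s) => a1 a2 a3; ring.
have := congr1 (Uop (m * m) s) e.
rewrite Uop_qpowM Uop_VopM; last by lia.
rewrite Uop_constM Uop_VopM // rmorphXn /= const_natr.
have l1 : peval (1 - 'X) al = 1 - al.
  by rewrite pevalD /peval rmorph1 -polyC1 hornerC rmorphN /= map_polyX hornerN hornerX.
have Dal : Dop al = al * (peval (1 - 'X) al * (phi F ^+ 2) ^+ 2).
  by rewrite (Dop_agm_ratio F2 alA) l1 -exprM.
have WK : (phi F ^+ 2) ^+ m.-1 * peval (hasse n 1 'X) al = 1.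
  rewrite -[RHS](hasse_agm m_pr mn) -alA [al * _]mulrC -{1}[agm_a F]mulr1 hasse_scale.
  rewrite peval_hasse peval_X peval_1; congr (_ * _).
  by rewrite /agm_a -!exprM; congr (_ ^+ _); lia.
have nz : peval (1 - 'X) al * (phi F ^+ 2) ^+ 2 != 0.
  apply: series_neq0; rewrite l1 -exprM -/(agm_a F) coefM0 (agm_a0 F2) mulr1 coefBs (agm_ratio0 F2 alA).
  by rewrite subr0 oner_eq0.
have -> : al ^+ (m * m - s) = peval 'X^(m * m - s) al by rewrite pevalX peval_X.
rewrite (cartier_main m_pr _ al0 Dal WK nz).
set P := _ * _ ^+ (m * m).-1.
(* As s < m^2 the polynomial vanishes at 0, which yields the factor [al] to be cancelled. *)
have P0 : (Upoly2 P)`_0 = 0.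
  rewrite coef0_Upoly2 // -horner_coef0 /P !hornerM hornerXn expr0n (_ : _ == _ = false) ?mul0r //.
  by apply/negbTE; rewrite subn_eq0 -ltnNge.
rewrite {1}(poly_divX P0) pevalM peval_X => h.
exists (drop_poly 1 (Upoly2 P)); split.
  rewrite size_drop_poly leq_subLR add1n -addn1; apply: size_Upoly2 => //.
  have dK : deg_le (n * 1) (hasse n 1 'X : {poly F}).
    by apply: deg_le_hasse; [exact: deg_le1|exact: deg_le_X].
  have dX : deg_le ((m * m - s) * 1) ('X^(m * m - s) : {poly F}) by apply: deg_leX; exact: deg_le_X.
  have dl : deg_le 1 (1 - 'X : {poly F}).
    by apply: deg_leD; [exact: deg_le1|apply: deg_leN; exact: deg_le_X].
  have := deg_leM (deg_leM dX (deg_leX (m.+1 * (m * m - 2)) dK)) (deg_leX (m * m).-1 dl).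
  rewrite -/P /deg_le => hd; apply: leq_trans hd _.
  exact: degree_bound4.
apply: (mulfI al0).
rewrite mulrCA -h; move: (_ ^+ (m * m).-1) (peval _ _) => a1 a2; ring.
Qed.

Lemma neg_argE (x : series F) i : coef (neg_arg x) i = (-1) ^+ i * coef x i.
Proof. by []. Qed.

Lemma regular4_progression : exists A B, (0 < A)%N /\ forall i, (b 4 (A * i + B))%:R = 0 :> F.
Proof.
have [n mn] : exists n, m = (2 * n).+1 by exists m./2; lia.
have [s ms] : exists s, (m * m)%N = (8 * s).+1.
  have [t tE] : exists t, (n * n.+1 = 2 * t)%N.
    exists (n * n.+1)./2; have h : odd (n * n.+1) = false by rewrite oddM /= andbN.
    by rewrite -[LHS]odd_double_half h add0n mul2n.
  by exists t; nia.
have m1 := prime_gt1 m_pr.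
have [al alA] := agm_ratio F2.
have [Q [sQ UQ]] := Uop_regular4 mn ms alA.
(* An odd prime with p and p - 1 nonzero modulo m: 3 works unless m = 3, where 5 does. *)
have [p [p_pr p_odd p8 p2 [p1F pF]]] : exists p, [/\ prime p, odd p, coprime p 8, (~~ (p %| 2))%N
    & p.-1%:R != 0 :> F /\ p%:R != 0 :> F].
  have nzF k : ~~ (m %| k)%N -> k%:R != 0 :> F by rewrite (dvdn_pcharf (pchar_Fp m_pr)).
  have [m3|m3] := eqVneq m 3%N.
    by exists 5%N; split => //; split; apply: nzF; rewrite m3.
  by exists 3%N; split => //; split; apply: nzF; rewrite dvdn_prime2 //; lia.
have p0 : p = 1 %[mod 2] by rewrite !modn2 p_odd.
have pd k : ~~ (p %| 2 ^ k)%N.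
  by apply: contra p2 => h; have := h; rewrite Euclid_dvdX // => /andP[].
have tl : theta_like p 2 (qpow F 1 * Vop 8 (16 ^+ s * Uop (m * m) s (2 * neg_arg (regular_series F 4)))).
  rewrite UQ (pevalE _ sQ) mulr_sumr rmorph_sum mulr_sumr big_nat /=.
  apply: theta_like_sum => i i4.
  have Gphi := regular4_neg F2.
  (* One factor phi turns the series of b_4 into [psi2], and 4 i of them turn al^i into a power of
     [agm_c]. Enough remain because i < 4 s and m^2 = 8 s + 1. *)
  have -> : 2 * neg_arg (regular_series F 4) * (phi F ^+ 2) ^+ (m * m).-1 * (const Q`_i * al ^+ i) =
     const Q`_i * (phi F ^+ (2 * (m * m) - 3 - 4 * i) * (agm_c F ^+ i * psi2 F)).
    rewrite -alA -Gphi /agm_a (exprMn i al) -!exprM.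
    have -> : (2 * (m * m).-1 = (2 * (m * m) - 3 - 4 * i) + 4 * i + 1)%N by lia.
    rewrite !exprD expr1.
    move: (phi F ^+ (2 * (m * m) - 3 - 4 * i)) (phi F ^+ (4 * i)) (al ^+ i) => a1 a2 a3; ring.
  have -> : qpow F 1 * Vop 8 (const Q`_i * (phi F ^+ (2 * (m * m) - 3 - 4 * i) * (agm_c F ^+ i * psi2 F))) =
     const Q`_i * (Vop 8 (phi F) ^+ (2 * (m * m) - 3 - 4 * i) *
       ((qpow F 2 * Vop (8 * 2) (psi2 F)) ^+ (4 * i) * (qpow F 1 * Vop (8 * 1) (psi2 F)))).
    have c8 : Vop 8 (agm_c F) = (qpow F 2 * Vop (8 * 2) (psi2 F)) ^+ 4 := @Vop_agm_c _ F2 2 isT.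
    rewrite !rmorphM !rmorphXn /= c8 Vop_const -exprM muln1.
    move: (_ ^+ (4 * i)) (_ ^+ (_ - _)) => a1 a2; ring.
  apply: theta_likeZ; apply: theta_likeXM => //.
    by apply: theta_like_phi => //; exact: (pd 3%N).
  apply: theta_likeXM => //; first exact: theta_like_psi2.
  by apply: theta_like_psi2 => //; rewrite dvdn1; case: (p) p_pr => [|[]].
have [A [B [A0 h]]] := theta_like_progression p_pr p_odd (isT : (0 < 2)%N) p0 p1F pF (isT : (0 < 8)%N) p8 tl.
exists (m * m * A)%N, (m * m * B + s)%N; split; first by rewrite !muln_gt0 A0 andbT; lia.
move=> i; have := h i.
have -> : 16 ^+ s * Uop (m * m) s (2 * neg_arg (regular_series F 4)) =
   const (16 ^+ s * 2) * Uop (m * m) s (neg_arg (regular_series F 4)).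
  have -> : 2 * neg_arg (regular_series F 4) = const 2 * neg_arg (regular_series F 4) by rewrite const_natr.
  by rewrite Uop_constM (rmorphM (@const F)) (rmorphXn (@const F)) /= !const_natr mulrA.
rewrite coef_constM coefUop neg_argE => /eqP; rewrite !mulf_eq0 signr_eq0 (negbTE F2) orbF /=.
have -> : 16 ^+ s == 0 :> F = false.
  apply/negbTE; rewrite expf_neq0 //; have -> : 16 = 2 ^+ 4 :> F by rewrite -natrX.
  by rewrite expf_neq0.
rewrite /= => /eqP <-; congr (b 4 _)%:R; lia.
Qed.

End RegularFour.

(** * Algebra of the cubic modular equation *)

Section AlgebraSix.
Variables (R : idomainType) (al be u p : R).
Hypotheses (two0 : 2 != 0 :> R) (H1 : al * be = u ^+ 4)
  (H2 : (1 - al) * (1 - be) = (1 - u) ^+ 4)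
  (HR : (p + 1 - u) * (4 * u * (1 - u)) = al - be) (nz : 4 * u * (1 - u) != 0).
Lemma six_sum : al + be = 4 * u - 6 * u ^+ 2 + 4 * u ^+ 3.
Proof.
have -> : al + be = 1 + al * be - (1 - al) * (1 - be) by ring.
by rewrite H1 H2; ring.
Qed.
(** The sum and the product of al and be determine (al - be)^2, hence R = p + 1 - u satisfies R^2 =
    1 - u + u^2. Substituting for R gives an equation linear in u. *)
Lemma six_uy : u * (1 + 2 * p) = p * (2 + p).
Proof.
have sq : (al - be) ^+ 2 = (4 * u * (1 - u)) ^+ 2 * (1 - u + u ^+ 2).
have -> : (al - be) ^+ 2 = (al + be) ^+ 2 - 4 * (al * be) by ring.
by rewrite six_sum H1; ring.
have R2 : (p + 1 - u) ^+ 2 = 1 - u + u ^+ 2.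
have nz2 : (4 * u * (1 - u)) ^+ 2 != 0 by rewrite expf_neq0.
by apply: (mulfI nz2); rewrite -sq -HR; ring.
apply/eqP; rewrite -subr_eq0.
have -> : u * (1 + 2 * p) - p * (2 + p) = (1 - u + u ^+ 2) - (p + 1 - u) ^+ 2 by ring.
by rewrite R2 subrr.
Qed.
(** With [six_be] this is Ramanujan's rational parametrisation in degree 3; al and be are recovered
    from their sum and difference. *)
Lemma six_al : al * (1 + 2 * p) ^+ 3 = p * (2 + p) ^+ 3.
Proof.
have al2 : 2 * al = (4 * u - 6 * u ^+ 2 + 4 * u ^+ 3) + (p + 1 - u) * (4 * u * (1 - u)).
by rewrite -six_sum HR; ring.
apply: (mulfI two0); transitivity (2 * al * (1 + 2 * p) ^+ 3); first by ring.
rewrite al2; transitivity (2 * ((u * (1 + 2 * p)) * ((4 + 2 * p) * (1 + 2 * p) ^+ 2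
  - (7 + 2 * p) * (u * (1 + 2 * p)) * (1 + 2 * p) + 4 * (u * (1 + 2 * p)) ^+ 2))); first by ring.
by rewrite six_uy; ring.
Qed.
Lemma six_be : be * (1 + 2 * p) = p ^+ 3 * (2 + p).
Proof.
have be2 : 2 * be = (4 * u - 6 * u ^+ 2 + 4 * u ^+ 3) - (p + 1 - u) * (4 * u * (1 - u)).
by rewrite -six_sum HR; ring.
apply: (mulfI two0); transitivity (2 * be * (1 + 2 * p)); first by ring.
rewrite be2; transitivity (2 * ((u * (1 + 2 * p)) * (u * (1 + 2 * p) - 2 * p))); first by ring.
by rewrite six_uy; ring.
Qed.
Lemma six_al1 : (1 - al) * (1 + 2 * p) ^+ 3 = (1 + p) * (1 - p) ^+ 3.
Proof.
transitivity ((1 + 2 * p) ^+ 3 - al * (1 + 2 * p) ^+ 3); first by ring.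
by rewrite six_al; ring.
Qed.
Lemma six_be1 : (1 - be) * (1 + 2 * p) = (1 + p) ^+ 3 * (1 - p).
Proof.
transitivity ((1 + 2 * p) - be * (1 + 2 * p)); first by ring.
by rewrite six_be; ring.
Qed.
End AlgebraSix.
Section EtaAlgebra.
Variables (R : idomainType) (q e1 e2 e3 e4 e6 e12 : R).
Hypotheses (q0 : q != 0) (n16 : 16 != 0 :> R) (n1 : e1 != 0) (n2 : e2 != 0) (n3 : e3 != 0)
  (n4 : e4 != 0) (n6 : e6 != 0) (n12 : e12 != 0).

(** Throughout these identities e_k stands for Euler's product at q^k. Eighth powers appear because
    the parametrisation expresses the eighth powers of p, 2 + p, 1 - p and 1 + p through al, be and
    y. *)
Lemma eta_algebra_p p0 al be : (q * p0) ^+ 8 * al = be ^+ 3 ->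
  al * e2 ^+ 24 = 16 * (q * (e1 ^+ 8 * e4 ^+ 16)) ->
  be * e6 ^+ 24 = 16 * (q ^+ 3 * (e3 ^+ 8 * e12 ^+ 16)) ->
  (p0 * (e6 ^+ 9 * e1 * e4 ^+ 2)) ^+ 8 = (2 * (e3 ^+ 3 * e12 ^+ 6 * e2 ^+ 3)) ^+ 8.
Proof.
move=> p8 hal hbe; have nz : 16 * q ^+ 9 != 0 by rewrite mulf_neq0 ?expf_neq0.
apply: (mulfI nz); transitivity ((q * p0) ^+ 8 * (al * e2 ^+ 24) * e6 ^+ 72).
  by rewrite hal; ring.
transitivity ((q * p0) ^+ 8 * al * e2 ^+ 24 * e6 ^+ 72); first by ring.
rewrite p8; transitivity ((be * e6 ^+ 24) ^+ 3 * e2 ^+ 24); first by ring.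
by rewrite hbe; ring.
Qed.

Lemma eta_algebra_p2 a al be y : a ^+ 8 * be = al ^+ 3 * y ^+ 8 ->
  al * e2 ^+ 24 = 16 * (q * (e1 ^+ 8 * e4 ^+ 16)) ->
  be * e6 ^+ 24 = 16 * (q ^+ 3 * (e3 ^+ 8 * e12 ^+ 16)) ->
  y * (e6 ^+ 10 * e1 ^+ 4 * e4 ^+ 4) = e2 ^+ 10 * e3 ^+ 4 * e12 ^+ 4 ->
  (a * (e6 ^+ 7 * e1)) ^+ 8 = (2 * (e4 ^+ 2 * e2 * e3 ^+ 3 * e12 ^+ 2)) ^+ 8.
Proof.
move=> p8 hal hbe hy.
have nz : 16 * (q ^+ 3 * (e3 ^+ 8 * e12 ^+ 16)) * (e2 ^+ 72 * (e1 ^+ 24 * e4 ^+ 32)) != 0.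
  by rewrite !mulf_neq0 ?expf_neq0.
apply: (mulfI nz).
transitivity (a ^+ 8 * (be * e6 ^+ 24) * (e2 ^+ 72 * e6 ^+ 56 * e1 ^+ 32 * e4 ^+ 32)).
  by rewrite hbe; ring.
transitivity (a ^+ 8 * be * (e2 ^+ 72 * e6 ^+ 80 * e1 ^+ 32 * e4 ^+ 32)); first by ring.
rewrite p8; transitivity ((al * e2 ^+ 24) ^+ 3 * (y * (e6 ^+ 10 * e1 ^+ 4 * e4 ^+ 4)) ^+ 8).
  by ring.
by rewrite hal hy; ring.
Qed.

Lemma eta_algebra_pm a al be y : a ^+ 8 * be = al ^+ 3 * y ^+ 8 ->
  al * e2 ^+ 24 = e1 ^+ 16 * e4 ^+ 8 -> be * e6 ^+ 24 = e3 ^+ 16 * e12 ^+ 8 ->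
  y * (e6 ^+ 10 * e1 ^+ 4 * e4 ^+ 4) = e2 ^+ 10 * e3 ^+ 4 * e12 ^+ 4 ->
  (a * (e6 ^+ 7 * e4)) ^+ 8 = (e1 ^+ 2 * e2 * e3 ^+ 2 * e12 ^+ 3) ^+ 8.
Proof.
move=> p8 hal hbe hy.
have nz : e3 ^+ 16 * e12 ^+ 8 * (e2 ^+ 72 * (e1 ^+ 32 * e4 ^+ 24)) != 0.
  by rewrite !mulf_neq0 ?expf_neq0.
apply: (mulfI nz).
transitivity (a ^+ 8 * (be * e6 ^+ 24) * (e2 ^+ 72 * e6 ^+ 56 * e1 ^+ 32 * e4 ^+ 32)).
  by rewrite hbe; ring.
transitivity (a ^+ 8 * be * (e2 ^+ 72 * e6 ^+ 80 * e1 ^+ 32 * e4 ^+ 32)); first by ring.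
rewrite p8; transitivity ((al * e2 ^+ 24) ^+ 3 * (y * (e6 ^+ 10 * e1 ^+ 4 * e4 ^+ 4)) ^+ 8).
  by ring.
by rewrite hal hy; ring.
Qed.

Lemma eta_algebra_p1 a al be : a ^+ 8 * al = be ^+ 3 ->
  al * e2 ^+ 24 = e1 ^+ 16 * e4 ^+ 8 -> be * e6 ^+ 24 = e3 ^+ 16 * e12 ^+ 8 ->
  (a * (e1 ^+ 2 * e4 * e6 ^+ 9)) ^+ 8 = (e3 ^+ 6 * e12 ^+ 3 * e2 ^+ 3) ^+ 8.
Proof.
move=> p8 hal hbe; transitivity (a ^+ 8 * (al * e2 ^+ 24) * e6 ^+ 72); first by rewrite hal; ring.
transitivity (a ^+ 8 * al * e2 ^+ 24 * e6 ^+ 72); first by ring.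
rewrite p8; transitivity ((be * e6 ^+ 24) ^+ 3 * e2 ^+ 24); first by ring.
by rewrite hbe; ring.
Qed.

(** The letters p, a, d, c, z stand for p, 2 + p, 1 - p, 1 + p and 1 + 2p. Their exponents are those
    for which all Euler products cancel against G^24 = (e6/e1)^24. *)
Lemma eta_algebra_pow G p a d c z : G * e1 = e6 ->
  p * (e6 ^+ 9 * e1 * e4 ^+ 2) = q * (2 * (e3 ^+ 3 * e12 ^+ 6 * e2 ^+ 3)) ->
  a * (e6 ^+ 7 * e1) = 2 * (e4 ^+ 2 * e2 * e3 ^+ 3 * e12 ^+ 2) ->
  d * (e6 ^+ 7 * e4) = e1 ^+ 2 * e2 * e3 ^+ 2 * e12 ^+ 3 ->
  c * (e1 ^+ 2 * e4 * e6 ^+ 9) = e3 ^+ 6 * e12 ^+ 3 * e2 ^+ 3 ->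
  z * (e6 ^+ 10 * e1 ^+ 4 * e4 ^+ 4) = e2 ^+ 10 * e3 ^+ 4 * e12 ^+ 4 ->
  16 * (q ^+ 5 * (G ^+ 24 * (a * d ^+ 10 * z))) = p ^+ 5 * c ^+ 2.
Proof.
move=> hG hp ha hd hc hz.
have nz : (e1 ^+ 24 * (e6 ^+ 7 * e1) * (e6 ^+ 7 * e4) ^+ 10 * (e6 ^+ 10 * e1 ^+ 4 * e4 ^+ 4)) *
    ((e6 ^+ 9 * e1 * e4 ^+ 2) ^+ 5 * (e1 ^+ 2 * e4 * e6 ^+ 9) ^+ 2) != 0.
  by rewrite !mulf_neq0 // expf_neq0 // ?mulf_neq0 ?expf_neq0.
apply: (mulIf nz).
transitivity (16 * q ^+ 5 * ((G * e1) ^+ 24 * (a * (e6 ^+ 7 * e1)) * (d * (e6 ^+ 7 * e4)) ^+ 10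
  * (z * (e6 ^+ 10 * e1 ^+ 4 * e4 ^+ 4))) *
    ((e6 ^+ 9 * e1 * e4 ^+ 2) ^+ 5 * (e1 ^+ 2 * e4 * e6 ^+ 9) ^+ 2)); first by ring.
transitivity ((p * (e6 ^+ 9 * e1 * e4 ^+ 2)) ^+ 5 * (c * (e1 ^+ 2 * e4 * e6 ^+ 9)) ^+ 2 *
  (e1 ^+ 24 * (e6 ^+ 7 * e1) * (e6 ^+ 7 * e4) ^+ 10 * (e6 ^+ 10 * e1 ^+ 4 * e4 ^+ 4))); last by ring.
by rewrite hG ha hd hz hp hc; ring.
Qed.

Lemma eta_algebra_borwein G f3 a d s B : G * e1 = e6 ->
  f3 * (e3 ^+ 2 * e12 ^+ 2) = e6 ^+ 5 ->
  a * (e6 ^+ 7 * e1) = 2 * (e4 ^+ 2 * e2 * e3 ^+ 3 * e12 ^+ 2) ->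
  d * (e6 ^+ 7 * e4) = e1 ^+ 2 * e2 * e3 ^+ 2 * e12 ^+ 3 ->
  s * e1 = 2 * e2 ^+ 2 -> e1 ^+ 3 = e3 * B ->
  G * f3 ^+ 4 * (a * d ^+ 2) = s * e2 * B.
Proof.
move=> hG hf ha hd hs hB.
have nz : e1 * (e3 ^+ 2 * e12 ^+ 2) ^+ 4 * (e6 ^+ 7 * e1) * (e6 ^+ 7 * e4) ^+ 2 * e3 != 0.
  by rewrite !mulf_neq0 // expf_neq0 // ?mulf_neq0 ?expf_neq0.
apply: (mulIf nz).
transitivity ((G * e1) * (f3 * (e3 ^+ 2 * e12 ^+ 2)) ^+ 4 * (a * (e6 ^+ 7 * e1))
  * (d * (e6 ^+ 7 * e4)) ^+ 2 * e3); first by ring.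
transitivity ((s * e1) * e2 * (e3 * B) *
  ((e3 ^+ 2 * e12 ^+ 2) ^+ 4 * (e6 ^+ 7 * e1) * (e6 ^+ 7 * e4) ^+ 2)); last by ring.
by rewrite hG hf ha hd hs -hB; ring.
Qed.

Lemma eta_algebra_borwein4 G f3 a d s B : G * e1 = e6 ->
  f3 * (e3 ^+ 2 * e12 ^+ 2) = e6 ^+ 5 ->
  a * (e6 ^+ 7 * e1) = 2 * (e4 ^+ 2 * e2 * e3 ^+ 3 * e12 ^+ 2) ->
  d * (e6 ^+ 7 * e4) = e1 ^+ 2 * e2 * e3 ^+ 2 * e12 ^+ 3 ->
  s * e1 = 2 * e2 ^+ 2 -> e4 ^+ 3 = e12 * B ->
  G * f3 ^+ 4 * (a ^+ 2 * d) = 2 * (s * e2 * B).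
Proof.
move=> hG hf ha hd hs hB.
have nz : e1 * (e3 ^+ 2 * e12 ^+ 2) ^+ 4 * (e6 ^+ 7 * e1) ^+ 2 * (e6 ^+ 7 * e4) * e12 != 0.
  by rewrite !mulf_neq0 // expf_neq0 // ?mulf_neq0 ?expf_neq0.
apply: (mulIf nz).
transitivity ((G * e1) * (f3 * (e3 ^+ 2 * e12 ^+ 2)) ^+ 4 * (a * (e6 ^+ 7 * e1)) ^+ 2
  * (d * (e6 ^+ 7 * e4)) * e12); first by ring.
transitivity (2 * (s * e1) * e2 * (e12 * B) *
  ((e3 ^+ 2 * e12 ^+ 2) ^+ 4 * (e6 ^+ 7 * e1) ^+ 2 * (e6 ^+ 7 * e4))); last by ring.
by rewrite hG hf ha hd hs -hB; ring.
Qed.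

End EtaAlgebra.

(** * The level six parameter and its eta quotients *)

Section SixGeneral.
Variable F : fieldType.
Hypotheses (F2 : 2 != 0 :> F) (F3 : 3 != 0 :> F).
Local Notation f := (phi F).
Local Notation f3 := (Vop 3 (phi F)).
Local Notation nf := (neg_arg (phi F)).
Local Notation A := (agm_a F).
Local Notation C := (agm_c F).
Local Notation A3 := (Vop 3 (agm_a F)).
Local Notation C3 := (Vop 3 (agm_c F)).
Local Notation q := (qpow F 1).
Local Notation X := (Vop 2 (psi2 F) * Vop 6 (psi2 F)).
Local Notation e1 := (euler F).
Local Notation e2 := (Vop 2 (euler F)).
Local Notation e3 := (Vop 3 (euler F)).
Local Notation e4 := (Vop 4 (euler F)).
Local Notation e6 := (Vop 6 (euler F)).
Local Notation e12 := (Vop 12 (euler F)).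
Lemma natr_series_neq0 k : k%:R != 0 :> F -> k%:R != 0 :> series F.
Proof.
by move=> h; apply: series_neq0; rewrite coef_natr.
Qed.
Lemma qpow1_neq0 : q != 0.
Proof.
by apply/eqP => /(congr1 (fun x => coef x 1)) /= /eqP; rewrite oner_eq0.
Qed.
Lemma pow2_neq0 k : (2 ^ k)%:R != 0 :> F.
Proof.
by rewrite natrX expf_neq0.
Qed.
Lemma Vop_euler_neq0 k : Vop k (euler F) != 0.
Proof.
by apply: series_neq0; rewrite Vop_coef0 euler_coef0 oner_eq0.
Qed.
Lemma euler_neq0 : euler F != 0.
Proof.
by apply: series_neq0; rewrite euler_coef0 oner_eq0.
Qed.
Lemma phi_neq0 : f != 0.
Proof.
by apply: series_neq0; rewrite (phi_coef0 F2) oner_eq0.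
Qed.
Lemma psi2_eta2 : Vop 2 (psi2 F) * e2 = 2 * e4 ^+ 2.
Proof.
by rewrite -rmorphM psi2_product rmorphM rmorph_nat rmorphXn /= Vop_comp.
Qed.
(** The factorisation phi(q)^2 phi(-q)^2 = P^2 - K^2 = phi(-q^2)^4, with a root fixed by constant
    terms, reduces the formula to the product for phi(-q). *)
Lemma phi_eta : f * (e1 ^+ 2 * e4 ^+ 2) = e2 ^+ 5.
Proof.
have nfe := phi_neg_product F.
have nfe2 : Vop 2 nf * e4 = e2 ^+ 2.
by have := congr1 (Vop 2) nfe; rewrite rmorphM rmorphXn /= Vop_comp.
have vb : Vop 2 nf ^+ 4 = (Vop 2 f ^+ 2) ^+ 2 - (q * Vop 4 (psi2 F) ^+ 2) ^+ 2.
by rewrite -rmorphXn -(agm_bE F2) rmorphB /= Vop2_agm_a Vop2_agm_c.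
have fnf : f * nf = Vop 2 nf ^+ 2.
have c1 : coef (f * nf) 0 = 1 by rewrite coefM0 neg_arg_coef0 (phi_coef0 F2) mulr1.
apply: (@series_expr_inj _ _ _ 2) => //.
- by rewrite c1 coefX0 Vop_coef0 neg_arg_coef0 (phi_coef0 F2) expr1n.
- by rewrite c1 oner_eq0.
- rewrite exprMn (phi2E F2) (phi2E_neg F2); transitivity (Vop 2 nf ^+ 4); last by ring.
by rewrite vb; ring.
rewrite -nfe; transitivity (f * nf * e4 ^+ 2 * e2); first by ring.
rewrite fnf; transitivity ((Vop 2 nf * e4) ^+ 2 * e2); first by ring.
by rewrite nfe2; ring.
Qed.
Lemma Vop_mulX k (x z : series F) a : Vop k.+1 (x * z ^+ a) = Vop k.+1 x * Vop k.+1 z ^+ a.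
Proof.
by rewrite rmorphM rmorphXn.
Qed.
Lemma Vop_mulXX k (x z t : series F) a c :
  Vop k.+1 (x * (z ^+ a * t ^+ c)) = Vop k.+1 x * (Vop k.+1 z ^+ a * Vop k.+1 t ^+ c).
Proof.
by rewrite !rmorphM !rmorphXn.
Qed.
Lemma Vop_natMXX k n (x z t : series F) a c : Vop k.+1 (n%:R * (x * (z ^+ a * t ^+ c))) =
  n%:R * (Vop k.+1 x * (Vop k.+1 z ^+ a * Vop k.+1 t ^+ c)).
Proof.
by rewrite !rmorphM !rmorphXn rmorph_nat.
Qed.
Lemma Vop_XX k (z t : series F) a c : Vop k.+1 (z ^+ a * t ^+ c) = Vop k.+1 z ^+ a * Vop k.+1 t ^+ c.
Proof. by rewrite rmorphM !rmorphXn. Qed.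

Lemma Vop_compS j k (x : series F) : Vop j (Vop k.+1 x) = Vop (j * k.+1) x.
Proof. exact: Vop_comp. Qed.

Lemma VopX k (x : series F) n : Vop k.+1 (x ^+ n) = Vop k.+1 x ^+ n.
Proof. by rewrite rmorphXn. Qed.

Lemma VopMS k (x z : series F) : Vop k.+1 (x * z) = Vop k.+1 x * Vop k.+1 z.
Proof. by rewrite rmorphM. Qed.

Lemma Vop3_e2 : Vop 3 e2 = e6. Proof. exact: (Vop_compS 3 1 (euler F)). Qed.
Lemma Vop3_e4 : Vop 3 e4 = e12. Proof. exact: (Vop_compS 3 3 (euler F)). Qed.

Lemma phi_eta3 : f3 * (e3 ^+ 2 * e12 ^+ 2) = e6 ^+ 5.
Proof.
rewrite -Vop3_e2 -Vop3_e4.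
exact: etrans (esym (Vop_mulXX 2 f e1 e4 2 2)) (etrans (congr1 (Vop 3) phi_eta) (VopX 2 e2 5)).
Qed.
Lemma euler_cube : e1 ^+ 3 = e3 * borwein_b F.
Proof.
by rewrite !euler_pentagonal (pent_cube F2).
Qed.
Lemma euler_cube4 : e4 ^+ 3 = e12 * Vop 4 (borwein_b F).
Proof.
have <- : Vop 4 e3 = e12 := Vop_compS 4 2 (euler F).
exact: etrans (esym (VopX 3 e1 3)) (etrans (congr1 (Vop 4) euler_cube) (VopMS 3 e3 (borwein_b F))).
Qed.
Lemma agm_b3 : A3 - C3 = Vop 3 nf ^+ 4.
Proof.
by rewrite -rmorphB (agm_bE F2) rmorphXn.
Qed.
Lemma agm_a3E : A3 = f3 ^+ 4.
Proof.
by rewrite /agm_a rmorphXn.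
Qed.
Lemma qpow3E : qpow F 3 = q ^+ 3.
Proof.
by rewrite -qpowM.
Qed.
Lemma agm_c3E : C3 = q ^+ 3 * Vop 6 (psi2 F) ^+ 4.
Proof.
by rewrite -qpow3E /agm_c rmorphM rmorphXn /= Vop_qpow // Vop_comp.
Qed.
Section SixParameter.
Variables al u u0 p p0 w : series F.
Hypotheses (alA : al * A = C) (u0X : u0 * (f * f3) = X) (uq : u = q * u0) (pq : p = q * p0)
  (pR : (p + 1 - u) * (4 * u * (1 - u)) = al - Vop 3 al) (wphi : w * f = f3 ^+ 3).
Local Notation be := (Vop 3 al).
Local Notation y := (1 + 2 * p).
Lemma beA3 : be * A3 = C3.
Proof.
by rewrite -rmorphM alA.
Qed.
Lemma A3_neq0 : A3 != 0.
Proof.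
by apply: series_neq0; rewrite Vop_coef0 (agm_a0 F2) oner_eq0.
Qed.
Lemma ratio_prod : al * be = u ^+ 4.
Proof.
have nz : A * A3 != 0 by rewrite mulf_neq0 ?A3_neq0 ?agm_a_neq0.
apply: (mulIf nz); transitivity (C * C3); first by rewrite -beA3 -alA; ring.
transitivity (q ^+ 4 * (u0 * (f * f3)) ^+ 4); last by rewrite uq agm_a3E /agm_a; ring.
by rewrite u0X agm_c3E /agm_c; ring.
Qed.
(** With [ratio_prod] this is the cubic modular equation. The dissection [phi_phi3_odd] says that 1
    - u is the quotient of phi(-q) phi(-q^3) by phi(q) phi(q^3), and the fourth powers of these are
    the complementary forms. *)
Lemma ratio_coprod : (1 - al) * (1 - be) = (1 - u) ^+ 4.
Proof.
have nz : A * A3 != 0 by rewrite mulf_neq0 ?A3_neq0 ?agm_a_neq0.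
have uff : u * (f * f3) = f * f3 - nf * Vop 3 nf.
by rewrite uq -mulrA u0X -(phi_phi3_odd F2) rmorphM /= neg_arg_Vop_odd.
apply: (mulIf nz); transitivity ((nf * Vop 3 nf) ^+ 4).
transitivity ((A - al * A) * (A3 - be * A3)); first by ring.
by rewrite alA beA3 (agm_bE F2) agm_b3; ring.
transitivity ((f * f3 - u * (f * f3)) ^+ 4); last by rewrite agm_a3E /agm_a; ring.
by rewrite uff; ring.
Qed.
Lemma u_coef0 : coef u 0 = 0.
Proof.
by rewrite uq coef_qpowM.
Qed.
Lemma p_coef0 : coef p 0 = 0.
Proof.
by rewrite pq coef_qpowM.
Qed.
Lemma u0_coef0 : coef u0 0 = 4.
Proof.
have := congr1 (fun x => coef x 0) u0X.
rewrite !coefM0 !Vop_coef0 (phi_coef0 F2) (psi2_coef0 F2) !mulr1 => ->.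
by rewrite -natrM.
Qed.
Lemma coef_lin (a c : nat) : coef (a%:R + c%:R * p) 0 = a%:R.
Proof.
by rewrite coefDs coefM0 p_coef0 mulr0 addr0 coef_natr.
Qed.
Lemma y_coef0 : coef y 0 = 1.
Proof.
exact: coef_lin 1%N 2%N.
Qed.
Lemma p2_coef0 : coef (2 + p) 0 = 2.
Proof.
by rewrite coefDs p_coef0 addr0 coef_natr.
Qed.
Lemma p1_coef0 : coef (1 + p) 0 = 1.
Proof.
by rewrite coefDs p_coef0 addr0.
Qed.
Lemma pm_coef0 : coef (1 - p) 0 = 1.
Proof.
by rewrite coefBs p_coef0 subr0.
Qed.
Lemma ratio_nz : 4 * u * (1 - u) != 0.
Proof.
have n4 := natr_series_neq0 (pow2_neq0 2).
have nu : u != 0.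
by rewrite uq mulf_neq0 ?qpow1_neq0 // series_neq0 // u0_coef0 (pow2_neq0 2).
have nu1 : 1 - u != 0 by apply: series_neq0; rewrite coefBs u_coef0 subr0 oner_eq0.
by rewrite !mulf_neq0.
Qed.
Lemma series2_neq0 : 2 != 0 :> series F.
Proof.
exact: natr_series_neq0.
Qed.
Lemma uyE : u * y = p * (2 + p).
Proof.
exact: six_uy ratio_prod ratio_coprod pR ratio_nz.
Qed.
Lemma al_y : al * y ^+ 3 = p * (2 + p) ^+ 3.
Proof.
exact: six_al series2_neq0 ratio_prod ratio_coprod pR ratio_nz.
Qed.
Lemma be_y : be * y = p ^+ 3 * (2 + p).
Proof.
exact: six_be series2_neq0 ratio_prod ratio_coprod pR ratio_nz.
Qed.
Lemma al1_y : (1 - al) * y ^+ 3 = (1 + p) * (1 - p) ^+ 3.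
Proof.
exact: six_al1 series2_neq0 ratio_prod ratio_coprod pR ratio_nz.
Qed.
Lemma be1_y : (1 - be) * y = (1 + p) ^+ 3 * (1 - p).
Proof.
exact: six_be1 series2_neq0 ratio_prod ratio_coprod pR ratio_nz.
Qed.
Lemma p0_coef0 : coef p0 0 = 2.
Proof.
have h : p0 * (2 + p) = u0 * y.
apply: (mulfI qpow1_neq0); transitivity (p * (2 + p)); first by rewrite {2}pq; ring.
by rewrite -uyE uq; ring.
have := congr1 (fun x => coef x 0) h; rewrite !coefM0 p2_coef0 y_coef0 u0_coef0 mulr1 => h2.
by apply: (mulIf F2); rewrite h2 -natrM.
Qed.
Lemma p_neq0 : p != 0.
Proof.
by rewrite pq mulf_neq0 ?qpow1_neq0 // series_neq0 // p0_coef0.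
Qed.
Lemma y_neq0 : y != 0.
Proof.
by apply: series_neq0; rewrite y_coef0 oner_eq0.
Qed.
Lemma p2_neq0 : 2 + p != 0.
Proof.
by apply: series_neq0; rewrite p2_coef0.
Qed.
Lemma p1_neq0 : 1 + p != 0.
Proof.
by apply: series_neq0; rewrite p1_coef0 oner_eq0.
Qed.
Lemma pm_neq0 : 1 - p != 0.
Proof.
by apply: series_neq0; rewrite pm_coef0 oner_eq0.
Qed.
Lemma Dop_natr k : Dop (k%:R : series F) = 0.
Proof.
by rewrite -const_natr Dop_const.
Qed.
Lemma Dop_y : Dop y = 2 * Dop p.
Proof.
by rewrite raddfD /= Dop1 add0r DopM Dop_natr mul0r add0r.
Qed.
Lemma Dop_p2 : Dop (2 + p) = Dop p.
Proof.
by rewrite raddfD /= Dop_natr add0r.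
Qed.
Lemma agm_a_Dop : p * (2 + p) * (1 + p) * (1 - p) * A = 2 * y ^+ 2 * Dop p.
Proof.
have e : al * ((1 - al) * A) * y ^+ 3 + al * (3 * y ^+ 2 * (2 * Dop p)) =
    Dop p * (2 + p) ^+ 3 + p * (3 * (2 + p) ^+ 2 * Dop p).
have e0 := congr1 (@Dop F) al_y.
by rewrite (DopM al) (DopM p) !DopX Dop_y Dop_p2 (Dop_agm_ratio F2 alA) in e0; exact: e0.
have nz : (2 + p) ^+ 2 * (1 - p) ^+ 2 != 0.
by rewrite mulf_neq0 // expf_neq0 ?p2_neq0 ?pm_neq0.
apply: (mulfI nz); transitivity (al * y ^+ 3 * ((1 - al) * y ^+ 3) * A).
by rewrite al_y al1_y; ring.
transitivity (y ^+ 3 * ((al * ((1 - al) * A) * y ^+ 3 + al * (3 * y ^+ 2 * (2 * Dop p)))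
   - al * (3 * y ^+ 2 * (2 * Dop p)))); first by ring.
rewrite e; transitivity (y ^+ 3 * (Dop p * (2 + p) ^+ 3 + p * (3 * (2 + p) ^+ 2 * Dop p))
   - 6 * y ^+ 2 * (al * y ^+ 3) * Dop p); first by ring.
by rewrite al_y; ring.
Qed.
(** Differentiating the equation of be, where D V_3 = 3 V_3 D introduces the factor 3 to be
    cancelled. *)
Lemma agm_a3_Dop : p * (2 + p) * (1 + p) * (1 - p) * A3 = 2 * Dop p.
Proof.
have e : 3 * (be * ((1 - be) * A3)) * y + be * (2 * Dop p) =
    3 * p ^+ 2 * Dop p * (2 + p) + p ^+ 3 * Dop p.
have e0 := congr1 (@Dop F) be_y.
rewrite (DopM be) (DopM (p ^+ 3)) DopX Dop_y Dop_p2 Dop_Vop (Dop_agm_ratio F2 alA) in e0.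
by rewrite rmorphM rmorphM rmorphB rmorph1 in e0; exact: e0.
have nz : 3 * p ^+ 2 * (1 + p) ^+ 2 != 0.
by rewrite !mulf_neq0 ?expf_neq0 ?p_neq0 ?p1_neq0 // (natr_series_neq0 F3).
apply: (mulfI nz); transitivity (3 * (be * y * ((1 - be) * y)) * A3).
by rewrite be_y be1_y; ring.
transitivity (y * ((3 * (be * ((1 - be) * A3)) * y + be * (2 * Dop p)) - be * (2 * Dop p))).
by ring.
rewrite e; transitivity (y * (3 * p ^+ 2 * Dop p * (2 + p) + p ^+ 3 * Dop p)
   - 2 * (be * y) * Dop p); first by ring.
by rewrite be_y; ring.
Qed.
(** The equations of al and of be each compute D p. Comparing them gives the multiplier of degree 3,
    the quotient of phi(q)^4 by phi(q^3)^4. *)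
Lemma agm_a_a3 : A = y ^+ 2 * A3.
Proof.
have nz : p * (2 + p) * (1 + p) * (1 - p) != 0.
by rewrite !mulf_neq0 ?p_neq0 ?p2_neq0 ?p1_neq0 ?pm_neq0.
apply: (mulfI nz); rewrite agm_a_Dop.
transitivity (y ^+ 2 * (p * (2 + p) * (1 + p) * (1 - p) * A3)); last by ring.
by rewrite agm_a3_Dop; ring.
Qed.
Lemma phi_sqr3 : f ^+ 2 = y * f3 ^+ 2.
Proof.
apply: (@series_expr_inj _ _ _ 2) => //.
- by rewrite coefM0 !coefX0 Vop_coef0 y_coef0 (phi_coef0 F2) !expr1n mulr1.
- by rewrite coefX0 (phi_coef0 F2) expr1n oner_eq0.
- transitivity (agm_a F); first by rewrite /agm_a; ring.
by rewrite agm_a_a3 agm_a3E; ring.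
Qed.
Lemma agm_a3_w : A3 = w ^+ 2 * y.
Proof.
have nz : f ^+ 2 != 0 by rewrite expf_neq0 ?phi_neq0.
apply: (mulIf nz); transitivity ((w * f) ^+ 2 * y); last by ring.
by rewrite wphi phi_sqr3 agm_a3E; ring.
Qed.
Lemma agm_a_w : A = w ^+ 2 * y ^+ 3.
Proof.
by rewrite agm_a_a3 agm_a3_w; ring.
Qed.
Lemma phi_phi3_w : (f * f3) ^+ 2 = w ^+ 2 * y ^+ 2.
Proof.
rewrite exprMn phi_sqr3; transitivity (y * A3); first by rewrite agm_a3E; ring.
by rewrite agm_a3_w; ring.
Qed.
Lemma agm_c_w : C = w ^+ 2 * (p * (2 + p) ^+ 3).
Proof.
by rewrite -alA agm_a_w -al_y; ring.
Qed.
Lemma agm_c3_w : C3 = w ^+ 2 * (p ^+ 3 * (2 + p)).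
Proof.
by rewrite -beA3 agm_a3_w -be_y; ring.
Qed.
Lemma psi_psi3_w : (q * X) ^+ 2 = w ^+ 2 * (p * (2 + p)) ^+ 2.
Proof.
have -> : q * X = u * (f * f3) by rewrite uq -mulrA u0X.
by rewrite exprMn phi_phi3_w -uyE; ring.
Qed.
Definition six_l : {poly F} := (2^-1)%:P * ((1 - 'X) * (1 + 'X) * (2 + 'X) * (1 + 2 * 'X)).
Lemma Dop_p : Dop p = p * (peval six_l p * w ^+ 2).
Proof.
apply: (mulfI series2_neq0); rewrite -agm_a3_Dop agm_a3_w /six_l.
rewrite !(pevalM, pevalD, pevalN, peval_X, peval_C, peval_nat, peval_1).
have h : 2 * const 2^-1 = 1 :> series F by rewrite -[X in X * _]const_natr -rmorphM mulfV // rmorph1.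
transitivity ((2 * const 2^-1) * (p * (2 + p) * (1 + p) * (1 - p) * (w ^+ 2 * y))); last by ring.
by rewrite h mul1r.
Qed.
Lemma eta_al : al * e2 ^+ 24 = 16 * (q * (e1 ^+ 8 * e4 ^+ 16)).
Proof.
transitivity (al * (e2 ^+ 5) ^+ 4 * e2 ^+ 4); first by ring.
rewrite -phi_eta; transitivity (al * A * (e1 ^+ 8 * e4 ^+ 8) * e2 ^+ 4); first by rewrite /agm_a; ring.
rewrite alA /agm_c; transitivity (q * (Vop 2 (psi2 F) * e2) ^+ 4 * (e1 ^+ 8 * e4 ^+ 8)); first by ring.
by rewrite psi2_eta2; ring.
Qed.
Lemma eta_al1 : (1 - al) * e2 ^+ 24 = e1 ^+ 16 * e4 ^+ 8.
Proof.
transitivity ((1 - al) * (e2 ^+ 5) ^+ 4 * e2 ^+ 4); first by ring.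
rewrite -phi_eta; transitivity ((A - al * A) * (e1 ^+ 8 * e4 ^+ 8) * e2 ^+ 4); first by rewrite /agm_a; ring.
rewrite alA (agm_bE F2); transitivity ((nf * e2) ^+ 4 * (e1 ^+ 8 * e4 ^+ 8)); first by ring.
by rewrite phi_neg_product; ring.
Qed.
Lemma eta_be : be * e6 ^+ 24 = 16 * (q ^+ 3 * (e3 ^+ 8 * e12 ^+ 16)).
Proof.
have vq : Vop 3 q = q ^+ 3 by rewrite -qpow3E; exact: (Vop_qpow F 1 (isT : (0 < 3)%N)).
rewrite -Vop3_e2 -Vop3_e4 -vq.
exact: etrans (esym (Vop_mulX 2 al e2 24)) (etrans (congr1 (Vop 3) eta_al) (Vop_natMXX 2 16 q e1 e4 8 16)).
Qed.

Lemma eta_be1 : (1 - be) * e6 ^+ 24 = e3 ^+ 16 * e12 ^+ 8.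
Proof.
have v1 : Vop 3 (1 - al) = 1 - be by rewrite rmorphB rmorph1.
rewrite -Vop3_e2 -Vop3_e4 -v1.
exact: etrans (esym (Vop_mulX 2 (1 - al) e2 24)) (etrans (congr1 (Vop 3) eta_al1) (Vop_XX 2 e1 e4 16 8)).
Qed.

Lemma eta_y : y * (e6 ^+ 10 * e1 ^+ 4 * e4 ^+ 4) = e2 ^+ 10 * e3 ^+ 4 * e12 ^+ 4.
Proof.
transitivity (y * f3 ^+ 2 * (e3 ^+ 4 * e12 ^+ 4 * e1 ^+ 4 * e4 ^+ 4)).
have -> : e6 ^+ 10 = (e6 ^+ 5) ^+ 2 by ring.
by rewrite -phi_eta3; ring.
rewrite -phi_sqr3; have -> : e2 ^+ 10 = (e2 ^+ 5) ^+ 2 by ring.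
by rewrite -phi_eta; ring.
Qed.
Lemma euler_coefs k : coef (Vop k (euler F)) 0 = 1.
Proof.
by rewrite Vop_coef0 euler_coef0.
Qed.
Let n16 : 16 != 0 :> series F := natr_series_neq0 (pow2_neq0 4).
Let V := Vop_euler_neq0.

(** Eliminating y gives p^8 al = be^3, an equality of eta quotients up to an eighth root, which the
    constant terms determine. The same pattern serves 2 + p, 1 - p and 1 + p. *)
Lemma eta_p : p * (e6 ^+ 9 * e1 * e4 ^+ 2) = q * (2 * (e3 ^+ 3 * e12 ^+ 6 * e2 ^+ 3)).
Proof.
have p8 : p ^+ 8 * al = be ^+ 3.
  have nz : y ^+ 3 != 0 by rewrite expf_neq0 ?y_neq0.
  apply: (mulIf nz); rewrite -mulrA al_y; transitivity ((be * y) ^+ 3); last by ring.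
  by rewrite be_y; ring.
rewrite pq in p8; rewrite pq -mulrA; congr (_ * _).
have c2 : coef (p0 * (e6 ^+ 9 * e1 * e4 ^+ 2)) 0 = 2.
  by rewrite !coefM0 ?coefX0 ?euler_coefs ?euler_coef0 p0_coef0 ?expr1n ?mulr1.
have c2' : coef (2 * (e3 ^+ 3 * e12 ^+ 6 * e2 ^+ 3)) 0 = 2.
  by rewrite !coefM0 ?coefX0 ?euler_coefs coef_natr /= ?expr1n ?mulr1.
apply: (@series_expr_inj _ _ _ 8 isT (pow2_neq0 3)).
- by rewrite c2 c2'.
- by rewrite c2.
- exact: (eta_algebra_p qpow1_neq0 n16 p8 eta_al eta_be).
Qed.

Lemma eta_p2 : (2 + p) * (e6 ^+ 7 * e1) = 2 * (e4 ^+ 2 * e2 * e3 ^+ 3 * e12 ^+ 2).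
Proof.
have p8 : (2 + p) ^+ 8 * be = al ^+ 3 * y ^+ 8.
  apply: (mulIf y_neq0); rewrite -mulrA be_y; transitivity ((al * y ^+ 3) ^+ 3); last by ring.
  by rewrite al_y; ring.
have c2 : coef ((2 + p) * (e6 ^+ 7 * e1)) 0 = 2.
  by rewrite !coefM0 ?coefX0 ?euler_coefs ?euler_coef0 p2_coef0 ?expr1n ?mulr1.
have c2' : coef (2 * (e4 ^+ 2 * e2 * e3 ^+ 3 * e12 ^+ 2)) 0 = 2.
  by rewrite !coefM0 ?coefX0 ?euler_coefs coef_natr /= ?expr1n ?mulr1.
apply: (@series_expr_inj _ _ _ 8 isT (pow2_neq0 3)).
- by rewrite c2 c2'.
- by rewrite c2.
- exact: (eta_algebra_p2 qpow1_neq0 n16 euler_neq0 (V 2) (V 3) (V 4) (V 12) p8 eta_al eta_be eta_y).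
Qed.

Lemma eta_pm : (1 - p) * (e6 ^+ 7 * e4) = e1 ^+ 2 * e2 * e3 ^+ 2 * e12 ^+ 3.
Proof.
have p8 : (1 - p) ^+ 8 * (1 - be) = (1 - al) ^+ 3 * y ^+ 8.
  apply: (mulIf y_neq0); rewrite -mulrA be1_y; transitivity (((1 - al) * y ^+ 3) ^+ 3); last by ring.
  by rewrite al1_y; ring.
have c1 : coef ((1 - p) * (e6 ^+ 7 * e4)) 0 = 1.
  by rewrite !coefM0 ?coefX0 ?euler_coefs pm_coef0 ?expr1n ?mulr1.
have c1' : coef (e1 ^+ 2 * e2 * e3 ^+ 2 * e12 ^+ 3) 0 = 1.
  by rewrite !coefM0 ?coefX0 ?euler_coefs ?euler_coef0 ?expr1n ?mulr1.
apply: (@series_expr_inj _ _ _ 8 isT (pow2_neq0 3)).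
- by rewrite c1 c1'.
- by rewrite c1 oner_eq0.
- exact: (eta_algebra_pm euler_neq0 (V 2) (V 3) (V 4) (V 12) p8 eta_al1 eta_be1 eta_y).
Qed.

Lemma eta_p1 : (1 + p) * (e1 ^+ 2 * e4 * e6 ^+ 9) = e3 ^+ 6 * e12 ^+ 3 * e2 ^+ 3.
Proof.
have p8 : (1 + p) ^+ 8 * (1 - al) = (1 - be) ^+ 3.
  have nz : y ^+ 3 != 0 by rewrite expf_neq0 ?y_neq0.
  apply: (mulIf nz); rewrite -mulrA al1_y; transitivity (((1 - be) * y) ^+ 3); last by ring.
  by rewrite be1_y; ring.
have c1 : coef ((1 + p) * (e1 ^+ 2 * e4 * e6 ^+ 9)) 0 = 1.
  by rewrite !coefM0 ?coefX0 ?euler_coefs ?euler_coef0 p1_coef0 ?expr1n ?mulr1.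
have c1' : coef (e3 ^+ 6 * e12 ^+ 3 * e2 ^+ 3) 0 = 1.
  by rewrite !coefM0 ?coefX0 ?euler_coefs ?expr1n ?mulr1.
apply: (@series_expr_inj _ _ _ 8 isT (pow2_neq0 3)).
- by rewrite c1 c1'.
- by rewrite c1 oner_eq0.
- exact: (eta_algebra_p1 p8 eta_al1 eta_be1).
Qed.

Lemma regular6_eta : regular_series F 6 * e1 = e6.
Proof. exact: regular_seriesM. Qed.

Lemma regular6_pow : 16 * (q ^+ 5 * (regular_series F 6 ^+ 24 *
  ((2 + p) * (1 - p) ^+ 10 * y))) = p ^+ 5 * (1 + p) ^+ 2.
Proof.
exact: (eta_algebra_pow euler_neq0 (V 4) (V 6) regular6_eta eta_p eta_p2 eta_pm eta_p1 eta_y).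
Qed.

(** This and [regular6_borwein4] give two multiples of the series of b_6 that are explicit products
    of theta series. As (1 - p) + (2 + p) = 3, a combination of them yields the multiple by A3 (2 +
    p)(1 - p). *)
Lemma regular6_borwein : regular_series F 6 * A3 * ((2 + p) * (1 - p) ^+ 2) =
  psi2 F * e2 * borwein_b F.
Proof.
rewrite agm_a3E; exact: (eta_algebra_borwein euler_neq0 (V 3) (V 4) (V 6) (V 12) regular6_eta
  phi_eta3 eta_p2 eta_pm (psi2_product F) euler_cube).
Qed.

Lemma regular6_borwein4 : regular_series F 6 * A3 * ((2 + p) ^+ 2 * (1 - p)) =
  2 * (psi2 F * e2 * Vop 4 (borwein_b F)).
Proof.
rewrite agm_a3E; exact: (eta_algebra_borwein4 euler_neq0 (V 3) (V 4) (V 6) (V 12) regular6_eta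
  phi_eta3 eta_p2 eta_pm (psi2_product F) euler_cube4).
Qed.

(* the five weight-two forms on the right are w^2 times polynomials in p
   spanning the polynomials of degree at most 4 *)
Lemma weight_two_span i : (i <= 4)%N -> exists c1 c2 c3 c4 c5 : F,
  w ^+ 2 * p ^+ i = const c1 * A + const c2 * (f * f3) ^+ 2 + const c3 * A3 + const c4 * C
    + const c5 * (q * X) ^+ 2.
Proof.
have F36 : 36 != 0 :> F.
have -> : 36 = 2 ^+ 2 * 3 ^+ 2 :> F by rewrite -!natrX -natrM.
by rewrite mulf_neq0 ?expf_neq0.
have h : 36 * const 36^-1 = 1 :> series F by rewrite -[X in X * _]const_natr -rmorphM mulfV // rmorph1.
have key (z1 z2 z3 z4 z5 : int) : 36 * (w ^+ 2 * p ^+ i) =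
   z1%:~R * (w ^+ 2 * y ^+ 3) + z2%:~R * (w ^+ 2 * y ^+ 2) + z3%:~R * (w ^+ 2 * y)
   + z4%:~R * (w ^+ 2 * (p * (2 + p) ^+ 3)) + z5%:~R * (w ^+ 2 * (p * (2 + p)) ^+ 2) ->
   exists c1 c2 c3 c4 c5 : F,
  w ^+ 2 * p ^+ i = const c1 * A + const c2 * (f * f3) ^+ 2 + const c3 * A3 + const c4 * C
    + const c5 * (q * X) ^+ 2.
move=> e; exists (36^-1 * z1%:~R), (36^-1 * z2%:~R), (36^-1 * z3%:~R), (36^-1 * z4%:~R), (36^-1 * z5%:~R).
rewrite !(rmorphM (@const F)) !(rmorph_int (@const F)) phi_phi3_w agm_a3_w agm_c_w agm_a_w psi_psi3_w.
transitivity (const 36^-1 * (36 * (w ^+ 2 * p ^+ i))).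
by rewrite mulrA [_ * 36]mulrC h mul1r.
rewrite e; move: (z1%:~R) (z2%:~R) (z3%:~R) (z4%:~R) (z5%:~R) => a1 a2 a3 a4 a5; ring.
case: i key => [|[|[|[|[|//]]]]] key _.
(* The integers solve the five by five linear system expressing 36 p^i in y^3, y^2, y, p (2 + p)^3
   and p^2 (2 + p)^2. *)
- by apply: (key 4 20 12 (- 16) 16); ring.
- by apply: (key (- 2) (- 10) 12 8 (- 8)); ring.
- by apply: (key 1 14 (- 15) (- 4) 4); ring.
- by apply: (key 4 (- 16) 12 2 (- 2)); ring.
- by apply: (key (- 20) 8 12 8 28); ring.
Qed.
End SixParameter.
End SixGeneral.

(** * Existence of the level six parameter *)

Section SixExistence.
Variable F : fieldType.
Hypothesis F2 : 2 != 0 :> F.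

(** The square root R of 1 - u + u^2 is obtained rationally, as the quotient of al - be by 4 u (1 -
    u). After removing q, numerator and denominator both start with 16, so R has constant term 1 and
    p = R - 1 + u is divisible by q. *)
Lemma six_parameter : exists al u u0 p p0 w : series F,
  [/\ al * agm_a F = agm_c F, u0 * (phi F * Vop 3 (phi F)) = Vop 2 (psi2 F) * Vop 6 (psi2 F),
      u = qpow F 1 * u0 /\ p = qpow F 1 * p0,
      (p + 1 - u) * (4 * u * (1 - u)) = al - Vop 3 al & w * phi F = Vop 3 (phi F) ^+ 3].
Proof.
have q3 : qpow F 3 = qpow F 1 ^+ 3 by rewrite -qpowM.
have c16 : (2 ^ 4)%:R != 0 :> F := pow2_neq0 F2 4.
have ua : agm_a F \is a GRing.unit by rewrite unit_series_coef0 (agm_a0 F2) oner_eq0.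
have uf : phi F \is a GRing.unit by rewrite unit_series_coef0 (phi_coef0 F2) oner_eq0.
have uff : phi F * Vop 3 (phi F) \is a GRing.unit.
  by rewrite unit_series_coef0 coefM0 Vop_coef0 (phi_coef0 F2) mulr1 oner_eq0.
have [a1 a1E] : exists a1, a1 * agm_a F = Vop 2 (psi2 F) ^+ 4.
  by exists (Vop 2 (psi2 F) ^+ 4 / agm_a F); rewrite divrK.
have [u0 u0E] : exists u0, u0 * (phi F * Vop 3 (phi F)) = Vop 2 (psi2 F) * Vop 6 (psi2 F).
  by exists (Vop 2 (psi2 F) * Vop 6 (psi2 F) / (phi F * Vop 3 (phi F))); rewrite divrK.
have a10 : coef a1 0 = 16.
  have := congr1 (fun x => coef x 0) a1E; rewrite coefM0 (agm_a0 F2) mulr1 => ->.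
  by rewrite coefX0 Vop_coef0 (psi2_coef0 F2) -natrX.
have u00 := u0_coef0 F2 u0E.
have [u uE] : exists u, u = qpow F 1 * u0 by eexists.
have u_0 : coef u 0 = 0 by rewrite uE coef_qpowM.
have [a0 a0E] : exists a0, a0 = a1 - qpow F 1 * (qpow F 1 * Vop 3 a1) by eexists.
have a00 : coef a0 0 = 16 by rewrite a0E coefBs coef_qpowM /= subr0.
have al3 : Vop 3 (qpow F 1 * a1) = qpow F 1 ^+ 3 * Vop 3 a1.
  rewrite -q3 rmorphM; congr (_ * _); exact: (Vop_qpow F 1 (isT : (0 < 3)%N)).
have d0 : coef (4 * u0 * (1 - u)) 0 = 16.
  by rewrite !coefM0 coefBs u_0 subr0 u00 coef_natr /= mulr1 -natrM.
have ud : 4 * u0 * (1 - u) \is a GRing.unit by rewrite unit_series_coef0 d0.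
have [R RE] : exists R, R * (4 * u0 * (1 - u)) = a0.
  by exists (a0 / (4 * u0 * (1 - u))); rewrite divrK.
have R0 : coef R 0 = 1.
  have := congr1 (fun x => coef x 0) RE; rewrite coefM0 d0 a00 => h.
  by apply: (mulIf c16); rewrite mul1r.
have [p0 p0E] : exists p0, R - 1 + u = qpow F 1 * p0.
  by apply: coef_qdiv; rewrite coefDs coefBs u_0 R0 addr0 subrr.
exists (qpow F 1 * a1), u, u0, (R - 1 + u), p0, (Vop 3 (phi F) ^+ 3 / phi F); split => //.
- by rewrite -mulrA a1E.
- rewrite al3; transitivity (R * (4 * u * (1 - u))); first by ring.
  transitivity (qpow F 1 * (R * (4 * u0 * (1 - u)))); first by rewrite {1}uE; ring.
  by rewrite RE a0E; ring.
- by rewrite divrK.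
Qed.

End SixExistence.

(** * The congruences for b_6 *)

(** Isolates an M-th power of the linear factors 1 + X, 2 + X, 1 - X and 1 + 2 X, which Frobenius
    takes out of [Upoly2]; the other factors keep nonnegative exponents. *)
Lemma six_regroup (R : comNzRingType) (x a c d z e k : R) M s : (0 < s)%N -> M = (24 * s).+1 ->
  x * a ^+ (M - 2 * s) * (c * d ^+ 10 * z) ^+ s * k * (e * (d * a * c * z)) ^+ M.-1 =
  (a * c * d * z) ^+ M *
    (e ^+ M.-1 * (x * a ^+ (M - 1 - 2 * s) * c ^+ (s - 1) * d ^+ (10 * s - 1) * z ^+ (s - 1) * k)).
Proof.
move=> s0 ME.
have ha : a ^+ (M - 2 * s) * a ^+ M.-1 = a ^+ M * a ^+ (M - 1 - 2 * s).
  by rewrite -!exprD; congr (_ ^+ _); lia.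
have hc : c ^+ s * c ^+ M.-1 = c ^+ M * c ^+ (s - 1) by rewrite -!exprD; congr (_ ^+ _); lia.
have hz : z ^+ s * z ^+ M.-1 = z ^+ M * z ^+ (s - 1) by rewrite -!exprD; congr (_ ^+ _); lia.
have hd : (d ^+ 10) ^+ s * d ^+ M.-1 = d ^+ M * d ^+ (10 * s - 1).
  by rewrite -exprM -!exprD; congr (_ ^+ _); lia.
move: hd; move: (d ^+ 10) => D hd; rewrite !exprMn.
transitivity (x * (a ^+ (M - 2 * s) * a ^+ M.-1) * (c ^+ s * c ^+ M.-1) * (D ^+ s * d ^+ M.-1)
  * (z ^+ s * z ^+ M.-1) * k * e ^+ M.-1); first by ring.
by rewrite ha hc hd hz; ring.
Qed.

(** Since n (m + 1) = 12 s, the two sides are 1152 s^2 + 5 s - 2 and 1152 s^2 + 24 s - 1. *)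
Lemma degree_bound6 m n s : m = (2 * n).+1 -> (m * m)%N = (24 * s).+1 -> (0 < s)%N ->
  ((m * m).-1 * 0 + ((m * m - 5 * s) * 1 + (m * m - 1 - 2 * s) * 1 + (s - 1) * 1
     + (10 * s - 1) * 1 + (s - 1) * 1 + m.+1 * (m * m - 2) * (n * 4))
   < m * m * (2 * (m * m) - 3))%N.
Proof.
move=> mn ms; have n4 : (n * m.+1 = 12 * s)%N by nia.
have -> : (m.+1 * (m * m - 2) * (n * 4) = (n * m.+1) * (4 * (m * m - 2)))%N.
  by move: (m * m - 2)%N => z; lia.
rewrite n4 ms; case: s {ms n4} => // t _.
have -> : ((24 * t.+1).+1 - 5 * t.+1 = 19 * t + 20)%N by lia.
have -> : ((24 * t.+1).+1 - 1 - 2 * t.+1 = 22 * t + 22)%N by lia.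
have -> : ((24 * t.+1).+1 - 2 = 24 * t + 23)%N by lia.
have -> : (2 * (24 * t.+1).+1 - 3 = 48 * t + 47)%N by lia.
have -> : (10 * t.+1 - 1 = 10 * t + 9)%N by lia.
have -> : (t.+1 - 1 = t)%N by lia.
lia.
Qed.

Lemma Vop_hasse (F : fieldType) k n (x z : series F) :
  Vop k.+1 (hasse n x z) = hasse n (Vop k.+1 x) (Vop k.+1 z).
Proof.
rewrite /hasse rmorph_sum; apply: eq_bigr => j _.
by rewrite !rmorphM !rmorphXn rmorph_nat.
Qed.

Lemma Vop_twist (F : fieldType) (g1 g2 h1 h2 : series F) (a c d : F) :
  qpow F 5 * Vop 24 (const a * (g1 * h1 + const c * ((g1 + const d * g2) * h2))) =
  const a * (Vop 24 h1 * (qpow F 5 * Vop 24 g1) +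
    const c * (Vop 24 h2 * (qpow F 5 * Vop 24 g1 + const d * (qpow F 5 * Vop 24 g2)))).
Proof. by rewrite !(rmorphM, rmorphD) /= !Vop_const; ring. Qed.

Lemma Vop_pull (F : fieldType) (c : F) (x z t : series F) :
  Vop 24 (x * (const c * z)) * t = const c * (Vop 24 (x * z) * t).
Proof. by rewrite (mulrCA x) (VopMS 23 (const c)) Vop_const -mulrA. Qed.

Section RegularSix.
Variable m : nat.
Hypotheses (m_pr : prime m) (m5 : (4 < m)%N).
Local Notation F := 'F_m.

Lemma Fp_small_neq0 k : (0 < k < 5)%N -> k%:R != 0 :> F.
Proof. by move=> /andP[k0 k5]; rewrite -(dvdn_pcharf (pchar_Fp m_pr)) gtnNdvd //; lia. Qed.
Let F2 : 2 != 0 :> F := @Fp_small_neq0 2 isT.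
Let F3 : 3 != 0 :> F := @Fp_small_neq0 3 isT.

Section SixMod.
Variables al u u0 p p0 w : series F.
Hypotheses (alA : al * agm_a F = agm_c F)
  (u0X : u0 * (phi F * Vop 3 (phi F)) = Vop 2 (psi2 F) * Vop 6 (psi2 F))
  (uq : u = qpow F 1 * u0) (pq : p = qpow F 1 * p0)
  (pR : (p + 1 - u) * (4 * u * (1 - u)) = al - Vop 3 al)
  (wphi : w * phi F = Vop 3 (phi F) ^+ 3).
Local Notation G := (regular_series F 6).
Local Notation y := (1 + 2 * p).
Local Notation q := (qpow F 1).
Local Notation f := (phi F).
Local Notation f3 := (Vop 3 (phi F)).

Ltac six L := eapply L; first [exact F2 | exact F3 | exact alA | exact u0X | exact uq
  | exact pq | exact pR | exact wphi].

Lemma w_coef0 : coef w 0 = 1.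
Proof.
have := congr1 (fun x => coef x 0) wphi.
by rewrite coefM0 coefX0 Vop_coef0 (phi_coef0 F2) expr1n mulr1.
Qed.

(** The complementary powers of p and 1 + p complete p^(5s) (1 + p)^(2s) to an m^2-th power, so the
    extraction acts on a polynomial in p. The factor (2 + p)(1 - p)(1 + 2p) is kept apart because it
    turns the series of b_6 into theta series. *)
Lemma Uop_regular6 n s : m = (2 * n).+1 -> (m * m)%N = (24 * s).+1 ->
  exists Q : {poly F}, (size Q <= 2 * (m * m) - 4)%N /\
  Uop (m * m) (5 * s) G =
  const (16 ^+ s) * (G * w ^+ (m * m).-1 * ((2 + p) * (1 - p) * y * peval Q p)).
Proof.
move=> mn ms; have s0 : (0 < s)%N by nia.
have p_nz : p != 0 by six p_neq0.
have p1_nz : 1 + p != 0 by six p1_neq0.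
have R24 : 16 * (q ^+ 5 * (G ^+ 24 * ((2 + p) * (1 - p) ^+ 10 * y))) = p ^+ 5 * (1 + p) ^+ 2.
  by six regular6_pow.
have Dp : Dop p = p * (peval (six_l F) p * w ^+ 2) by six Dop_p.
have hA3 : Vop 3 (agm_a F) = w ^+ 2 * y by six agm_a3_w.
have hC3 : Vop 3 (agm_c F) = w ^+ 2 * (p ^+ 3 * (2 + p)) by six agm_c3_w.
have p_0 : coef p 0 = 0 by rewrite pq coef_qpowM.
have [L LE] : exists L, L = (2 + p) * (1 - p) ^+ 10 * y by eexists.
rewrite -LE in R24.
have q5 : qpow F 5 = q ^+ 5 by rewrite -(qpowM F 1 5).
have q5s : qpow F (5 * s) = (q ^+ 5) ^+ s by rewrite mulnC qpowM q5.
have regroup (c a1 a2 a3 g z z' : series F) : c * (a1 * (a2 * a3)) = z * z' ->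
    c ^+ s * (a1 ^+ s * (g * a2 ^+ s * a3 ^+ s)) = g * (z ^+ s * z' ^+ s).
  by move=> h; rewrite -(exprMn s z z') -h !exprMn; ring.
have V1 : 16 ^+ s * (qpow F (5 * s) * (Vop (m * m) G * L ^+ s)) = G * (p ^+ (5 * s) * (1 + p) ^+ (2 * s)).
  rewrite -(frobenius2 m_pr) ms exprS !exprM q5s; exact: regroup R24.
have hp : p ^+ (m * m) = p ^+ (5 * s) * p ^+ (m * m - 5 * s).
  by rewrite -exprD subnKC //; lia.
have hp1 : (1 + p) ^+ (m * m) = (1 + p) ^+ (2 * s) * (1 + p) ^+ (m * m - 2 * s).
  by rewrite -exprD subnKC //; lia.
have e : const (16 ^+ s) * (qpow F (5 * s) * (Vop (m * m) G *
    (p ^+ (m * m - 5 * s) * (1 + p) ^+ (m * m - 2 * s) * L ^+ s))) = Vop (m * m) (p * (1 + p)) * G.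
  rewrite -[Vop _ (p * _)](frobenius2 m_pr) exprMn hp hp1 rmorphXn /= const_natr.
  move: V1; move: (16 ^+ s) (p ^+ (5 * s)) (p ^+ (m * m - 5 * s)) ((1 + p) ^+ (2 * s))
    ((1 + p) ^+ (m * m - 2 * s)) (L ^+ s) (Vop (m * m) G) => z1 z2 z3 z4 z5 z6 z7 V1.
  transitivity (z1 * (qpow F (5 * s) * (z7 * z6)) * (z3 * z5)); first by ring.
  by rewrite V1; ring.
pose N : {poly F} := 'X^(m * m - 5 * s) * (1 + 'X) ^+ (m * m - 2 * s)
   * ((2 + 'X) * (1 - 'X) ^+ 10 * (1 + 2 * 'X)) ^+ s.
have NE : p ^+ (m * m - 5 * s) * (1 + p) ^+ (m * m - 2 * s) * L ^+ s = peval N p.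
  by rewrite LE /N !(pevalX, pevalM, pevalD, pevalN, peval_X, peval_nat, peval_1).
pose K : {poly F} := hasse n (1 + 2 * 'X) ('X^3 * (2 + 'X)).
have WK : w ^+ m.-1 * peval K p = 1.
  have := congr1 (Vop 3) (hasse_agm m_pr mn); rewrite rmorph1 Vop_hasse hA3 hC3 hasse_scale => <-.
  rewrite peval_hasse !(pevalX, pevalM, pevalD, peval_X, peval_nat, peval_1) -exprM.
  by congr (_ ^+ _ * _); lia.
have l0 : coef (peval (six_l F) p * w ^+ 2) 0 = 1.
  have b2 : coef (2 + p) 0 = 2 by rewrite coefDs p_0 addr0 coef_natr.
  have b1 : coef (1 + p) 0 = 1 by rewrite coefDs p_0 addr0.
  have bm : coef (1 - p) 0 = 1 by rewrite coefBs p_0 subr0.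
  have b_y : coef y 0 = 1 by rewrite coefDs coefM0 p_0 mulr0 addr0.
  transitivity (coef (const 2^-1 * (2 + p) * ((1 - p) * (1 + p) * y * (w * w))) 0).
    congr (coef _ 0); rewrite /six_l !(pevalM, pevalD, pevalN, peval_X, peval_C, peval_nat, peval_1).
    by rewrite ?rmorph1; ring.
  by rewrite !coefM0 b2 b1 bm b_y w_coef0 !mulr1; exact: mulVf.
have nz : peval (six_l F) p * w ^+ 2 != 0 by apply: series_neq0; rewrite l0 oner_eq0.
have := congr1 (Uop (m * m) (5 * s)) e.
rewrite Uop_constM Uop_qpowM Uop_VopM; last by lia.
rewrite Uop_VopM; last by lia.
rewrite NE (cartier_main m_pr N p_nz Dp WK nz).
have -> : N * K ^+ (m.+1 * (m * m - 2)) * six_l F ^+ (m * m).-1 =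
  ((1 + 'X) * (2 + 'X) * (1 - 'X) * (1 + 2 * 'X)) ^+ (m * m) *
  ((2^-1)%:P ^+ (m * m).-1 * ('X^(m * m - 5 * s) * (1 + 'X) ^+ (m * m - 1 - 2 * s) *
    (2 + 'X) ^+ (s - 1) * (1 - 'X) ^+ (10 * s - 1) * (1 + 2 * 'X) ^+ (s - 1) * K ^+ (m.+1 * (m * m - 2)))).
  exact: six_regroup s0 ms.
rewrite (Upoly2_frobenius m_pr); set P := _ * (_ * K ^+ _).
have P0 : (Upoly2 P)`_0 = 0.
  rewrite coef0_Upoly2 // -horner_coef0 /P !hornerM hornerXn expr0n (_ : _ == _ = false) ?mul0r ?mulr0 //.
  by apply/negbTE; rewrite subn_eq0 -ltnNge; lia.
rewrite {1}(poly_divX P0) => h.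
exists (drop_poly 1 (Upoly2 P)); split.
  rewrite size_drop_poly leq_subLR; have -> : (1 + (2 * (m * m) - 4) = 2 * (m * m) - 3)%N by lia.
  apply: size_Upoly2 => //.
  have dX := deg_le_X F.
  have d1 : deg_le 1 (1 + 'X : {poly F}) by apply: deg_leD => //; exact: deg_le1.
  have d2 : deg_le 1 (2 + 'X : {poly F}) by apply: deg_leD => //; exact: deg_le_nat.
  have dm : deg_le 1 (1 - 'X : {poly F}) by apply: deg_leD; [exact: deg_le1|exact: deg_leN].
  have dy : deg_le 1 (1 + 2 * 'X : {poly F}).
    apply: deg_leD; first exact: deg_le1.
    exact: (@deg_leM _ 0 1 _ _ (deg_le_nat F 2 0) dX).
  have dK : deg_le (n * 4) K.
    apply: deg_le_hasse; first exact: deg_leW dy.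
    exact: (@deg_leM _ (3 * 1) 1 _ _ (deg_leX 3 dX) d2).
  have dc : deg_le 0 ((2^-1)%:P : {poly F}) by rewrite /deg_le size_polyC_leq1.
  have := deg_leM (deg_leX (m * m).-1 dc) (deg_leM (deg_leM (deg_leM (deg_leM (deg_leM
    (deg_leX (m * m - 5 * s) dX) (deg_leX (m * m - 1 - 2 * s) d1)) (deg_leX (s - 1) d2))
    (deg_leX (10 * s - 1) dm)) (deg_leX (s - 1) dy)) (deg_leX (m.+1 * (m * m - 2)) dK)).
  rewrite -/P /deg_le => hd; apply: leq_trans hd _.
  exact: degree_bound6.
have nz2 : p * (1 + p) != 0 by rewrite mulf_neq0.
apply: (mulfI nz2); rewrite -h.
rewrite !(pevalM, pevalD, pevalN, peval_X, peval_nat, peval_1).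
by move: (const _) (w ^+ (m * m).-1) (peval _ p) => z1 z2 z3; ring.
Qed.

Section SixTheta.
Variable ph : nat.
Hypotheses (ph_pr : prime ph) (phE : ph = 13 \/ ph = 37).
Local Notation TL := (theta_like (F := F) ph 12).

Lemma TL_weight2 i z : (i <= 4)%N -> TL z -> TL (Vop 24 (w ^+ 2 * p ^+ i) * z).
Proof.
move=> i4 tz.
have [c1 [c2 [c3 [c4 [c5 ->]]]]] : exists c1 c2 c3 c4 c5 : F,
  w ^+ 2 * p ^+ i = const c1 * agm_a F + const c2 * (f * f3) ^+ 2 + const c3 * Vop 3 (agm_a F)
    + const c4 * agm_c F + const c5 * (q * (Vop 2 (psi2 F) * Vop 6 (psi2 F))) ^+ 2.
  by eapply weight_two_span; first [exact F2 | exact F3 | exact alA | exact u0X | exact uq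
  | exact pq | exact pR | exact wphi | exact i4].
have V24 c (x : series F) : Vop 24 (const c * x) = const c * Vop 24 x by rewrite rmorphM /= Vop_const.
have tf : TL (Vop 24 f) by apply: theta_like_phi => //; case: phE => ->.
have tf3 : TL (Vop 72 f) by apply: theta_like_phi => //; case: phE => ->.
have t6 : TL (qpow F 6 * Vop (8 * 6) (psi2 F)) by apply: theta_like_psi2 => //; case: phE => ->.
have t18 : TL (qpow F 18 * Vop (8 * 18) (psi2 F)) by apply: theta_like_psi2 => //; case: phE => ->.
have tA : TL (Vop 24 (agm_a F) * z).
  by rewrite /agm_a rmorphXn /=; exact: theta_likeXM.
have tA3 : TL (Vop 24 (Vop 3 (agm_a F)) * z).
  by rewrite Vop_comp // /agm_a rmorphXn /=; exact: theta_likeXM.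
have tD : TL (Vop 24 ((f * f3) ^+ 2) * z).
  by rewrite rmorphXn rmorphM /= Vop_comp // exprMn -mulrA; do 2 apply: theta_likeXM => //.
have tC : TL (Vop 24 (agm_c F) * z).
  have -> : Vop 24 (agm_c F) = (qpow F 6 * Vop (8 * 6) (psi2 F)) ^+ 4 := @Vop_agm_c _ F2 6 isT.
  exact: theta_likeXM.
have tZ : TL (Vop 24 ((q * (Vop 2 (psi2 F) * Vop 6 (psi2 F))) ^+ 2) * z).
  have -> : Vop 24 ((q * (Vop 2 (psi2 F) * Vop 6 (psi2 F))) ^+ 2) =
     (qpow F 6 * Vop (8 * 6) (psi2 F)) ^+ 2 * (qpow F 18 * Vop (8 * 18) (psi2 F)) ^+ 2.
    rewrite (VopX 23 _ 2) !(VopMS 23) (Vop_qpow F 1 (isT : (0 < 24)%N)) !Vop_compS.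
    have -> : qpow F (24 * 1) = qpow F 6 * qpow F 18 by rewrite -qpowD.
    rewrite -[(24 * 2)%N]/(8 * 6)%N -[(24 * 6)%N]/(8 * 18)%N.
    by move: (Vop _ _) (Vop _ _) => z1 z2; ring.
  by rewrite -mulrA; do 2 apply: theta_likeXM => //.
rewrite !rmorphD /= !V24 !mulrDl -!mulrA.
by repeat first [exact: tA | exact: tA3 | exact: tD | exact: tC | exact: tZ
  | apply: theta_likeZ | apply: theta_likeD].
Qed.

(** A product of k forms of weight two, each absorbing at most four powers of p. *)
Lemma TL_weight k j z : (j <= 4 * k)%N -> TL z -> TL (Vop 24 (w ^+ (2 * k) * p ^+ j) * z).
Proof.
elim: k j z => [|k IH] j z jk tz.
  have -> : j = 0%N by lia.
  by rewrite muln0 !expr0 mulr1 rmorph1 mul1r.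
have -> : w ^+ (2 * k.+1) * p ^+ j = (w ^+ 2 * p ^+ (minn j 4)) * (w ^+ (2 * k) * p ^+ (j - 4)).
  by rewrite mulrACA -!exprD; congr (_ ^+ _ * _ ^+ _); lia.
rewrite rmorphM -mulrA; apply: TL_weight2; first by lia.
by apply: IH => //; lia.
Qed.

(** Dividing Q by 1 - p leaves a quotient, whose product with the series of b_6 is handled by
    [regular6_borwein], and the constant Q(1), for which the second power of 1 - p is missing and
    both Borwein identities are combined. The shift q^5 is q^3 for psi plus q^2 for the Euler
    product. *)
Lemma TL_regular6 n s : m = (2 * n).+1 -> (m * m)%N = (24 * s).+1 ->
  TL (qpow F 5 * Vop 24 (Uop (m * m) (5 * s) G)).
Proof.
move=> mn ms; have s0 : (0 < s)%N by nia.
have [Q [sQ ->]] := Uop_regular6 mn ms.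
(* As m^2 - 1 = 24 s = 2 + 2 k, one factor w^2 goes to the Borwein identities and w^(2k) remains;
   the quotient of Q has degree at most 48 s - 4 = 4 k. *)
pose k := (12 * s - 1)%N.
have hA3 : Vop 3 (agm_a F) = w ^+ 2 * y by six agm_a3_w.
have h1 : G * Vop 3 (agm_a F) * ((2 + p) * (1 - p) ^+ 2) = psi2 F * Vop 2 (euler F) * borwein_b F.
  by six regular6_borwein.
have h2 : G * Vop 3 (agm_a F) * ((2 + p) ^+ 2 * (1 - p)) =
    2 * (psi2 F * Vop 2 (euler F) * Vop 4 (borwein_b F)) by six regular6_borwein4.
move: h1 h2; set g1 := _ * borwein_b F; set g2 := _ * Vop 4 _ => h1 h2.
have [Qb QbE] : exists Qb, Q - (Q.[1])%:P = Qb * ('X - 1%:P).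
  by apply/factor_theorem; rewrite rootE hornerD hornerN hornerC subrr.
have sQb : (size Qb <= (4 * k).+1)%N.
  have [->|Qb0] := eqVneq Qb 0; first by rewrite size_poly0.
  have := size_Mmonic Qb0 (monicXsubC 1); rewrite size_XsubC -QbE => e.
  have {}e : size (Q - (Q.[1])%:P) = (size Qb).+1 by rewrite e addnC.
  have : (size (Q - (Q.[1])%:P)%R <= 2 * (m * m) - 4)%N.
    apply: leq_trans (size_polyD _ _) _; rewrite geq_max sQ size_polyN.
    by apply: leq_trans (size_polyC_leq1 _) _; lia.
  by rewrite /k; lia.
(* The division by 3 corresponds to (1 - p) + (2 + p) = 3. *)
pose c := 3^-1 * Q.[1].
have cE : const Q.[1] = 3 * const c.
  by rewrite -(const_natr F 3) -rmorphM /c mulrA mulfV // mul1r.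
have QE : peval Q p = (1 - p) * peval (- Qb) p + 3 * const c.
  have -> : Q = Qb * ('X - 1%:P) + (Q.[1])%:P by rewrite -QbE; ring.
  by rewrite pevalD pevalM pevalD !pevalN !peval_C peval_X rmorph1 cE; ring.
have wE : w ^+ (m * m).-1 = w ^+ 2 * w ^+ (2 * k).
  by rewrite -exprD; congr (_ ^+ _); rewrite /k; lia.
have -> : G * w ^+ (m * m).-1 * ((2 + p) * (1 - p) * y * peval Q p) =
   g1 * (w ^+ (2 * k) * peval (- Qb) p) + const c * ((g1 + const 2 * g2) * (w ^+ (2 * k) * p ^+ 0)).
  rewrite const_natr -h2 -h1 hA3 QE wE expr0.
  by move: (w ^+ (2 * k)) (peval (- Qb) p) (const c) => z1 z2 z3; ring.
rewrite Vop_twist; apply: theta_likeZ.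
have t3 : TL (qpow F 3 * Vop (8 * 3) (psi2 F)) by apply: theta_like_psi2 => //; case: phE => ->.
have t2 : TL (qpow F 2 * Vop 48 (euler F)) by apply: theta_like_euler => //; case: phE => ->.
have tb k' : (0 < k')%N -> ~~ (ph %| k')%N -> TL (Vop (24 * k') (borwein_b F)).
  by move=> k0 pk; apply: theta_like_borwein => //; case: phE => ->.
have q5 : qpow F 5 = qpow F 3 * qpow F 2 by rewrite -qpowD.
have tg k' : ~~ (ph %| k'.+1)%N ->
    TL (qpow F 5 * Vop 24 (psi2 F * Vop 2 (euler F) * Vop k'.+1 (borwein_b F))).
  move=> pk; have -> : qpow F 5 * Vop 24 (psi2 F * Vop 2 (euler F) * Vop k'.+1 (borwein_b F)) =
     (qpow F 3 * Vop (8 * 3) (psi2 F)) * ((qpow F 2 * Vop 48 (euler F)) * Vop (24 * k'.+1) (borwein_b F)).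
    rewrite q5 !(VopMS 23) !Vop_compS -[(24 * 2)%N]/48%N -[(8 * 3)%N]/24%N.
    by move: (Vop _ _) (Vop _ _) (Vop _ _) => z1 z2 z3; ring.
  by apply: theta_likeM => //; apply: theta_likeM => //; exact: tb.
have tg1 : TL (qpow F 5 * Vop 24 g1).
  have -> : g1 = psi2 F * Vop 2 (euler F) * Vop 1 (borwein_b F).
    by rewrite /g1; congr (_ * _); apply: seriesP => i /=; rewrite dvd1n divn1.
  by apply: tg => //; case: phE => ->.
have tg2 : TL (qpow F 5 * Vop 24 g2) by apply: tg => //; case: phE => ->.
apply: theta_likeD; last first.
  apply: theta_likeZ; apply: TL_weight => //.
  by apply: theta_likeD => //; exact: theta_likeZ.
have sQb' : (size (- Qb) <= (4 * k).+1)%N by rewrite size_polyN.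
rewrite (pevalE _ sQb') mulr_sumr rmorph_sum mulr_suml big_nat /=.
apply: theta_like_sum => i ik.
have -> : Vop 24 (w ^+ (2 * k) * (const (- Qb)`_i * p ^+ i)) * (qpow F 5 * Vop 24 g1) =
   const (- Qb)`_i * (Vop 24 (w ^+ (2 * k) * p ^+ i) * (qpow F 5 * Vop 24 g1)).
  exact: Vop_pull.
by apply: theta_likeZ; apply: TL_weight.
Qed.

End SixTheta.
End SixMod.

Lemma regular6_progression : exists A B, (0 < A)%N /\ forall i, (b 6 (A * i + B))%:R = 0 :> F.
Proof.
have m_odd : odd m by have [//|] := even_prime m_pr => m2; move: m5; rewrite m2.
have [n mn] : exists n, m = (2 * n).+1 by exists m./2; lia.
have [s ms] : exists s, (m * m)%N = (24 * s).+1.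
  have [t tE] : exists t, (n * n.+1 = 2 * t)%N.
    exists (n * n.+1)./2; have h : odd (n * n.+1) = false by rewrite oddM /= andbN.
    by rewrite -[LHS]odd_double_half h add0n mul2n.
  have m8 : (m * m = 8 * t + 1)%N by nia.
  have m3 : ~~ (3 %| m)%N by rewrite dvdn_prime2 //; lia.
  have [a [aE|aE]] : exists a, m = (3 * a + 1)%N \/ m = (3 * a + 2)%N by exists (m %/ 3)%N; lia.
    have h : (8 * t = 3 * (3 * (a * a) + 2 * a))%N by rewrite aE in m8; lia.
    by exists (t %/ 3)%N; lia.
  have h : (8 * t = 3 * (3 * (a * a) + 4 * a + 1))%N by rewrite aE in m8; lia.
  by exists (t %/ 3)%N; lia.
have [al [u [u0 [p [p0 [w [alA u0X [uq pq] pR wphi]]]]]]] := six_parameter F2.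
(* Primes congruent to 1 modulo the period 12: 13, with 13 - 1 a product of 2s and 3s, or 37 when m
   = 13. *)
have [ph [ph_pr phE ph1F phF]] : exists ph, [/\ prime ph, ph = 13 \/ ph = 37,
    ph.-1%:R != 0 :> F & ph%:R != 0 :> F].
  have nzF k : ~~ (m %| k)%N -> k%:R != 0 :> F by rewrite (dvdn_pcharf (pchar_Fp m_pr)).
  have [m13|m13] := eqVneq m 13%N.
    by exists 37%N; split=> //; [right|apply: nzF; rewrite m13|apply: nzF; rewrite m13].
  exists 13%N; split=> //; [by left| |by apply: nzF; rewrite dvdn_prime2 //].
  apply: nzF; rewrite -[13.-1]/(4 * 3)%N Euclid_dvdM // negb_or !gtnNdvd //; lia.
have tl := TL_regular6 alA u0X uq pq pR wphi ph_pr phE mn ms.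
have ph_odd : odd ph by case: phE => ->.
have ph12 : ph = 1 %[mod 12] by case: phE => ->.
have ph24 : coprime ph 24 by case: phE => ->.
have [A [B [A0 h]]] := theta_like_progression ph_pr ph_odd (isT : (0 < 12)%N) ph12 ph1F phF (isT : (0 < 24)%N) ph24 tl.
exists (m * m * A)%N, (m * m * B + 5 * s)%N; split; first by rewrite !muln_gt0 A0; lia.
move=> i; have := h i; rewrite coefUop /= => <-; congr (b 6 _)%:R; lia.
Qed.

End RegularSix.

Local Close Scope ring_scope.

Theorem theorem1p1 :
  (forall m : nat, prime m -> 2 <= m ->
     infinitely_many_ramanujan_congruences 4 m) /\
  (forall m : nat, prime m -> 5 <= m ->
     infinitely_many_ramanujan_congruences 6 m).
Proof.
split=> m m_pr m2.
  have [m_even|m_odd] := even_prime m_pr.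
    by rewrite m_even; exact: infinitely_many_of_one regular4_mod2.
  have [A [B [A0 h]]] := regular4_progression m_pr m_odd.
  exact: infinitely_many_of_one A0 (congruence_of_Fp m_pr h).
have [A [B [A0 h]]] := regular6_progression m_pr m2.
exact: infinitely_many_of_one A0 (congruence_of_Fp m_pr h).
Qed.
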